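(* Under the setting in the context, if $\langle\overline{\mathbf V}_{\boldsymbol\xi}\mathbf 1,\mathbf 1\rangle=0$, then $$\sum_{k=1}^n\begin{bmatrix} n^{-3}U_{k-1}^2\\ n^{-2}V_{k-1}^2\\ n^{-3/2}\langle\mathbf 1,\mathbf M_k\rangle U_{k-1}\\ n^{-3/2}\langle\tilde{\mathbf u},\mathbf M_k\rangle V_{k-1}\end{bmatrix}\xrightarrow{\mathcal D}\begin{bmatrix}\int_0^1\mathcal Y_t^2\,\mathrm dt\\ \frac{\langle\overline{\mathbf V}_{\boldsymbol\xi}\tilde{\mathbf u},\tilde{\mathbf u}\rangle}{4\alpha\beta}\int_0^1\mathcal Y_t\,\mathrm dt\\ \langle\mathbf V_{\boldsymbol\varepsilon}\mathbf 1,\mathbf 1\rangle^{1/2}\int_0^1\mathcal Y_t\,\mathrm d\widetilde{\widetilde{\mathcal W}}_t\\ \frac{\langle\overline{\mathbf V}_{\boldsymbol\xi}\tilde{\mathbf u},\tilde{\mathbf u}\rangle}{2\sqrt{\alpha\beta}}\int_0^1\mathcal Y_t\,\mathrm d\widetilde{\mathcal W}_t\end{bmatrix}$$ as $n\to\infty$, where $\mathcal Y_t=\langle\mathbf 1,\mathbf m_{\boldsymbol\varepsilon}\rangle t$ (deterministic) and $(\widetilde{\mathcal W}_t)_{t\ge0}$, $(\widetilde{\widetilde{\mathcal W}}_t)_{t\ge0}$ are independent standard Wiener processes.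
   Context: Setting: $\mathbf X_k=(X_{k,1},X_{k,2})^\top$, $\mathbf X_0=\mathbf 0$, and for $k\in\mathbb N$, $\mathbf X_k=\sum_{j=1}^{X_{k-1,1}}\boldsymbol\xi_{k,j,1}+\sum_{j=1}^{X_{k-1,2}}\boldsymbol\xi_{k,j,2}+\boldsymbol\varepsilon_k$, where $\{\boldsymbol\xi_{k,j,i},\boldsymbol\varepsilon_k:k,j\in\mathbb N,i\in\{1,2\}\}$ are independent $\mathbb Z_+^2$-valued random vectors and each of the families $\{\boldsymbol\xi_{k,j,1}\}$, $\{\boldsymbol\xi_{k,j,2}\}$, $\{\boldsymbol\varepsilon_k\}$ is identically distributed. $\mathbb E\boldsymbol\xi_{1,1,1}=(\alpha,\beta)^\top$, $\mathbb E\boldsymbol\xi_{1,1,2}=(\beta,\alpha)^\top$, so $\mathbf m_{\boldsymbol\xi}=\begin{bmatrix}\alpha&\beta\\\beta&\alpha\end{bmatrix}$, with $(\alpha,\beta)\in(0,1)^2$, $\alpha+\beta=1$. Assume $\mathbb E\|\boldsymbol\xi_{1,1,1}\|^8,\mathbb E\|\boldsymbol\xi_{1,1,2}\|^8,\mathbb E\|\boldsymbol\varepsilon_1\|^8<\infty$, $\mathbf m_{\boldsymbol\varepsilon}:=\mathbb E\boldsymbol\varepsilon_1\neq\mathbf 0$. $\mathbf V_{\boldsymbol\xi_i}=\operatorname{Var}(\boldsymbol\xi_{1,1,i})$, $\overline{\mathbf V}_{\boldsymbol\xi}=\frac12(\mathbf V_{\boldsymbol\xi_1}+\mathbf V_{\boldsymbol\xi_2})$,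 $\mathbf V_{\boldsymbol\varepsilon}=\operatorname{Var}(\boldsymbol\varepsilon_1)$, $\mathbf 1=(1,1)^\top$, $\tilde{\mathbf u}=(1,-1)^\top$. $\mathbf M_k=\mathbf X_k-\mathbf m_{\boldsymbol\xi}\mathbf X_{k-1}-\mathbf m_{\boldsymbol\varepsilon}$, $U_k=\langle\mathbf 1,\mathbf X_k\rangle$, $V_k=\langle\tilde{\mathbf u},\mathbf X_k\rangle$. *)

(* Defs.v *)
From HB Require Import structures.
From mathcomp Require Import all_boot all_order all_algebra.
From mathcomp Require Import all_classical all_reals all_analysis.
Set Implicit Arguments. Unset Strict Implicit. Unset Printing Implicit Defensive.
Import Order.TTheory GRing.Theory Num.Theory.
Import numFieldNormedType.Exports.
Local Open Scope classical_set_scope.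
Local Open Scope ring_scope.

Section Defs.
Context {R : realType} {d : measure_display} {T : measurableType d}.

(* expectation of a real random variable (meaningful for integrable f) *)
Definition Ex (P : probability T R) (f : T -> R) : R :=
  fine (\int[P]_w (f w)%:E).

Definition cov (P : probability T R) (f g : T -> R) : R :=
  Ex P (fun w => f w * g w) - Ex P f * Ex P g.

Definition cmp (i : 'I_2) (x : nat * nat) : R :=
  if i == ord0 then (x.1)%:R else (x.2)%:R.

Definition covmx (P : probability T R) (X : T -> nat * nat) : 'M[R]_2 :=
  \matrix_(i, j) cov P (fun w => cmp i (X w)) (fun w => cmp j (X w)).

Definition discrete_rv (X : T -> nat * nat) : Prop :=
  forall v, measurable [set w | X w = v].

Definition mutually_indep {I : eqType} (P : probability T R)
  (Y : I -> T -> nat * nat) : Prop :=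
  forall (s : seq I) (v : I -> nat * nat), uniq s ->
    P (\bigcap_(i in [set` s]) [set w | Y i w = v i])
    = (\prod_(i <- s) P [set w | Y i w = v i])%E.

(* the process: ξ k j i = ξ_{k+1,j+1,i} (i = false: type 1, true: type 2),
   ε k = ε_{k+1}; X 0 = 0 and
   X_{k+1} = sum_{j<X_{k,1}} ξ_{k+1,j+1,1} + sum_{j<X_{k,2}} ξ_{k+1,j+1,2} + ε_{k+1} *)
Fixpoint Xproc (xi : nat -> nat -> bool -> T -> nat * nat)
  (eps : nat -> T -> nat * nat) (k : nat) (w : T) : nat * nat :=
  match k with
  | 0 => (0, 0)%N
  | k'.+1 =>
    let x := Xproc xi eps k' w in
    ((\sum_(j < x.1) (xi k' j false w).1 + \sum_(j < x.2) (xi k' j true w).1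
       + (eps k' w).1)%N,
     (\sum_(j < x.1) (xi k' j false w).2 + \sum_(j < x.2) (xi k' j true w).2
       + (eps k' w).2)%N)
  end.

End Defs.

Section Vec.
Context {R : realType}.
Definition vec1 : 'cV[R]_2 := \col_(i < 2) 1.
Definition util : 'cV[R]_2 := \col_(i < 2) (if i == ord0 then 1 else -1).
Definition qf (A : 'M[R]_2) (u : 'cV[R]_2) : R := ((u^T *m A) *m u) ord0 ord0.

Definition gauss_cdf (v x : R) : \bar R :=
  (\int[lebesgue_measure]_(y in `]-oo, x]) (normal_pdf 0 (Num.sqrt v) y)%:E)%E.

(* Wiener integral of a deterministic continuous integrand f over [0,1]
   as the pathwise limit of dyadic Riemann(-Stieltjes) sums *)
Definition wiener_int (f : R -> R) (W : R -> R) : R :=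
  limn (fun n : nat => \sum_(i < 2 ^ n)
     f (i%:R / (2 ^ n)%:R) * (W (i.+1%:R / (2 ^ n)%:R) - W (i%:R / (2 ^ n)%:R))).

Definition row4 (a b c e : R) : 'rV[R]_4 := \row_(i < 4) [:: a; b; c; e]`_i.
End Vec.

Section Wiener.
Context {R : realType} {d : measure_display} {T : measurableType d}.

(* two independent standard Wiener processes on (T, Q):
   W 0 = 0, continuous paths, each W t a random variable, and, for every
   finite grid 0 = t_0 < t_1 < ... < t_m, the 2m increments are independent
   with W_a(t_{i+1}) - W_a(t_i) ~ N(0, t_{i+1} - t_i) (joint distribution
   functions factorize into Gaussian distribution functions) *)
Definition indep_std_wiener2 (Q : probability T R) (W1 W2 : R -> T -> R) : Prop :=
  (forall w, W1 0 w = 0 /\ W2 0 w = 0) /\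
  (forall w, continuous (fun t => W1 t w) /\ continuous (fun t => W2 t w)) /\
  (forall t, measurable_fun setT (W1 t) /\ measurable_fun setT (W2 t)) /\
  (forall (m : nat) (ts : nat -> R) (x y : nat -> R),
     ts 0%N = 0 -> (forall i, (i < m)%N -> ts i < ts i.+1) ->
     Q (\bigcap_(i in [set i | (i < m)%N])
          ([set w | W1 (ts i.+1) w - W1 (ts i) w <= x i] `&`
           [set w | W2 (ts i.+1) w - W2 (ts i) w <= y i]))
     = (\prod_(i < m) (gauss_cdf (ts i.+1 - ts i) (x i)
                       * gauss_cdf (ts i.+1 - ts i) (y i)))%E).

Definition cvg_dist {d' : measure_display} {T' : measurableType d'}
  (P : probability T' R) (Zn : nat -> T' -> 'rV[R]_4)
  (Q : probability T R) (Z : T -> 'rV[R]_4) : Prop :=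
  forall g : 'rV[R]_4 -> R, continuous g -> (exists M, forall z, `|g z| <= M) ->
    (fun n => Ex P (fun w => g (Zn n w))) @ \oo --> Ex Q (fun w => g (Z w)).
End Wiener.

(* Main.v *)
Require Import Defs.
From HB Require Import structures.
From mathcomp Require Import all_boot all_order all_algebra.
From mathcomp Require Import all_classical all_reals all_analysis.
From mathcomp Require Import measurable_realfun ring lra.
Import Order.TTheory GRing.Theory Num.Theory.
Import numFieldNormedType.Exports.
Local Open Scope classical_set_scope.
Local Open Scope ring_scope.
Set Implicit Arguments.
Unset Strict Implicit.
Unset Printing Implicit Defensive.

(** If the variance of the offspring total in the direction (1,1) vanishes, every individual has
    almost surely exactly one child, so U is a random walk with the immigrants as increments,
    U_k ~ m k, and V is a stable autoregression with coefficient delta = alpha - beta whose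
    innovations d_k have conditional variance gam U_k + const, gam = 4 alpha beta. For a linear
    combination Phi_n of the four sums, centred at the limits of the first two, and rho three times
    its limiting variance, w_k E cos(Phi_k + theta), w_k = exp(rho/2 * (1/n) sum_(j<k) (j/n)^2), is
    shown to be constant up to O(n^-1/2) by telescoping in k; the term V_k^2 is replaced by U_k
    through the corrector V_k^2 - V_(k+1)^2, which telescopes against a slowly varying factor.
    Together with second moment bounds, the limits of E cos give convergence of E g for every
    bounded continuous g: g is approximated on boxes by trigonometric polynomials bounded by the
    same constant, obtained as Bernstein-type random walk averages. The characteristic function of
    the Wiener integrals is computed from the Gaussian increments on dyadic grids. *)

(** * Expectations and independence *)

(** The conditional variance of d_k grows like U_k, which is of order n, while the fluctuation of
    one immigration has constant variance. Their covariance is a constant, so after rescaling it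
    carries a factor n^(-1/2): this is why the two Wiener processes are independent although the
    same immigrants drive both sums. Since U_k/n is deterministic to leading order, the conditional
    variances in the third sum are matched by the deterministic weight w_k. Those in the fourth sum
    contain V_k^2/n, which settles only on average; the corrector removes this obstacle. It works
    because V_k^2 - V_(k+1)^2 has conditional mean gam (V_k^2 - U_k) up to lower order: the
    contraction 1 - delta^2 and the variance per individual are the same number gam. The factor
    three in rho is the inverse of the integral of t^2 over [0,1]. Eighth moments enter through
    |V|^3 times the fourth power of an innovation, whose conditional fourth moment is quadratic in
    U. Only real cosines with a free phase occur; a phase shift by pi/2 supplies the sines. *)

Section Expectation.
Context {R : realType} {d : measure_display} {T : measurableType d}.
Variable P : probability T R.
Implicit Types f g : T -> R.

Definition L1 f := P.-integrable setT (EFin \o f).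

Lemma L1_measurable f : L1 f -> measurable_fun setT f.
Proof. by move/measurable_int/measurable_EFinP. Qed.

Lemma L1_le f g : measurable_fun setT f -> L1 g ->
  (forall w, `|f w| <= g w) -> L1 f.
Proof.
move=> mf ig fg; apply: (le_integrable _ _ _ ig) => //=.
  exact/measurable_EFinP.
by move=> w _; rewrite lee_fin (le_trans (fg w))// ler_norm.
Qed.

Lemma L1_cst c : L1 (fun=> c).
Proof. exact: finite_measure_integrable_cst. Qed.

Lemma L1_bounded f c : measurable_fun setT f -> (forall w, `|f w| <= c) -> L1 f.
Proof. by move=> mf fc; apply: L1_le (L1_cst c) fc. Qed.

Lemma L1D f g : L1 f -> L1 g -> L1 (fun w => f w + g w).
Proof. by move=> f1 g1; exact: (integrableD measurableT f1 g1). Qed.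

Lemma L1B f g : L1 f -> L1 g -> L1 (fun w => f w - g w).
Proof. by move=> f1 g1; exact: (integrableB measurableT f1 g1). Qed.

Lemma L1Z c f : L1 f -> L1 (fun w => c * f w).
Proof. by move=> f1; exact: (integrableZl measurableT c f1). Qed.

Lemma L1_norm f : L1 f -> L1 (fun w => `|f w|).
Proof. exact: integrable_norm. Qed.

Lemma L1_sum (I : Type) (s : seq I) (F : I -> T -> R) :
  (forall i, L1 (F i)) -> L1 (fun w => \sum_(i <- s) F i w).
Proof.
move=> iF; elim: s => [|i s IH].
  by under eq_fun do rewrite big_nil; exact: L1_cst.
by under eq_fun do rewrite big_cons; exact: L1D.
Qed.

Lemma Ex_cst c : Ex P (fun=> c) = c.
Proof. by rewrite /Ex integral_cst// [X in (_ * X)%E]probability_setT mule1. Qed.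

Lemma eq_Ex f g : f =1 g -> Ex P f = Ex P g.
Proof. by move=> /funext ->. Qed.

Lemma ExD f g : L1 f -> L1 g -> Ex P (fun w => f w + g w) = Ex P f + Ex P g.
Proof. exact: RintegralD. Qed.

Lemma ExB f g : L1 f -> L1 g -> Ex P (fun w => f w - g w) = Ex P f - Ex P g.
Proof. exact: RintegralB. Qed.

Lemma ExZ c f : L1 f -> Ex P (fun w => c * f w) = c * Ex P f.
Proof. exact: RintegralZl. Qed.

Lemma Ex_sum (I : Type) (s : seq I) (F : I -> T -> R) :
  (forall i, L1 (F i)) ->
  Ex P (fun w => \sum_(i <- s) F i w) = \sum_(i <- s) Ex P (F i).
Proof.
move=> iF; elim: s => [|i s IH].
  by rewrite big_nil; under eq_Ex do rewrite big_nil; exact: Ex_cst.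
rewrite big_cons -IH -ExD//; last exact: L1_sum.
by apply: eq_Ex => w; rewrite big_cons.
Qed.

Lemma Ex_ge0 f : (forall w, 0 <= f w) -> 0 <= Ex P f.
Proof. by move=> f0; apply: Rintegral_ge0. Qed.

Lemma Ex_le f g : L1 f -> L1 g -> (forall w, f w <= g w) -> Ex P f <= Ex P g.
Proof. by move=> f1 g1 fg; apply: le_Rintegral. Qed.

Lemma Ex_norm f : L1 f -> `|Ex P f| <= Ex P (fun w => `|f w|).
Proof. by move=> f1; apply: le_normr_Rintegral. Qed.

Lemma Ex_norm_le f g : L1 f -> L1 g -> (forall w, `|f w| <= g w) ->
  `|Ex P f| <= Ex P g.
Proof.
move=> f1 g1 fg; apply: le_trans (Ex_norm f1) _.
by apply: Ex_le => //; exact: L1_norm.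
Qed.

Lemma Ex_norm_bounded f c : measurable_fun setT f -> (forall w, `|f w| <= c) ->
  `|Ex P f| <= c.
Proof.
move=> mf fc; rewrite -(Ex_cst c); apply: Ex_norm_le => //; last exact: L1_cst.
exact: L1_bounded fc.
Qed.

Lemma integral_Ex f : L1 f -> (\int[P]_w (f w)%:E = (Ex P f)%:E)%E.
Proof. by move=> f1; rewrite fineK// integrable_fin_num. Qed.

Lemma L1_ge0P f : measurable_fun setT f -> (forall w, 0 <= f w) ->
  (\int[P]_w (f w)%:E < +oo)%E -> L1 f.
Proof.
move=> mf f0 fi; apply/integrableP; split; first exact/measurable_EFinP.
by under eq_integral => w _ do rewrite /= ger0_norm ?f0//.
Qed.

Lemma Ex_ae f g : measurable_fun setT f -> measurable_fun setT g ->
  (forall A, measurable A -> (forall w, f w != g w -> A w) -> P A = 0%E ->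
   Ex P f = Ex P g).
Proof.
move=> mf mg A mA fg A0; congr fine; apply: ae_eq_integral => //.
- exact/measurable_EFinP.
- exact/measurable_EFinP.
- exists A; split => // w /= /not_implyP[_ /eqP]; rewrite eqe; exact: fg.
Qed.

End Expectation.

(** * Independence of sigma-algebras generated by disjoint families *)

Section Independence.
Context {R : realType} {d : measure_display} {T : measurableType d}.
Variable P : probability T R.

(** The hypothesis makes the joint law of [X1] and [X2] the product of their laws, by uniqueness of
    product measures; Fubini does the rest. The target spaces are arbitrary so that [X1] and [X2]
    may also be the identity of [T] into [T] with a smaller sigma-algebra, as in [known_Ex]. *)
Lemma indep_Ex {d1 d2} {T1 : measurableType d1} {T2 : measurableType d2}
    (X1 : {mfun T >-> T1}) (X2 : {mfun T >-> T2}) (H : T1 -> R) (K : T2 -> R) :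
  (forall A B, measurable A -> measurable B ->
     P (X1 @^-1` A `&` X2 @^-1` B) = (P (X1 @^-1` A) * P (X2 @^-1` B))%E) ->
  measurable_fun setT H -> measurable_fun setT K ->
  L1 P (H \o X1) -> L1 P (K \o X2) ->
  L1 P (fun w => H (X1 w) * K (X2 w)) /\
  Ex P (fun w => H (X1 w) * K (X2 w)) = Ex P (H \o X1) * Ex P (K \o X2).
Proof.
move=> ind mH mK iH iK.
have mXX : measurable_fun setT (fun w => (X1 w, X2 w)).
  exact: measurable_fun_pair.
pose XX : {mfun T >-> (T1 * T2)%type} := mfun_Sub (mem_set mXX).
pose m1 := distribution P X1; pose m2 := distribution P X2.
have jointE A : measurable A -> (m1 \x m2)%E A = distribution P XX A.
  move=> mA; apply: (product_measure_unique (m' := distribution P XX)) => //.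
pose HK z : \bar R := (H z.1 * K z.2)%:E.
have mHK : measurable_fun setT HK.
  apply/measurable_EFinP; apply: measurable_funM.
    exact: measurableT_comp mH _.
  exact: measurableT_comp mK _.
have mEH : measurable_fun setT (EFin \o H) by exact/measurable_EFinP.
have mEK : measurable_fun setT (EFin \o K) by exact/measurable_EFinP.
have iH1 : m1.-integrable setT (EFin \o H).
  exact: (integrable_pushforward (mu := P) (phi := X1) _ mEH).
have iK1 : m2.-integrable setT (EFin \o K).
  exact: (integrable_pushforward (mu := P) (phi := X2) _ mEK).
have eqI : (\int[m1 \x m2]_z `|HK z| = \int[P]_w `|HK (XX w)|)%E.
  rewrite (eq_measure_integral (distribution P XX)); last by move=> A mA _; exact: jointE.
  by rewrite ge0_integral_pushforward//; exact: measurableT_comp.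
have iHK : (m1 \x m2)%E.-integrable setT HK.
  apply/integrable12ltyP => //=.
  under eq_integral => x _.
    under eq_integral => y _ do rewrite normrM EFinM.
    rewrite ge0_integralZl//; last first.
      by apply/measurable_EFinP; exact: measurableT_comp.
    over.
  have -> : (fun x => `|H x|%:E * \int[m2]_y `|K y|%:E)%E =
            (fun x => (\int[m2]_y `|K y|%:E) * `|H x|%:E)%E.
    by apply/funext => x; rewrite muleC.
  rewrite ge0_integralZl//; last 2 first.
  - by apply/measurable_EFinP; exact: measurableT_comp.
  - by apply: integral_ge0.
  have /integrableP[_ fH] := iH1; have /integrableP[_ fK] := iK1.
  apply: lte_mul_pinfty => //; first exact: integral_ge0.
  by rewrite ge0_fin_numE//; exact: integral_ge0.
have iP : L1 P (fun w => H (X1 w) * K (X2 w)).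
  apply/integrableP; split.
    apply/measurable_EFinP; apply: measurable_funM.
      exact: measurableT_comp mH _.
    exact: measurableT_comp mK _.
  by have /integrableP[_] := iHK; rewrite eqI.
split => //; apply: EFin_inj; rewrite EFinM -!integral_Ex//.
have <- : (\int[m1 \x m2]_z HK z = \int[P]_w (H (X1 w) * K (X2 w))%:E)%E.
  rewrite (eq_measure_integral (distribution P XX)); last by move=> A mA _; exact: jointE.
  by rewrite integral_pushforward.
rewrite -integral12_prod_meas1//.
transitivity (\int[m1]_x ((H x)%:E * \int[m2]_y (K y)%:E))%E.
  apply: eq_integral => x _; rewrite -integralZl//.
have -> : (fun x => (H x)%:E * \int[m2]_y (K y)%:E)%E =
          (fun x => (Ex P (K \o X2))%:E * (H x)%:E)%E.
  apply/funext => x; rewrite muleC; congr (_ * _)%E.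
  by rewrite -integral_Ex// (integral_distribution (X := X2)).
rewrite integralZl// muleC -integral_Ex//; congr (_ * _)%E.
  by rewrite (integral_distribution (X := X1)).
Qed.

Context {I : eqType} (Y : I -> T -> nat * nat).
Hypothesis mY : forall i, discrete_rv (Y i).
Hypothesis indY : mutually_indep P Y.

Definition atom_of (s : seq I) (v : I -> nat * nat) :=
  \bigcap_(i in [set` s]) [set w | Y i w = v i].

(** The empty set is included to obtain a pi-system: atoms that prescribe different values for the
    same index are disjoint. *)
Definition cylinders (A : set I) : set (set T) :=
  [set E | E = set0 \/ exists s v,
     [/\ uniq s, (forall i, i \in s -> A i) & E = atom_of s v]].

Lemma measurable_atom s v : measurable (atom_of s v).
Proof. by apply: fin_bigcap_measurable => // i _; exact: mY. Qed.

Lemma measurable_cylinders A E : cylinders A E -> measurable E.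
Proof. by case=> [->//|[s [v [_ _ ->]]]]; exact: measurable_atom. Qed.

Lemma sigma_cylinders_measurable A E : <<s cylinders A >> E -> measurable E.
Proof.
move: E; apply: smallest_sub; first exact: sigma_algebra_measurable.
exact: measurable_cylinders.
Qed.

Lemma cylindersT A : cylinders A setT.
Proof.
right; exists [::], (fun=> (0, 0)%N); split => //.
by apply/seteqP; split.
Qed.

Lemma cylindersI A : setI_closed (cylinders A).
Proof.
move=> E F [->|[s [v [us sA ->]]]]; first by rewrite set0I; left.
move=> [->|[s' [v' [us' sA' ->]]]]; first by rewrite setI0; left.
have [agree|] := pselect (forall i, i \in s -> i \in s' -> v i = v' i).
  right; exists (undup (s ++ s')), (fun i => if i \in s then v i else v' i).
  split; first exact: undup_uniq.
    by move=> i; rewrite mem_undup mem_cat => /orP[/sA|/sA'].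
  apply/seteqP; split => w.
    move=> [h h'] i /=; rewrite mem_undup mem_cat.
    by case: ifP => [/h//|_ /= /h'].
  move=> h; split => i /= ii.
    by have /= := h i; rewrite mem_undup mem_cat ii => ->.
  have /= := h i; rewrite mem_undup mem_cat ii orbT => -> //.
  by case: ifP => // iis; rewrite agree.
move=> /existsNP[i /not_implyP[is1 /not_implyP[is2 vi]]]; left.
apply/seteqP; split => // w [h h']; apply: vi.
by rewrite -(h i is1) -(h' i is2).
Qed.

Lemma P_atom s v : uniq s ->
  P (atom_of s v) = (\prod_(i <- s) P [set w | Y i w = v i])%E.
Proof. exact: indY. Qed.

Lemma cylinders_indep A B E F : (forall i, A i -> B i -> False) ->
  cylinders A E -> cylinders B F -> P (E `&` F) = (P E * P F)%E.
Proof.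
move=> AB [->|[s [v [us sA ->]]]]; first by rewrite set0I measure0 mul0e.
move=> [->|[s' [v' [us' sB ->]]]]; first by rewrite setI0 measure0 mule0.
have dis i : i \in s' -> i \notin s.
  by move=> /sB Bi; apply/negP => /sA Ai; exact: AB Bi.
pose u i := if i \in s then v i else v' i.
have -> : atom_of s v = atom_of s u.
  by apply/seteqP; split => w h i /= ii; have /= := h i ii; rewrite /u ii.
have -> : atom_of s' v' = atom_of s' u.
  by apply/seteqP; split => w h i /= ii; have /= := h i ii;
    rewrite /u (negbTE (dis _ ii)).
have -> : atom_of s u `&` atom_of s' u = atom_of (s ++ s') u.
  apply/seteqP; split => w.
    by move=> [h h'] i /=; rewrite mem_cat => /orP[/h|/h'].
  by move=> h; split => i /= ii; apply: h; rewrite /= mem_cat ii ?orbT.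
rewrite !P_atom//; last first.
  rewrite cat_uniq us us' andbT/=; apply/hasPn => i; exact: dis.
by rewrite big_cat.
Qed.

(** A pi-lambda argument in each event. With one event fixed, both sides are finite measures of the
    other one that agree on the pi-system [cylinders], hence on the generated sigma-algebra. This is
    [half], used once against a cylinder and once against a general event. *)
Lemma sigma_cylinders_indep A B E F : (forall i, A i -> B i -> False) ->
  <<s cylinders A >> E -> <<s cylinders B >> F -> P (E `&` F) = (P E * P F)%E.
Proof.
have half A' B' E' F' : (forall i, A' i -> B' i -> False) ->
    (forall E, cylinders A' E -> P (E `&` F') = (P E * P F')%E) ->
    measurable F' -> <<s cylinders A' >> E' -> P (E' `&` F') = (P E' * P F')%E.
  move=> AB cylE mF sE.
  have r0 : 0 <= fine (P F') by exact: fine_ge0.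
  have := @g_sigma_algebra_measure_unique _ R T (cylinders A')
    (@measurable_cylinders A') (fun=> setT) (fun=> cylindersT A') _
    (mrestr P mF) (mscale (NngNum r0) P) (@cylindersI A').
  have PF : (fine (P F'))%:E = P F' by rewrite fineK// fin_num_measure.
  have PFE C : mscale (NngNum r0) P C = (P C * P F')%E.
    by rewrite /mscale/= PF muleC.
  move=> H; rewrite -PFE -H //.
  - by rewrite bigcup_const.
  - by move=> C /cylE cC; transitivity (P C * P F')%E => //; rewrite -PFE.
  - move=> _; change (P (setT `&` F') < +oo)%E.
    by rewrite setTI -ge0_fin_numE// fin_num_measure.
move=> AB sE sF; apply: (half A B) => //; last first.
  exact: sigma_cylinders_measurable sF.
move=> E' cE; rewrite setIC muleC; apply: (half _ A) sF => //.
- by move=> i /[swap]; exact: AB.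
- by move=> F' cF; rewrite setIC muleC; exact: cylinders_indep cE cF.
- exact: measurable_cylinders cE.
Qed.

(* [known A H]: the random variable [H] is a function of [(Y i)_(i in A)]. *)
Definition known (A : set I) (H : T -> R) :=
  measurable_fun setT (H : g_sigma_algebraType (cylinders A) -> R).

Lemma known_measurable A H : known A H -> measurable_fun setT H.
Proof.
move=> kH _ B mB; rewrite setTI; apply: (@sigma_cylinders_measurable A).
by have := kH measurableT B mB; rewrite setTI.
Qed.

Lemma known_Ex A B H K : (forall i, A i -> B i -> False) ->
  known A H -> known B K -> L1 P H -> L1 P K ->
  L1 P (fun w => H w * K w) /\ Ex P (fun w => H w * K w) = Ex P H * Ex P K.
Proof.
move=> AB kH kK iH iK.
(* The random variable is the identity of [T], its target carrying only the events generated by the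
   cylinders; then [known] is measurability on the target. *)
have mid C : measurable_fun setT (id : T -> g_sigma_algebraType (cylinders C)).
  by move=> _ E mE; rewrite setTI; exact: sigma_cylinders_measurable mE.
pose X1 : {mfun T >-> g_sigma_algebraType (cylinders A)} := mfun_Sub (mem_set (mid A)).
pose X2 : {mfun T >-> g_sigma_algebraType (cylinders B)} := mfun_Sub (mem_set (mid B)).
apply: (indep_Ex (X1 := X1) (X2 := X2) _ kH kK) => // E F mE mF.
exact: sigma_cylinders_indep mE mF.
Qed.

Lemma sub_known A B H : (forall i, A i -> B i) -> known A H -> known B H.
Proof.
move=> AB kH _ C mC; have := kH measurableT C mC; rewrite !setTI.
apply: sub_sigma_algebra2 => E [->|[s [v [us sA ->]]]]; first by left.
by right; exists s, v; split => // i /sA /AB.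
Qed.

End Independence.

(** * Measurability of countably valued variables *)

Lemma measurable_glue {d d' : measure_display} {T : measurableType d}
    {T' : measurableType d'} (N : T -> nat) (F : nat -> T -> T') :
  measurable_fun setT N -> (forall n, measurable_fun setT (F n)) ->
  measurable_fun setT (fun w => F (N w) w).
Proof.
move=> mN mF _ B mB; rewrite setTI.
have -> : (fun w => F (N w) w) @^-1` B =
    \bigcup_n (N @^-1` [set n] `&` F n @^-1` B).
  apply/seteqP; split => [w Bw|w [n _ [/= -> //]]].
  by exists (N w).
apply: bigcupT_measurable => n; apply: measurableI.
  by rewrite -[X in measurable X]setTI; exact: mN.
by rewrite -[X in measurable X]setTI; exact: mF.
Qed.

(** Every set of codes is a countable union of points, so measurable atoms give measurability for
    the discrete sigma-algebra of [nat]. *)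
Lemma measurable_pickle {d : measure_display} {T : measurableType d}
    (X : T -> nat * nat) :
  (forall v, measurable [set w | X w = v]) ->
  measurable_fun setT (fun w => pickle (X w)).
Proof.
move=> mX _ B mB; rewrite setTI.
have -> : (fun w => pickle (X w)) @^-1` B =
    \bigcup_(n in B) [set w | pickle (X w) = n].
  apply/seteqP; split => [w Bw|w [n Bn /= XnE]]; last by rewrite -XnE in Bn.
  by exists (pickle (X w)).
apply: bigcup_measurable => n _.
case E : (pickle_inv (T := (nat * nat)%type) n) => [v|].
  have -> : [set w | pickle (X w) = n] = [set w | X w = v]; last exact: mX.
  apply/seteqP; split => w /=.
    by move=> Xn; move: E; rewrite -Xn pickleK_inv => -[].
  by move=> ->; have := @pickle_invK (nat * nat)%type n; rewrite E.
have -> : [set w | pickle (X w) = n] = set0; last exact: measurable0.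
by apply/seteqP; split => // w /= Xn; move: E; rewrite -Xn pickleK_inv.
Qed.

Lemma measurable_atoms_comp {d d' : measure_display} {T : measurableType d}
    {T' : measurableType d'} (X : T -> nat * nat) (F : nat * nat -> T -> T') :
  (forall v, measurable [set w | X w = v]) ->
  (forall v, measurable_fun setT (F v)) ->
  measurable_fun setT (fun w => F (X w) w).
Proof.
move=> mX mF.
have -> : (fun w => F (X w) w) =
    fun w => F (odflt (0, 0)%N (unpickle (pickle (X w)))) w.
  by apply/funext => w; rewrite pickleK.
exact: (measurable_glue (F := fun n => F (odflt (0, 0)%N (unpickle n)))
  (measurable_pickle mX)).
Qed.

(** * Variables with the same atom probabilities *)

Section IdenticalLaw.
Context {R : realType} {d : measure_display} {T : measurableType d}.
Variable P : probability T R.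
Variables X X' : T -> nat * nat.
Hypotheses (mX : discrete_rv X) (mX' : discrete_rv X').
Hypothesis eqlaw : forall v, P [set w | X w = v] = P [set w | X' w = v].

(** The law of a countably valued variable is a sum of point masses, so equal atom probabilities
    give equal laws of the [pickle] codes; [f] is transported along the coding. *)
Lemma ge0_integral_same_law (f : nat * nat -> \bar R) : (forall v, 0 <= f v)%E ->
  (\int[P]_w f (X w) = \int[P]_w f (X' w))%E.
Proof.
move=> f0.
pose N : {mfun T >-> nat} := mfun_Sub (mem_set (measurable_pickle mX)).
pose N' : {mfun T >-> nat} := mfun_Sub (mem_set (measurable_pickle mX')).
pose F n := f (odflt (0, 0)%N (unpickle n)).
have eqF Z : (fun w => f (Z w)) = F \o (fun w : T => pickle (Z w)).
  by apply/funext => w; rewrite /F/= pickleK.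
have atomE (Z : T -> nat * nat) n : (fun w => pickle (Z w)) @^-1` [set n] =
    if pickle_inv (T := (nat * nat)%type) n is Some v then [set w | Z w = v]
    else set0.
  case E : pickle_inv => [v|]; apply/seteqP; split => // w /=.
  - by move=> Zn; apply: Some_inj; rewrite -E -Zn pickleK_inv.
  - by move=> ->; have := @pickle_invK (nat * nat)%type n; rewrite E.
  - by move=> Zn; move: E; rewrite -Zn pickleK_inv.
rewrite !eqF.
rewrite -(@ge0_integral_distribution _ _ _ _ _ P N F)//; last first.
  by move=> ?; exact: f0.
rewrite -(@ge0_integral_distribution _ _ _ _ _ P N' F)//; last first.
  by move=> ?; exact: f0.
apply: eq_measure_integral => A _ _.
have splitA : A = \bigcup_(n in A) [set n].
  by apply/seteqP; split => [n An|n [k Ak ->//]]; exists n.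
rewrite splitA !measure_bigcup//; try by move=> i j _ _ [x [-> ->]].
apply: eq_eseriesr => n _; rewrite /distribution/pushforward/=.
rewrite [X in P X = _]atomE [X in _ = P X]atomE.
by case: pickle_inv.
Qed.

Lemma L1_same_law (f : nat * nat -> R) :
  L1 P (fun w => f (X' w)) -> L1 P (fun w => f (X w)).
Proof.
move=> /integrableP[mf ff]; apply/integrableP; split.
  by apply/measurable_EFinP; apply: (measurable_atoms_comp (F := fun v _ => f v)).
by rewrite (ge0_integral_same_law (f := fun v => `|(f v)%:E|)%E).
Qed.

Lemma Ex_same_law (f : nat * nat -> R) :
  Ex P (fun w => f (X w)) = Ex P (fun w => f (X' w)).
Proof.
have posE Z : (fun w : T => (f (Z w))%:E)^\+%E = (EFin \o f)^\+%E \o Z.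
  by rewrite -funepos_comp.
have negE Z : (fun w : T => (f (Z w))%:E)^\-%E = (EFin \o f)^\-%E \o Z.
  by rewrite -funeneg_comp.
rewrite /Ex [in LHS]integralE [in RHS]integralE !posE !negE.
congr (fine (_ - _)%E).
  exact: (ge0_integral_same_law (@funepos_ge0 _ _ (EFin \o f))).
exact: (ge0_integral_same_law (@funeneg_ge0 _ _ (EFin \o f))).
Qed.

End IdenticalLaw.

(** * Closure properties of [known] *)

Section Known.
Context {R : realType} {d : measure_display} {T : measurableType d}.
Context {I : eqType} (Y : I -> T -> nat * nat).
Implicit Types (A : set I) (H K : T -> R).

Lemma known_cst A (c : R) : known Y A (fun=> c).
Proof. exact: measurable_cst. Qed.

Lemma knownD A H K : known Y A H -> known Y A K -> known Y A (fun w => H w + K w).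
Proof. exact: measurable_funD. Qed.

Lemma knownB A H K : known Y A H -> known Y A K -> known Y A (fun w => H w - K w).
Proof. exact: measurable_funB. Qed.

Lemma knownM A H K : known Y A H -> known Y A K -> known Y A (fun w => H w * K w).
Proof. exact: measurable_funM. Qed.

Lemma knownX A H n : known Y A H -> known Y A (fun w => H w ^+ n).
Proof. exact: measurable_funX. Qed.

Lemma known_comp A H (f : R -> R) : measurable_fun setT f -> known Y A H ->
  known Y A (fun w => f (H w)).
Proof. by move=> mf kH; apply: measurableT_comp mf kH. Qed.

Definition knownN A (X : T -> nat * nat) :=
  forall v, <<s cylinders Y A >> [set w | X w = v].

Lemma sub_cylinders A B : (forall i, A i -> B i) -> cylinders Y A `<=` cylinders Y B.
Proof.
move=> AB E [->|[s [v [us sA ->]]]]; first by left.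
by right; exists s, v; split => // i /sA /AB.
Qed.

Lemma sub_knownN A B X : (forall i, A i -> B i) -> knownN A X -> knownN B X.
Proof. by move=> AB kX v; exact: (sub_sigma_algebra2 (sub_cylinders AB)) (kX v). Qed.

Lemma knownN_glue A (X : T -> nat * nat) (F : nat * nat -> T -> R) :
  knownN A X -> (forall v, known Y A (F v)) -> known Y A (fun w => F (X w) w).
Proof.
exact: (@measurable_atoms_comp _ _ (g_sigma_algebraType (cylinders Y A)) R X F).
Qed.

Lemma knownN_comp A (X : T -> nat * nat) (f : nat * nat -> R) :
  knownN A X -> known Y A (fun w => f (X w)).
Proof.
by move=> kX; apply: (knownN_glue (F := fun v _ => f v)) => // v; exact: known_cst.
Qed.

Lemma knownN_cmp A (X : T -> nat * nat) :
  known Y A (fun w => (X w).1%:R : R) -> known Y A (fun w => (X w).2%:R : R) ->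
  knownN A X.
Proof.
move=> k1 k2 [a b].
have -> : [set w | X w = (a, b)] =
    (fun w => (X w).1%:R : R) @^-1` [set a%:R] `&`
    (fun w => (X w).2%:R : R) @^-1` [set b%:R].
  apply/seteqP; split => w /= => [-> //|[]].
  by move=> /eqP; rewrite eqr_nat => /eqP + /eqP; rewrite eqr_nat => + /eqP;
    case: (X w) => /= x y -> ->.
apply: (@measurableI _ (g_sigma_algebraType (cylinders Y A))).
  by rewrite -[X in measurable X]setTI; apply: k1.
by rewrite -[X in measurable X]setTI; apply: k2.
Qed.

Lemma knownN_self A i : A i -> knownN A (Y i).
Proof.
move=> Ai v; apply: sub_sigma_algebra; right.
exists [:: i], (fun=> v); split => //.
  by move=> j; rewrite inE => /eqP ->.
apply/seteqP; split => w /= => [Yi j|].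
  by rewrite /= inE => /eqP ->.
by apply; rewrite /= inE.
Qed.

End Known.

(** * Trigonometric estimates and approximation *)

Section TrigBounds.
Context {R : realType}.
Implicit Types x y z p : R.

Lemma sin_lipschitz x y : `|sin x - sin y| <= `|x - y|.
Proof.
wlog xy : x y / x < y.
  move=> H; have [xy|yx|->] := ltgtP x y; last by rewrite !subrr normr0.
    exact: H.
  by rewrite distrC [leRHS]distrC; exact: H.
have [c _ E] := MVT xy (fun z _ => is_derive_sin z)
  (continuous_subspaceT (@continuous_sin R)).
by rewrite distrC E [leRHS]distrC normrM ler_piMl// cos_max.
Qed.

Lemma cos_lipschitz x y : `|cos x - cos y| <= `|x - y|.
Proof.
rewrite -!sinDpihalf (_ : x - y = x + pi / 2 - (y + pi / 2)); last by ring.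
exact: sin_lipschitz.
Qed.

Lemma sin_norm_le x : `|sin x| <= `|x|.
Proof. by have := sin_lipschitz x 0; rewrite sin0 !subr0. Qed.

Lemma cos_half x : 1 - cos x = 2 * sin (x / 2) ^+ 2.
Proof.
rewrite sin2cos2 {1}(_ : x = (x / 2) *+ 2) ?cos_mulr2n; last by rewrite -mulr_natr divfK.
by ring.
Qed.

Lemma cos_sub1_bound x : 0 <= 1 - cos x <= x ^+ 2 / 2.
Proof.
rewrite cos_half mulr_ge0 ?sqr_ge0//=.
have : sin (x / 2) ^+ 2 <= (x / 2) ^+ 2.
  rewrite -[leLHS]real_normK ?num_real// -[leRHS]real_normK ?num_real//.
  by apply: lerXn2r; rewrite ?nnegrE//; exact: sin_norm_le.
by rewrite expr_div_n; lra.
Qed.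

Lemma sin_sub_bound x : `|sin x - x| <= `|x| ^+ 3 / 2.
Proof.
wlog x0 : x / 0 < x.
  move=> H; have [x0|x0|<-] := ltgtP 0 x; [exact: H| |].
    by have := H (- x); rewrite oppr_gt0 sinN normrN -opprD normrN; exact.
  by rewrite sin0 subrr normr0 expr0n mul0r.
have [c + E] := MVT x0 (fun z _ => is_derive_sin z)
  (continuous_subspaceT (@continuous_sin R)).
rewrite in_itv/= => /andP[c0 cx].
move: E; rewrite sin0 !subr0 => ->.
rewrite -{2}[x]mul1r -mulrBl normrM distrC.
have /andP[h0 h1] := cos_sub1_bound c.
rewrite (ger0_norm h0) (gtr0_norm x0) exprSr mulrAC ler_pM2r//.
apply: le_trans h1 _; rewrite ler_pM2r ?invr_gt0//.
by apply: lerXn2r; rewrite ?nnegrE ltW.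
Qed.

Lemma sin_sub_bound2 x : `|sin x - x| <= x ^+ 2.
Proof.
rewrite -real_normK ?num_real//.
have h1 := sin_sub_bound x; have h2 := sin_norm_le x.
have := ler_normB (sin x) x; have := normr_ge0 x; move: h1 h2.
set a := `|x|; set b := `|sin x|; set c := `|_ - _| => h1 h2 a0 h3.
have [a2|a2] := leP a 2; [|nra].
by apply: le_trans h1 _; have := sqr_ge0 a; nra.
Qed.

Lemma cos_taylor2 x : `|cos x - 1 + x ^+ 2 / 2| <= `|x| ^+ 3 / 4.
Proof.
have /andP[h0 h1] := cos_sub1_bound x.
rewrite (_ : cos x - 1 + _ = x ^+ 2 / 2 - (1 - cos x)); last by ring.
rewrite ger0_norm ?subr_ge0//.
have [a2|/ltW a2] := leP `|x| 2; last first.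
  apply: le_trans (_ : x ^+ 2 / 2 <= _); first by rewrite gerBl.
  rewrite -real_normK ?num_real//.
  by have := sqr_ge0 `|x|; nra.
rewrite cos_half; set z := x / 2.
have zx : x = 2 * z by rewrite /z mulrC divfK.
have := sin_sub_bound z; have := sin_norm_le z.
have nx : `|x| = 2 * `|z| by rewrite zx normrM ger0_norm.
rewrite (_ : x ^+ 2 / 2 - 2 * sin z ^+ 2 = 2 * ((z - sin z) * (z + sin z))); last first.
  by rewrite {1}zx; field.
move=> s1 s2; apply: le_trans (ler_norm _) _.
rewrite normrM normrM (ger0_norm (ler0n _ 2)) distrC.
move: a2; rewrite nx => a2.
have z0 := normr_ge0 z.
apply: le_trans (_ : 2 * ((`|z| ^+ 3 / 2) * (2 * `|z|)) <= _).
  rewrite ler_pM2l//; apply: ler_pM => //.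
  by apply: le_trans (ler_normD _ _) _; lra.
have : 0 <= `|z| ^+ 3 by rewrite exprn_ge0.
by nra.
Qed.

(** The two parts of the increment are expanded to different orders: in [restT_bound] the part [p]
    is the drift, of order 1/n, and [x] is the martingale part, of order n^(-1/2), whose square
    still counts. *)
Lemma cos_taylor_add phi p x :
  `|cos (phi + (p + x)) - (cos phi - sin phi * (p + x) - cos phi * x ^+ 2 / 2)|
  <= 2 * p ^+ 2 + `|p| * `|x| + `|x| ^+ 3.
Proof.
pose z := phi + x.
have E1 : cos (phi + (p + x)) = cos z * cos p - sin z * sin p.
  by rewrite (addrC p) addrA cosD.
have E2 : cos z = cos phi * cos x - sin phi * sin x by rewrite cosD.
rewrite (_ : _ - _ = cos z * (cos p - 1) - sin z * (sin p - p)
   - (sin z - sin phi) * p + (cos phi * (cos x - 1 + x ^+ 2 / 2) - sin phi * (sin x - x))); last first.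
  apply/eqP; rewrite -subr_eq0; apply/eqP.
  transitivity (cos z - (cos phi * cos x - sin phi * sin x)).
    by rewrite E1; field.
  by rewrite E2 subrr.
have l1 (a b : R) : `|a| <= 1 -> `|a * b| <= `|b| by move=> a1; rewrite normrM ler_piMl.
have c1 : `|cos p - 1| <= p ^+ 2 / 2.
  by have /andP[h0 h1] := cos_sub1_bound p; rewrite distrC ger0_norm.
have s1 := sin_sub_bound2 p.
have s2 : `|sin z - sin phi| <= `|x|.
  by have := sin_lipschitz z phi; rewrite /z addrAC subrr add0r.
have c3 := cos_taylor2 x; have s3 := sin_sub_bound x.
apply: le_trans (ler_normD _ _) _.
apply: le_trans (lerD (ler_normB _ _) (ler_normB _ _)) _.
apply: le_trans (lerD (lerD (ler_normB _ _) (lexx _)) (lexx _)) _.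
have b1 := l1 (cos z) (cos p - 1) (cos_max _).
have b2 := l1 (sin z) (sin p - p) (sin_max _).
have b3 : `|(sin z - sin phi) * p| <= `|p| * `|x|.
  by rewrite normrM mulrC; apply: ler_wpM2l.
have b4 := l1 (cos phi) (cos x - 1 + x ^+ 2 / 2) (cos_max _).
have b5 := l1 (sin phi) (sin x - x) (sin_max _).
have x3 : 0 <= `|x| ^+ 3 by rewrite exprn_ge0.
have p2 := sqr_ge0 p.
move: b1 b2 b3 b4 b5; move: (`|_ * (cos p - 1)|) (`|_ * (sin p - p)|) (`|(_ - _) * p|)
  (`|cos phi * _|) (`|sin phi * _|) => A B C D F.
by lra.
Qed.

Lemma expR_sub1_bound y : 0 <= y -> 0 <= 1 - expR (- y) <= y.
Proof.
move=> y0; have := @expR_ge1Dx R (- y) => h.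
by rewrite subr_ge0 -[X in _ <= X]expR0 ler_expR oppr_le0 y0/=; lra.
Qed.

Lemma expR_taylor1 y : 0 <= y -> `|1 - expR (- y) - y| <= y ^+ 2.
Proof.
move=> y0; have /andP[h0 h1] := expR_sub1_bound y0.
rewrite distrC ger0_norm ?subr_ge0//.
have := @expR_ge1Dx R y; have := expRN y; have := expR_gt0 y.
set E := expR y => E0 ->; move: h0 h1 => _ _ h.
have : E^-1 <= (1 + y)^-1 by rewrite lef_pV2 ?posrE//; lra.
have : (1 + y)^-1 <= 1 - y + y ^+ 2.
  rewrite invf_ple ?posrE; [|lra|nra].
  rewrite -[X in X <= _]mul1r ler_pdivrMr; nra.
by lra.
Qed.

End TrigBounds.

Lemma cvg_of_dist {R : realType} (u b : nat -> R) (l : R) :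
  (forall n, `|u n - l| <= b n) -> b @ \oo --> (0 : R) -> u @ \oo --> l.
Proof.
move=> ub b0; apply/cvgrPdist_le => e e0.
have : \forall n \near \oo, b n <= e by apply: cvgr_le b0 _ e0.
by apply: filterS => n bn; rewrite distrC (le_trans (ub n)).
Qed.

(** * Bernstein-type averages as trigonometric polynomials *)

Section TrigApproximation.
Context {R : realType} {n : nat}.
Implicit Types (f g : 'rV[R]_n -> R) (z y : 'rV[R]_n).

Inductive trig_poly : ('rV[R]_n -> R) -> Prop :=
| trig_cos (q : 'I_n -> R) theta :
    trig_poly (fun z => cos (\sum_i q i * z ord0 i + theta))
| trig_add f g : trig_poly f -> trig_poly g -> trig_poly (fun z => f z + g z)
| trig_scale c f : trig_poly f -> trig_poly (fun z => c * f z).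

Lemma trig_cst c : trig_poly (fun=> c).
Proof.
have -> : (fun=> c) = fun z : 'rV[R]_n => c * cos (\sum_i 0 * z ord0 i + 0).
  apply/funext => z; rewrite big1 => [|i _]; last by rewrite mul0r.
  by rewrite addr0 cos0 mulr1.
exact/trig_scale/trig_cos.
Qed.

(** A product of a cosine and a sine is a combination of two phase shifted cosines. This is the only
    multiplication that [walk] requires. *)
Lemma trig_mul_sin f i L : trig_poly f -> trig_poly (fun z => f z * sin (z ord0 i / L)).
Proof.
elim=> {f} [q theta|f g _ hf _ hg|c f _ hf].
- have lin (z : 'rV[R]_n) (c : R) : \sum_j (q j + (j == i)%:R * c) * z ord0 j =
      \sum_j q j * z ord0 j + z ord0 i * c.
    under eq_bigr do rewrite mulrDl; rewrite big_split/=; congr (_ + _).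
    rewrite (bigD1 i)//= big1 => [|j /negbTE ->]; last by rewrite mul0r mul0r.
    by rewrite eqxx mul1r addr0 mulrC.
  have -> : (fun z : 'rV[R]_n => cos (\sum_j q j * z ord0 j + theta) * sin (z ord0 i / L)) =
    (fun z => 2^-1 * cos (\sum_j (q j + (j == i)%:R * L^-1) * z ord0 j + (theta - pi / 2)) +
      (- 2^-1) * cos (\sum_j (q j + (j == i)%:R * (- L^-1)) * z ord0 j + (theta - pi / 2))).
    apply/funext => z; rewrite !lin mulrN.
    set A := \sum_j _; set B := z ord0 i / L.
    rewrite (_ : A + B + _ = A + theta + B - pi / 2); last by ring.
    rewrite (_ : A - B + _ = A + theta - B - pi / 2); last by ring.
    by rewrite !cosBpihalf sinD sinB; field.
  by apply: trig_add; apply: trig_scale; exact: trig_cos.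
- under eq_fun do rewrite mulrDl; exact: trig_add.
- under eq_fun do rewrite -mulrA; exact: trig_scale.
Qed.

Variables L a : R.

(** A probability that is itself a trigonometric polynomial in [z]. The mean step is
    [a * sin (z_i / L)], so [N] steps with [a = L / N] have mean displacement [L * sin (z_i / L)],
    which is close to [z_i] for large [L]. *)
Definition upp z i := (1 + sin (z ord0 i / L)) / 2.

(* [walk l f y z] is the expectation of [f] at the end of a random walk that
   starts in [y] and, for each [i] in [l], moves the coordinate [i] by [a] with
   probability [upp z i] and by [- a] otherwise. *)
Fixpoint walk (l : seq 'I_n) f y z : R :=
  if l is i :: l' then
    upp z i * walk l' f (y + a *: delta_mx ord0 i) z
    + (1 - upp z i) * walk l' f (y - a *: delta_mx ord0 i) z
  else f y.

Lemma upp_itv z i : 0 <= upp z i <= 1.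
Proof.
have := sin_geN1 (z ord0 i / L); have := sin_le1 (z ord0 i / L).
by rewrite /upp => h1 h2; apply/andP; split; lra.
Qed.

Lemma trig_walk l f y : trig_poly (walk l f y).
Proof.
elim: l y => [|i l IH] y /=; first exact: trig_cst.
have -> : (fun z => upp z i * walk l f (y + a *: delta_mx ord0 i) z +
     (1 - upp z i) * walk l f (y - a *: delta_mx ord0 i) z) =
  (fun z => (2^-1 * walk l f (y + a *: delta_mx ord0 i) z +
     2^-1 * (walk l f (y + a *: delta_mx ord0 i) z * sin (z ord0 i / L))) +
    (2^-1 * walk l f (y - a *: delta_mx ord0 i) z +
     (- 2^-1) * (walk l f (y - a *: delta_mx ord0 i) z * sin (z ord0 i / L)))).
  by apply/funext => z; rewrite /upp; field.
by do ?[apply: trig_add | apply: trig_scale | apply: trig_mul_sin | exact: IH].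
Qed.

Lemma walk_le l f g y z : (forall x, f x <= g x) -> walk l f y z <= walk l g y z.
Proof.
move=> fg; elim: l y => [|i l IH] y //=; have /andP[u0 u1] := upp_itv z i.
by apply: lerD; apply: ler_wpM2l => //; rewrite subr_ge0.
Qed.

Lemma walk_cst l c y z : walk l (fun=> c) y z = c.
Proof. by elim: l y => [//|i l IH] y /=; rewrite !IH; ring. Qed.

Lemma walkD l f g y z : walk l (fun x => f x + g x) y z = walk l f y z + walk l g y z.
Proof. by elim: l y => [//|i l IH] y /=; rewrite !IH; ring. Qed.

Lemma walkZ l c f y z : walk l (fun x => c * f x) y z = c * walk l f y z.
Proof. by elim: l y => [//|i l IH] y /=; rewrite !IH; ring. Qed.

Lemma walk_sum l (I : Type) (s : seq I) (F : I -> 'rV[R]_n -> R) y z :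
  walk l (fun x => \sum_(i <- s) F i x) y z = \sum_(i <- s) walk l (F i) y z.
Proof.
elim: s => [|i s IH].
  rewrite big_nil -[RHS](walk_cst l 0 y z); congr (walk l _ y z).
  by apply/funext => x; rewrite big_nil.
by rewrite big_cons -IH -walkD; congr (walk l _ y z); apply/funext => x; rewrite big_cons.
Qed.

Lemma walk_norm l f y z M : (forall x, `|f x| <= M) -> `|walk l f y z| <= M.
Proof.
move=> fM; rewrite ler_norml; apply/andP; split.
  rewrite -(walk_cst l (- M) y z); apply: walk_le => x.
  by have := fM x; rewrite ler_norml => /andP[].
rewrite -(walk_cst l M y z); apply: walk_le => x.
by have := fM x; rewrite ler_norml => /andP[].
Qed.

(** Squared bias plus variance: the steps are independent, and each step in direction [i] has mean
    [a * S] and variance [a^2 * (1 - S^2)], where [S = sin (z_i / L)]. *)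
Lemma walk_sqr l i tau y z : walk l (fun x => (x ord0 i - tau) ^+ 2) y z =
  (y ord0 i + (count_mem i l)%:R * (a * sin (z ord0 i / L)) - tau) ^+ 2
  + (count_mem i l)%:R * (a ^+ 2 * (1 - sin (z ord0 i / L) ^+ 2)).
Proof.
elim: l y => [|j l IH] y /=; first by rewrite !mul0r !addr0.
rewrite !IH !mxE eqxx /= natrD eq_sym; case: eqVneq => [<-|ij] /=.
  by rewrite /upp; field.
by ring.
Qed.

End TrigApproximation.

Section TrigDensity.
Context {R : realType} {n : nat}.

(** The point [y] may lie outside the box, so the covering argument is applied to the property
    [Pr r] of the centre [z], which quantifies over all [y]. *)
Lemma box_unif_continuous (g : 'rV[R]_n -> R) (K e : R) : continuous g -> 0 < e ->
  exists2 r : R, 0 < r & forall z y : 'rV[R]_n, (forall i, `|z ord0 i| <= K) ->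
    (forall i, `|y ord0 i - z ord0 i| < r) -> `|g y - g z| <= e.
Proof.
move=> cg e0.
pose A := [set v : 'rV[R]_n | forall i, (`[- K, K]%classic : set R) (v ord0 i)].
have cA : compact A.
  by apply: (@rV_compact R n (fun=> `[- K, K]%classic)) => i; exact: segment_compact.
pose Pr (r : R) (z : 'rV[R]_n) := forall y : 'rV[R]_n,
  (forall i, `|y ord0 i - z ord0 i| < r) -> `|g y - g z| <= e.
have H : \forall r \near 0^'+, A `<=` Pr r.
  apply: ((compact_near_coveringP A).1 cA) => x _.
  have : nbhs x [set y | `|g x - g y| < e / 2].
    by have /cvgrPdist_lt := cg x; apply; rewrite divr_gt0.
  move=> /nbhs_ballP[d /= d0 hd].
  exists (ball x (d / 2), [set r | r < d / 2]) => /=.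
    split; first by apply: nbhsx_ballx; rewrite divr_gt0.
    by apply: nbhs_right_lt; rewrite divr_gt0.
  move=> [x' r] /= [bx' rd] y hy.
  have bxx' : ball x d x' by apply: (le_ball _ bx'); lra.
  have bxy : ball x d y.
    split => // i j; rewrite /ball/= (ord1 i).
    have := bx'.2 ord0 j; rewrite /ball/= => b1; have := hy j.
    move=> b2; rewrite (_ : x ord0 j - y ord0 j = (x ord0 j - x' ord0 j) - (y ord0 j - x' ord0 j)); last by ring.
    by apply: le_lt_trans (ler_normB _ _) _; lra.
  have h1 := hd _ bxx'; have h2 := hd _ bxy; rewrite /= in h1 h2.
  rewrite (_ : g y - g x' = (g x - g x') - (g x - g y)); last by ring.
  by apply: le_trans (ler_normB _ _) _; lra.
have [r [r0 hr]] := filter_ex (filterI (nbhs_right_gt 0) H).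
exists r => // z y hz hy; apply: hr hy => i /=.
by rewrite in_itv/= -ler_norml.
Qed.

Lemma trig_poly_approx (g : 'rV[R]_n -> R) (M K e : R) :
  continuous g -> (forall z, `|g z| <= M) -> 0 < K -> 0 < e ->
  exists f, [/\ trig_poly f, (forall z, `|f z| <= M) &
    forall z : 'rV[R]_n, (forall i, `|z ord0 i| <= K) -> `|g z - f z| <= e].
Proof.
move=> cg gM K0 e0.
have M0 : 0 <= M by apply: le_trans (gM 0).
have e2 : 0 < e / 2 by rewrite divr_gt0.
have [r r0 hr] := box_unif_continuous K cg e2.
(* The Chebyshev constant: where some coordinate of [y - z] is at least [r], the trivial bound
   [2 * M] is at most [B * (y_i - z_i)^2]. *)
pose B := 2 * M / r ^+ 2.
have B0 : 0 <= B by apply: divr_ge0; [exact: mulr_ge0|exact: sqr_ge0].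
(* Each coordinate will have squared bias and variance at most [c], so the quadratic term of [quad]
   averages to at most [B * n * (2 * c) <= e / 2]. *)
pose c := Num.min 1 (e / 4 / ((1 + B) * (1 + n%:R))).
have Bn : 0 < (1 + B) * (1 + n%:R) by rewrite mulr_gt0// ltr_pwDl.
have c0 : 0 < c by rewrite /c lt_min ltr01 !divr_gt0.
have c1 : c <= 1 by rewrite /c ge_min lexx.
have ce : (1 + B) * (1 + n%:R) * c <= e / 4.
  by rewrite mulrC -ler_pdivlMr// /c ge_min lexx orbT.
(* [L] makes the bias at most [K^2 / L <= c], by [|sin x - x| <= x^2]; [N] then makes the variance
   at most [L^2 / N <= c]. *)
pose L := (K ^+ 2 + 1) / c.
have L0 : 0 < L by rewrite /L divr_gt0// ltr_wpDl ?sqr_ge0.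
pose N := (Num.truncn (L ^+ 2 / c)).+1.
have N0 : (0 : R) < N%:R by [].
pose l := flatten (nseq N (enum 'I_n)).
have cl i : count_mem i l = N.
  rewrite /l count_flatten map_nseq sumn_nseq.
  by rewrite (count_uniq_mem _ (enum_uniq _)) mem_enum mul1n.
exists (walk L (L / N%:R) l g 0); split; first exact: trig_walk.
  by move=> z; exact: walk_norm.
move=> z hz.
have quad y : `|g y - g z| <= e / 2 + B * \sum_i (y ord0 i - z ord0 i) ^+ 2.
  have s0 : 0 <= \sum_i (y ord0 i - z ord0 i) ^+ 2 by apply: sumr_ge0 => i _; exact: sqr_ge0.
  have [hy|] := pselect (forall i, `|y ord0 i - z ord0 i| < r).
    by apply: le_trans (hr z y hz hy) _; rewrite lerDl mulr_ge0.
  move=> /existsNP[i /negP]; rewrite -leNgt => ri.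
  apply: le_trans (ler_normB _ _) _; apply: le_trans (_ : 2 * M <= _).
    by rewrite mulr_natl mulr2n lerD.
  apply: le_trans (_ : B * (y ord0 i - z ord0 i) ^+ 2 <= _).
    rewrite /B mulrAC ler_pdivlMr ?exprn_gt0//; apply: ler_wpM2l; first by rewrite mulr_ge0.
    by rewrite -[leRHS]real_normK ?num_real//; apply: lerXn2r; rewrite ?nnegrE// ltW.
  apply: le_trans (_ : B * \sum_i (y ord0 i - z ord0 i) ^+ 2 <= _).
    apply: ler_wpM2l => //; rewrite (bigD1 i)//= lerDl; apply: sumr_ge0 => j _; exact: sqr_ge0.
  by rewrite lerDr ltW.
pose W f := walk L (L / N%:R) l f 0 z.
have WE : W (fun y => g y - g z) = W g - g z.
  have := walkD L (L / N%:R) l g (fun=> - g z) 0 z.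
  by rewrite walk_cst => <-.
have Wq : W (fun y => \sum_i (y ord0 i - z ord0 i) ^+ 2) <= n%:R * (2 * c).
  rewrite /W walk_sum; apply: le_trans (_ : \sum_(i < n) (2 * c) <= _); last first.
    by rewrite sumr_const card_ord -[leLHS]mulr_natl.
  apply: ler_sum => i _; rewrite walk_sqr cl mxE add0r.
  set S := sin _; have S1 : S ^+ 2 <= 1.
    by rewrite -real_normK ?num_real//; apply: exprn_ile1; rewrite ?sin_max.
  rewrite (_ : N%:R * (L / N%:R * S) = L * S); last by field; rewrite gt_eqF.
  rewrite (_ : N%:R * ((L / N%:R) ^+ 2 * (1 - S ^+ 2)) = L ^+ 2 / N%:R * (1 - S ^+ 2)); last first.
    by field; rewrite gt_eqF.
  have h1 : `|L * S - z ord0 i| <= c.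
    have := sin_sub_bound2 (z ord0 i / L); rewrite -/S => h.
    have -> : L * S - z ord0 i = L * (S - z ord0 i / L) by field; rewrite gt_eqF.
    rewrite normrM (gtr0_norm L0); apply: le_trans (ler_wpM2l (ltW L0) h) _.
    rewrite (_ : L * _ = z ord0 i ^+ 2 / L); last by field; rewrite gt_eqF.
    rewrite ler_pdivrMr// /L mulrC divfK ?gt_eqF//.
    apply: le_trans (_ : K ^+ 2 <= _); last by rewrite lerDl.
    by rewrite -[leLHS]real_normK ?num_real//; apply: lerXn2r; rewrite ?nnegrE// ltW.
  have h2 : L ^+ 2 / N%:R <= c.
    rewrite ler_pdivrMr// mulrC -ler_pdivrMr//.
    by apply/ltW; rewrite /N; exact: truncnS_gt.
  have h3 : (L * S - z ord0 i) ^+ 2 <= c.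
    rewrite -real_normK ?num_real//; apply: le_trans (_ : c ^+ 2 <= _).
      by apply: lerXn2r; rewrite ?nnegrE// ltW.
    by rewrite expr2 ler_piMl// ltW.
  have h4 : L ^+ 2 / N%:R * (1 - S ^+ 2) <= L ^+ 2 / N%:R.
    by rewrite ler_piMr ?divr_ge0 ?sqr_ge0// gerBl sqr_ge0.
  by lra.
rewrite distrC -/(W g) -WE.
apply: le_trans (_ : W (fun y => e / 2 + B * \sum_i (y ord0 i - z ord0 i) ^+ 2) <= _).
  rewrite ler_norml; apply/andP; split.
    rewrite lerNl -mulN1r -walkZ; apply: walk_le => y; rewrite mulN1r.
    by apply: le_trans (quad y); rewrite -normrN; exact: ler_norm.
  by apply: walk_le => y; apply: le_trans (quad y); exact: ler_norm.
rewrite /W walkD walk_cst walkZ -/(W _).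
have : B * W (fun y => \sum_i (y ord0 i - z ord0 i) ^+ 2) <= B * (n%:R * (2 * c)).
  exact: ler_wpM2l.
have n0 : (0 : R) <= n%:R by [].
have := mulr_ge0 B0 (ltW c0); have := mulr_ge0 n0 (ltW c0).
by move: ce; nra.
Qed.

End TrigDensity.

Lemma Ex_bounded_cvg {R : realType} {d : measure_display} {T : measurableType d}
    (P : probability T R) (f_ : nat -> T -> R) (f : T -> R) (M : R) :
  (forall n, measurable_fun setT (f_ n)) -> (forall n w, `|f_ n w| <= M) ->
  (forall w, (fun n => f_ n w) @ \oo --> f w) ->
  measurable_fun setT f /\ (fun n => Ex P (f_ n)) @ \oo --> Ex P f.
Proof.
move=> mf_ fM f_f.
have mf : measurable_fun setT f.
  by apply: (@measurable_fun_cvg _ _ _ setT f_) => // x _; exact: f_f.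
split => //.
have cE : {ae P, forall w, setT w -> (fun n => (f_ n w)%:E) @ \oo --> (f w)%:E}.
  by apply: aeW => w _; apply: cvg_EFin; [exact: nearW|exact: f_f].
have bE : {ae P, forall w n, setT w -> (`|(f_ n w)%:E| <= M%:E)%E}.
  by apply: aeW => w n _; rewrite /= lee_fin.
have [i1 _ c] := @dominated_convergence _ T R P setT measurableT (fun n w => (f_ n w)%:E)
  (fun w => (f w)%:E) (fun=> M%:E)
  (fun n => (measurable_EFinP _ _).2 (mf_ n)) ((measurable_EFinP _ _).2 mf) cE
  (L1_cst P M) bE.
rewrite (integral_Ex (i1 : L1 P f)) in c; exact: (fine_cvg c).
Qed.

(** * Convergence in distribution from expectations of cosines *)

Section Portmanteau.
Context {R : realType} {n : nat}.

Lemma measurable_linear {d : measure_display} {T : measurableType d}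
    (Z : T -> 'rV[R]_n) (q : 'I_n -> R) (theta : R) :
  (forall i, measurable_fun setT (fun w => Z w ord0 i)) ->
  measurable_fun setT (fun w => \sum_i q i * Z w ord0 i + theta).
Proof.
move=> mZ; apply: measurable_funD => //; apply: measurable_sum => i.
by apply: measurable_funM.
Qed.

Lemma measurable_trig {d : measure_display} {T : measurableType d}
    (Z : T -> 'rV[R]_n) (f : 'rV[R]_n -> R) :
  (forall i, measurable_fun setT (fun w => Z w ord0 i)) -> trig_poly f ->
  measurable_fun setT (fun w => f (Z w)) /\ exists C, forall z, `|f z| <= C.
Proof.
move=> mZ; elim=> {f} [q theta|f g _ [mf [C hC]] _ [mg [D hD]]|c f _ [mf [C hC]]].
- split; last by exists 1 => z; exact: cos_max.
  apply: (measurableT_comp (f := cos)); last exact: measurable_linear.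
  by apply: continuous_measurable_fun; exact: continuous_cos.
- split; first exact: measurable_funD.
  by exists (C + D) => z; apply: le_trans (ler_normD _ _) (lerD _ _).
- split; first exact: measurable_funM.
  by exists (`|c| * C) => z; rewrite normrM; exact: ler_wpM2l.
Qed.

Lemma trig_poly_dense (g : 'rV[R]_n -> R) (M : R) : continuous g -> (forall z, `|g z| <= M) ->
  exists Tk : nat -> 'rV[R]_n -> R, [/\ (forall k, trig_poly (Tk k)),
    (forall k z, `|Tk k z| <= M),
    (forall k (z : 'rV[R]_n), (forall i, `|z ord0 i| <= k.+1%:R) -> `|g z - Tk k z| <= k.+1%:R^-1) &
    forall z, (fun k => Tk k z) @ \oo --> g z].
Proof.
move=> cg gM.
have /choice[Tk hT] (k : nat) : exists f, [/\ trig_poly f, (forall z, `|f z| <= M) &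
    forall z : 'rV[R]_n, (forall i, `|z ord0 i| <= k.+1%:R) -> `|g z - f z| <= k.+1%:R^-1].
  by apply: trig_poly_approx => //; rewrite invr_gt0.
exists Tk; split => [k|k|k|z]; try by have [] := hT k.
apply/cvgrPdist_le => e e0.
have : \forall k \near \oo, (k.+1%:R^-1 : R) <= e by apply: cvgr_le (@cvg_harmonic R) _ e0.
have : \forall k \near \oo, \sum_i `|z ord0 i| <= k%:R by exact: nbhs_infty_ger.
apply: filterS2 => k zk ke; have [_ _ h] := hT k.
apply: le_trans (h z _) ke => i; apply: le_trans (_ : k%:R <= _); last by rewrite ler_nat.
apply: le_trans zk; rewrite (bigD1 i)//= lerDl; apply: sumr_ge0 => j _; exact: normr_ge0.
Qed.

(** Measurable coordinates make trigonometric polynomials of [Z] measurable, and [g] is a pointwise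
    limit of such polynomials. *)
Lemma measurable_continuous_rV {d : measure_display} {T : measurableType d}
    (Z : T -> 'rV[R]_n) (g : 'rV[R]_n -> R) :
  (forall i, measurable_fun setT (fun w => Z w ord0 i)) -> continuous g ->
  (exists M, forall z, `|g z| <= M) -> measurable_fun setT (fun w => g (Z w)).
Proof.
move=> mZ cg [M gM]; have [Tk [tT Tb _ cT]] := trig_poly_dense cg gM.
apply: (@measurable_fun_cvg _ _ _ setT (fun k w => Tk k (Z w))) => // k.
by have [] := measurable_trig mZ (tT k).
Qed.

Context {d d' : measure_display} {T : measurableType d} {T' : measurableType d'}.
Variables (P : probability T R) (Q : probability T' R).
Variables (Zn : nat -> T -> 'rV[R]_n) (Z : T' -> 'rV[R]_n).
Hypothesis mZn : forall k i, measurable_fun setT (fun w => Zn k w ord0 i).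
Hypothesis mZ : forall i, measurable_fun setT (fun w => Z w ord0 i).
Hypothesis cvg_cf : forall (q : 'I_n -> R) theta,
  (fun k => Ex P (fun w => cos (\sum_i q i * Zn k w ord0 i + theta))) @ \oo -->
  Ex Q (fun w => cos (\sum_i q i * Z w ord0 i + theta)).
Variables (tight : nat -> T -> R) (K0 : R).
Hypothesis tight_L1 : forall k, L1 P (tight k).
Hypothesis tight_Ex : forall k, Ex P (tight k) <= K0.
Hypothesis tight_ge0 : forall k w, 0 <= tight k w.
Hypothesis tightP : forall k w i, `|Zn k w ord0 i| <= tight k w.

Lemma cvg_trig (f : 'rV[R]_n -> R) : trig_poly f ->
  (fun k => Ex P (fun w => f (Zn k w))) @ \oo --> Ex Q (fun w => f (Z w)).
Proof.
have LP h k : trig_poly h -> L1 P (fun w => h (Zn k w)).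
  by move=> /(measurable_trig (mZn k))[mh [C hC]]; exact: L1_bounded mh _.
have LQ h : trig_poly h -> L1 Q (fun w => h (Z w)).
  by move=> /(measurable_trig mZ)[mh [C hC]]; exact: L1_bounded mh _.
elim=> {f} [q theta|f g tf hf tg hg|c f tf hf]; first exact: cvg_cf.
- rewrite ExD ?LQ//; under eq_fun => k do rewrite ExD ?LP//.
  exact: cvgD.
- rewrite ExZ ?LQ//; under eq_fun => k do rewrite ExZ ?LP//.
  exact: cvgM (cvg_cst _) hf.
Qed.

(** Replacing [g] by [Tk k] costs little on both sides: under [P] uniformly in the index of [Zn], by
    Markov's inequality for [tight], and under [Q] by bounded convergence. So [k] can be fixed
    before the index of [Zn] tends to infinity. *)
Lemma portmanteau (g : 'rV[R]_n -> R) : continuous g -> (exists M, forall z, `|g z| <= M) ->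
  (fun k => Ex P (fun w => g (Zn k w))) @ \oo --> Ex Q (fun w => g (Z w)).
Proof.
move=> cg [M gM].
have M0 : 0 <= M by apply: le_trans (gM 0).
have K0_ge0 : 0 <= `|K0| by [].
have [Tk [tT Tb hT cT]] := trig_poly_dense cg gM.
have mTZ k : measurable_fun setT (fun w => Tk k (Z w)) by have [] := measurable_trig mZ (tT k).
have mTZn k m : measurable_fun setT (fun w => Tk k (Zn m w)) by have [] := measurable_trig (mZn m) (tT k).
have [_ cgZ] := Ex_bounded_cvg Q mTZ (fun k w => Tb k (Z w)) (fun w => cT (Z w)).
have gb : exists M, forall z, `|g z| <= M by exists M.
have mgZn m := measurable_continuous_rV (mZn m) cg gb.
have unif k m : `|Ex P (fun w => g (Zn m w)) - Ex P (fun w => Tk k (Zn m w))| <=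
    (1 + 2 * M * `|K0|) / k.+1%:R.
  have Lg : L1 P (fun w => g (Zn m w)) by exact: L1_bounded (mgZn m) _.
  have LT : L1 P (fun w => Tk k (Zn m w)) by exact: L1_bounded (mTZn k m) _.
  have t0 w : 0 <= 2 * M / k.+1%:R * `|tight m w| by rewrite mulr_ge0// divr_ge0// mulr_ge0.
  rewrite -ExB//.
  have Lt := L1_norm (tight_L1 m).
  apply: le_trans (Ex_norm_le (g := fun w => k.+1%:R^-1 + 2 * M / k.+1%:R * `|tight m w|) _ _ _) _.
  - exact: L1B.
  - by apply: L1D (L1_cst _ _) _; exact: L1Z.
  - move=> w; have [hz|] := pselect (forall i, `|Zn m w ord0 i| <= k.+1%:R).
      apply: le_trans (hT k _ hz) _; rewrite lerDl; exact: t0.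
    move=> /existsNP[i /negP]; rewrite -ltNge => hz.
    apply: le_trans (ler_normB _ _) _; apply: le_trans (lerD (gM _) (Tb k _)) _.
    (* Outside the box some coordinate exceeds [k.+1], hence [tight m w / k.+1 >= 1] there. *)
    apply: le_trans (_ : 2 * M / k.+1%:R * `|tight m w| <= _); last by rewrite lerDr invr_ge0.
    rewrite -mulrA -[leLHS]mulr1 -mulr2n -[M *+ 2]mulr_natl.
    apply: ler_wpM2l; first by rewrite mulr_ge0.
    rewrite mulrC ler_pdivlMr// mul1r.
    by apply: le_trans (ltW hz) _; apply: le_trans (tightP m w i) _; exact: ler_norm.
  rewrite ExD ?ExZ ?Ex_cst//; [|exact: L1_cst|exact: L1Z].
  have Et : Ex P (fun w => `|tight m w|) <= `|K0|.
    rewrite (@eq_Ex _ _ _ _ _ (tight m)); first by apply: le_trans (tight_Ex m) _; exact: ler_norm.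
    by move=> w; rewrite ger0_norm.
  rewrite [leRHS]mulrDl mul1r lerD2l [leLHS]mulrAC; apply: ler_wpM2r; first by rewrite invr_ge0.
  by apply: ler_wpM2l => //; rewrite mulr_ge0.
apply/cvgrPdist_le => e e0.
have e3 : 0 < e / 3 by rewrite divr_gt0.
have cb : (fun k => (1 + 2 * M * `|K0|) / k.+1%:R : R) @ \oo --> (0 : R).
  rewrite -(mulr0 (1 + 2 * M * `|K0|)); apply: cvgM (cvg_cst _) _; exact: cvg_harmonic.
have N1 : \forall k \near \oo, (1 + 2 * M * `|K0|) / k.+1%:R <= e / 3.
  by apply: cvgr_le cb _ e3.
have N2 : \forall k \near \oo, `|Ex Q (fun w => g (Z w)) - Ex Q (fun w => Tk k (Z w))| <= e / 3.
  by move/cvgrPdist_le : cgZ; exact.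
have [k [kb kg]] := filter_ex (filterI N1 N2).
have /cvgrPdist_le/(_ _ e3) := cvg_trig (tT k); apply: filterS => m hm.
have u := unif k m; rewrite /= in kb kg hm.
rewrite (_ : _ - _ = (Ex Q (fun w => g (Z w)) - Ex Q (fun w => Tk k (Z w))) +
   (Ex Q (fun w => Tk k (Z w)) - Ex P (fun w => Tk k (Zn m w))) -
   (Ex P (fun w => g (Zn m w)) - Ex P (fun w => Tk k (Zn m w)))); last by ring.
apply: le_trans (ler_normB _ _) _; apply: le_trans (lerD (ler_normD _ _) (lexx _)) _.
apply: le_trans (lerD (lerD kg hm) (le_trans u kb)) _; lra.
Qed.

End Portmanteau.
(** [nu] is dominated by [mu], and [h] agrees almost everywhere with the Radon-Nikodym derivative,
    so this is its change of variables formula. *)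
Lemma integral_density {R : realType} {d : measure_display} {T : measurableType d}
    (nu : {finite_measure set T -> \bar R}) (mu : {sigma_finite_measure set T -> \bar R})
    (h g : T -> R) :
  mu.-integrable setT (EFin \o h) ->
  (forall A, measurable A -> nu A = (\int[mu]_(x in A) (h x)%:E)%E) ->
  measurable_fun setT g -> nu.-integrable setT (EFin \o g) ->
  (\int[nu]_x (g x)%:E = \int[mu]_x (g x * h x)%:E)%E.
Proof.
move=> ih nuE mg ig; have mh : measurable_fun setT h.
  exact/measurable_EFinP/(measurable_int mu).
have dom : nu `<< mu.
  apply/null_content_dominatesP => A mA muA0; rewrite nuE//.
  apply: null_set_integral => //; apply: measurable_funTS.
  exact/measurable_EFinP.
rewrite -(Radon_Nikodym_change_of_variables dom)//=.
apply: ae_eq_integral => //.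
- apply: emeasurable_funM; first exact/measurable_EFinP.
  by apply: (measurable_int mu); apply: Radon_Nikodym_integrable; exact: dom.
- exact/measurable_EFinP/measurable_funM.
- under [X in ae_eq _ _ _ X]eq_fun do rewrite EFinM.
  apply: ae_eqe_mul2l => /=.
  rewrite Radon_NikodymE//=.
  case: cid => /= k [k1 k2 k3].
  apply: integral_ae_eq => //= [|E _ mE]; last by rewrite -k3//; exact: nuE.
  exact/measurable_EFinP.
Qed.

(** * Gaussian laws *)

Section Gauss.
Context {R : realType} (s : R).
Hypothesis s_gt0 : 0 < s.
Local Notation N := (normal_prob 0 s).
Local Notation mu := (@lebesgue_measure R).
Local Notation f := (normal_pdf 0 s).

Let s_neq0 : s != 0. Proof. exact: lt0r_neq0. Qed.

Lemma integral_normal_prob (g : R -> R) :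
  measurable_fun setT g -> N.-integrable setT (EFin \o g) ->
  (\int[N]_x (g x)%:E = \int[mu]_x (g x * f x)%:E)%E.
Proof.
by move=> mg ig; rewrite (@integral_density _ _ _ _ mu f)//; exact: integrable_normal_pdf.
Qed.

Lemma normal_pdf0E x : f x = normal_peak s * expR (- x ^+ 2 / (s ^+ 2 *+ 2)).
Proof. by rewrite normal_pdfE// /normal_fun subr0. Qed.

Lemma is_derive_normal_pdf (x : R) : is_derive x (1 : R) (f : R -> R) (- (x / s ^+ 2) * f x).
Proof.
rewrite normal_pdfE// /normal_fun; apply: is_derive_eq.
rewrite /GRing.scale/= !subr0.
by field.
Qed.

(** An integrable majorant of [|x| * f x], which also shows that [f] decays at infinity. Once the
    density with doubled standard deviation is split off, the claim is [y <= exp (3 * y^2 / 8)] for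
    [y = |x| / s], which follows from [exp z >= 1 + z]. *)
Lemma normM_normal_pdf_le x : `|x| * f x <=
  s * (normal_peak s / normal_peak (2 * s)) * normal_pdf 0 (2 * s) x.
Proof.
have s2 : 2 * s != 0 by rewrite mulf_neq0.
have p0 := normal_peak_gt0 s_neq0; have p1 := normal_peak_gt0 s2.
rewrite normal_pdf0E normal_pdfE// /normal_fun subr0.
rewrite [leRHS](_ : _ = normal_peak s * (s * expR (- x ^+ 2 / ((2 * s) ^+ 2 *+ 2)))); last by field; rewrite lt0r_neq0.
rewrite mulrCA ler_pM2l//.
rewrite (_ : - x ^+ 2 / (s ^+ 2 *+ 2) =
  - (3 * (x / s) ^+ 2 / 8) + - x ^+ 2 / ((2 * s) ^+ 2 *+ 2)); last by field.
rewrite expRD mulrA ler_pM2r ?expR_gt0// expRN ler_pdivrMr ?expR_gt0//.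
have h := expR_ge1Dx (3 * (x / s) ^+ 2 / 8).
rewrite -ler_pdivrMl//; apply: le_trans h.
have -> : s^-1 * `|x| = `|x / s| by rewrite normrM (gtr0_norm (_ : 0 < s^-1)) ?invr_gt0// mulrC.
rewrite -(real_normK (num_real (x / s))); set y := `|_|.
have : 0 <= (y - 4 / 3) ^+ 2 by exact: sqr_ge0.
nra.
Qed.

Lemma integrable_bounded_pdf (g : R -> R) (C : R) :
  measurable_fun setT g -> (forall x, `|g x| <= C) ->
  mu.-integrable setT (EFin \o (fun x => g x * f x)).
Proof.
move=> mg gC; apply: (@le_integrable _ _ _ mu setT measurableT _ (fun x => (C * f x)%:E)).
- by apply/measurable_EFinP/measurable_funM => //; exact: measurable_normal_pdf.
- move=> x _ /=; rewrite lee_fin !normrM (ger0_norm (normal_pdf_ge0 _ _ _)).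
  rewrite ler_wpM2r ?normal_pdf_ge0// (le_trans (gC x))//.
  by rewrite ler_norm.
- under eq_fun do rewrite EFinM.
  apply: integrableZl => //; exact: integrable_normal_pdf.
Qed.

Lemma integrable_normM_pdf : mu.-integrable setT (EFin \o (fun x : R => `|x| * f x)).
Proof.
apply: (@le_integrable _ _ _ mu setT measurableT _ (fun x =>
    (s * (normal_peak s / normal_peak (2 * s)) * normal_pdf 0 (2 * s) x)%:E)).
- by apply/measurable_EFinP/measurable_funM => //; exact: measurable_normal_pdf.
- move=> x _ /=; rewrite lee_fin [leLHS]ger0_norm ?mulr_ge0 ?normal_pdf_ge0//.
  exact: le_trans (normM_normal_pdf_le x) (ler_norm _).
- under eq_fun do rewrite EFinM.
  apply: integrableZl => //; exact: integrable_normal_pdf.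
Qed.

Definition gauss_cos (theta c : R) : R := \int[mu]_x (cos (c * x + theta) * f x).

Lemma measurable_phase (h : R -> R) (theta c : R) :
  continuous h -> measurable_fun setT (fun x : R => h (c * x + theta)).
Proof.
move=> ch; apply: continuous_measurable_fun => x.
apply: continuous_comp; last exact: ch.
by apply: cvgD; [apply: cvgM; [exact: cvg_cst|exact: cvg_id]|exact: cvg_cst].
Qed.

Lemma is_derive_gauss_cos (theta c : R) :
  is_derive c (1 : R) (gauss_cos theta) (\int[mu]_x (- x * sin (c * x + theta) * f x)).
Proof.
pose F (c x : R) := cos (c * x + theta) * f x.
have dF (c' x : R) : is_derive c' (1 : R) (F^~ x) (- x * sin (c' * x + theta) * f x).
  rewrite /F; apply: is_derive_eq.
  by rewrite /GRing.scale/=; ring.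
have iF (x : R) : `]c - 1, c + 1[%classic x -> mu.-integrable setT (EFin \o F x).
  move=> _; apply: (@integrable_bounded_pdf _ 1); last by move=> y; exact: cos_max.
  by apply: measurable_phase; exact: continuous_cos.
have cc : `]c - 1, c + 1[%classic c by rewrite /= in_itv/=; apply/andP; split; lra.
have GF (x y : R) : `]c - 1, c + 1[%classic x -> setT y -> `|partial1of2 F x y| <= `|y| * f y.
  move=> _ _; rewrite partial1of2E (@derive_val _ _ _ _ _ _ _ (dF x y)).
  rewrite !normrM normrN (ger0_norm (normal_pdf_ge0 _ _ _)) ler_wpM2r ?normal_pdf_ge0//.
  by rewrite ler_piMr// sin_max.
have G0 (y : R) : 0 <= `|y| * f y by rewrite mulr_ge0 ?normal_pdf_ge0.
have dF' (x y : R) : `]c - 1, c + 1[%classic x -> setT y -> derivable (F^~ y) x 1.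
  by move=> _ _; have [] := dF x y.
have hd := @derivable_under_integral _ _ _ mu F setT measurableT c _ _ cc iF dF'
  _ G0 integrable_normM_pdf GF.
have hv := @differentiation_under_integral _ _ _ mu F setT measurableT c _ _ cc iF dF'
  _ G0 integrable_normM_pdf GF.
apply: DeriveDef; first exact: hd.
rewrite -derive1E hv; apply: eq_Rintegral => x _.
by rewrite partial1of2E (@derive_val _ _ _ _ _ _ _ (dF c x)).
Qed.

Lemma cvg_normal_pdf_natr (g : R -> R) : (forall x, `|g x| <= 1) ->
  (fun n : nat => g n.+1%:R * f n.+1%:R) @ \oo --> (0 : R) /\
  (fun n : nat => g (- n.+1%:R) * f (- n.+1%:R)) @ \oo --> (0 : R).
Proof.
move=> g1; set K := s * (normal_peak s / normal_peak (2 * s)) * normal_peak (2 * s).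
have hK (x : R) : `|x| * f x <= K.
  apply: le_trans (normM_normal_pdf_le x) _.
  rewrite ler_wpM2l ?normal_pdf_ub ?mulf_neq0//.
  by rewrite mulr_ge0 ?(ltW s_gt0)// divr_ge0 ?normal_peak_ge0.
have hx (x : R) (n : nat) : `|x| = n.+1%:R -> `|g x * f x| <= K * n.+1%:R^-1.
  move=> xn; rewrite ler_pdivlMr// -xn normrM (ger0_norm (normal_pdf_ge0 _ _ _)).
  apply: le_trans (hK x); rewrite mulrC ler_wpM2l// ler_piMl ?normal_pdf_ge0//.
have K0 : (fun n : nat => K * n.+1%:R^-1) @ \oo --> (0 : R).
  by rewrite -(mulr0 K); apply: cvgM; [exact: cvg_cst|exact: cvg_harmonic].
split; apply: norm_cvg0; apply: (@squeeze_cvgr _ _ _ _ (cst 0) (fun n : nat => K * n.+1%:R^-1)).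
1,4: by near=> n; rewrite normr_ge0/= hx// ?normrN ger0_norm.
all: by [exact: cvg_cst|exact: K0].
Unshelve. all: end_near. Qed.

(** The integrand is the derivative of [K], a bounded multiple of the density, which vanishes at
    infinity. Dominated convergence passes from the intervals [A n] to the whole line. *)
Lemma integral_by_parts_pdf (theta c : R) :
  \int[mu]_x ((x * sin (c * x + theta) - s ^+ 2 * c * cos (c * x + theta)) * f x) = 0.
Proof.
pose k (x : R) := (x * sin (c * x + theta) - s ^+ 2 * c * cos (c * x + theta)) * f x.
pose K (x : R) := - s ^+ 2 * (sin (c * x + theta) * f x).
have dK (x : R) : is_derive x (1 : R) K (k x).
  rewrite /K /k; have d := is_derive_normal_pdf x.
  apply: is_derive_eq.
  by rewrite /GRing.scale/=; field.
have ck : continuous k.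
  move=> x; apply: cvgM; last exact: continuous_normal_pdf.
  have cp (h : R -> R) : continuous h -> {for x, continuous (fun x : R => h (c * x + theta))}.
    move=> ch; apply: continuous_comp; last exact: ch.
    by apply: cvgD; [apply: cvgM; [exact: cvg_cst|exact: cvg_id]|exact: cvg_cst].
  apply: cvgB; apply: cvgM; [exact: cvg_id| |exact: cvg_cst|].
    by apply: cp; exact: continuous_sin.
  by apply: cp; exact: continuous_cos.
have mk : measurable_fun setT k by exact: continuous_measurable_fun.
have ik : mu.-integrable setT (EFin \o (fun x : R => `|x| * f x + s ^+ 2 * `|c| * f x)).
  have i2 := @integrable_bounded_pdf (cst (s ^+ 2 * `|c|)) `|s ^+ 2 * `|c| |
    (measurable_cst _) (fun=> lexx _).
  exact: (integrableD measurableT integrable_normM_pdf i2).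
have kb x : `|k x| <= `|x| * f x + s ^+ 2 * `|c| * f x.
  rewrite /k normrM (ger0_norm (normal_pdf_ge0 _ _ _)) -mulrDl ler_wpM2r ?normal_pdf_ge0//.
  apply: le_trans (ler_normB _ _) _.
  rewrite (normrM x) (normrM (_ * c)) (normrM _ c) (ger0_norm (sqr_ge0 s)).
  by apply: lerD; (apply: ler_piMr; rewrite ?sin_max ?cos_max//); rewrite mulr_ge0 ?sqr_ge0.
pose A (n : nat) : set R := `[- n.+1%:R, n.+1%:R]%classic.
have [||||| _ _ cvk] := @dominated_convergence _ _ _ mu setT measurableT
  (fun n => (EFin \o k) \_ (A n)) (EFin \o k)
  (EFin \o (fun x : R => `|x| * f x + s ^+ 2 * `|c| * f x)).
- move=> n; apply/(measurable_restrictT _ _).1 => //.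
    exact: measurable_itv.
  by apply: measurable_funTS; exact/measurable_EFinP.
- exact/measurable_EFinP.
- apply/aeW => x _; apply: cvg_near_cst.
  near=> n; rewrite patchE mem_set// /A /= in_itv/= -ler_norml.
  rewrite (@le_trans _ _ n%:R) ?ler_nat//.
  by near: n; exact: nbhs_infty_ger.
- exact: ik.
- apply/aeW => x n _; rewrite patchE; case: ifP => _; rewrite /= ?lee_fin ?normr0 ?kb//.
  exact: le_trans (kb x).
have intk n : (\int[mu]_(x in setT) ((EFin \o k) \_ (A n)) x = (K n.+1%:R - K (- n.+1%:R))%:E)%E.
  rewrite -integral_mkcondr setTI EFinB.
  apply: continuous_FTC2.
  - by rewrite (@lt_trans _ _ 0) ?oppr_lt0.
  - by apply: continuous_subspaceT; exact: ck.
  - have cK x : {for x, continuous K}.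
      by apply: differentiable_continuous; apply/derivable1_diffP; have [] := dK x.
    split; first by move=> x _; have [] := dK x.
    + by apply: cvg_at_right_filter; exact: cK.
    + by apply: cvg_at_left_filter; exact: cK.
  - by move=> x _; rewrite derive1E; have [] := dK x.
have K0 : (fun n : nat => (K n.+1%:R - K (- n.+1%:R))%:E) @ \oo --> 0%:E.
  apply: cvg_EFin; first exact: nearW.
  have [h1 h2] := @cvg_normal_pdf_natr (fun x => sin (c * x + theta)) (fun=> sin_max _).
  rewrite -(subrr (- s ^+ 2 * 0)); apply: cvgB.
    by apply: cvgM (cvg_cst _) h1.
  by apply: cvgM (cvg_cst _) h2.
have {}cvk : (fun n : nat => (K n.+1%:R - K (- n.+1%:R))%:E) @ \oo --> (\int[mu]_x (EFin \o k) x)%E.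
  by rewrite -(funext intk).
by rewrite /Rintegral (cvg_unique _ cvk K0).
Unshelve. all: end_near. Qed.

(** As a function of [c], [gauss_cos theta] solves [y' = - s^2 * c * y], by differentiation under
    the integral and integration by parts; hence its product with [exp (c^2 * s^2 / 2)] is
    constant. *)
Lemma gauss_cosE (theta c : R) :
  gauss_cos theta c = cos theta * expR (- (c ^+ 2 * s ^+ 2 / 2)).
Proof.
pose D (c : R) := gauss_cos theta c * expR (c ^+ 2 * s ^+ 2 / 2).
have dD (x : R) : is_derive x (1 : R) D 0.
  have d := is_derive_gauss_cos theta x.
  rewrite /D; apply: is_derive_eq.
  have -> : \int[mu]_y (- y * sin (x * y + theta) * f y) = - s ^+ 2 * x * gauss_cos theta x.
    have ms : measurable_fun setT (fun y : R => - y * sin (x * y + theta) * f y).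
      apply: measurable_funM; last exact: measurable_normal_pdf.
      apply: measurable_funM; first exact: oppr_measurable.
      by apply: measurable_phase; exact: continuous_sin.
    have isin : mu.-integrable setT (EFin \o (fun y : R => - y * sin (x * y + theta) * f y)).
      apply: le_integrable integrable_normM_pdf => //; first exact/measurable_EFinP.
      move=> y _ /=; rewrite lee_fin (normrM _ (f y)) (normrM _ (f y)) ler_wpM2r//.
      by rewrite normrM normrN normr_id ler_piMr// sin_max.
    have ic : mu.-integrable setT (EFin \o (fun y : R => cos (x * y + theta) * f y)).
      apply: (@integrable_bounded_pdf _ 1); last by move=> y; exact: cos_max.
      by apply: measurable_phase; exact: continuous_cos.
    have ic' : mu.-integrable setT (EFin \o (fun y : R => s ^+ 2 * x * (cos (x * y + theta) * f y))).
      exact: (integrableZl measurableT (s ^+ 2 * x) ic).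
    apply/eqP; rewrite -subr_eq0 mulNr mulNr opprK /gauss_cos -RintegralZl//.
    rewrite -RintegralD//; apply/eqP.
    transitivity (-1 * \int[mu]_y ((y * sin (x * y + theta) - s ^+ 2 * x * cos (x * y + theta)) * f y)); last first.
      by rewrite integral_by_parts_pdf mulr0.
    rewrite -RintegralZl//.
      by apply: eq_Rintegral => y _; ring.
    have := integrableZl measurableT (-1) (integrableD measurableT ic' isin).
    by congr (integrable _ _ _); apply/funext => y /=; rewrite -EFinD -EFinM; congr EFin; ring.
  by rewrite /GRing.scale/=; field.
have D0 : D 0 = cos theta.
  rewrite /D expr0n/= !mul0r expR0 mulr1 /gauss_cos.
  under eq_Rintegral do rewrite mul0r add0r.
  rewrite RintegralZl//; last exact: integrable_normal_pdf.
  by rewrite /Rintegral integral_normal_pdf mulr1.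
have := is_derive_0_is_cst c 0 dD; rewrite D0 => <-.
by rewrite /D -mulrA expRN divff ?mulr1// lt0r_neq0// expR_gt0.
Qed.

Lemma Ex_cos_normal (theta c : R) :
  Ex N (fun x => cos (c * x + theta)) = cos theta * expR (- (c ^+ 2 * s ^+ 2 / 2)).
Proof.
have mc : measurable_fun setT (fun x : R => cos (c * x + theta)).
  by apply: measurable_phase; exact: continuous_cos.
rewrite /Ex integral_normal_prob//; first exact: gauss_cosE.
by apply: (@L1_bounded _ _ _ N _ 1 mc) => x; exact: cos_max.
Qed.

Lemma normal_prob_cdf (x : R) : N `]-oo, x]%classic = gauss_cdf (s ^+ 2) x.
Proof. by rewrite /gauss_cdf sqrtr_sqr gtr0_norm. Qed.
End Gauss.

(** * Gaussian laws under a bounded weight *)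

Section WeightedLaw.
Context {R : realType} {d : measure_display} {T : measurableType d} (Q : probability T R).
Variables (h : T -> R) (M : R).
Hypothesis mh : measurable_fun setT h.
Hypothesis h_ge0 : forall w, 0 <= h w.
Hypothesis h_le : forall w, h w <= M.

Let L1h : L1 Q h.
Proof. by apply: (@L1_bounded _ _ _ _ _ M) => // w; rewrite ger0_norm. Qed.

Definition weighted_measure (A : set T) : \bar R := (\int[Q]_(w in A) (h w)%:E)%E.

Local Notation nu := weighted_measure.

Let nu0 : nu set0 = 0%E. Proof. exact: integral_set0. Qed.

Let nu_ge0 A : (0 <= nu A)%E.
Proof. by apply: integral_ge0 => w _; rewrite lee_fin. Qed.

Let nu_sigma_additive : semi_sigma_additive nu.
Proof.
move=> A mA tA mUA; rewrite /weighted_measure ge0_integral_bigcup//.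
- by apply: is_cvg_ereal_nneg_natsum_cond => n _ _; exact: nu_ge0.
- by apply: measurable_funTS; exact/measurable_EFinP.
- by move=> w _; rewrite lee_fin.
Qed.

HB.instance Definition _ := isMeasure.Build _ _ _ nu nu0 nu_ge0 nu_sigma_additive.

Let nu_fin : fin_num_fun nu.
Proof.
move=> A mA; apply: integrable_fin_num => //.
exact: integrableS L1h.
Qed.

HB.instance Definition _ := Measure_isFinite.Build _ _ _ nu nu_fin.

Variables (X : T -> R) (v c : R).
Hypothesis mX : measurable_fun setT X.
Hypothesis v_gt0 : 0 < v.
Hypothesis c_ge0 : 0 <= c.
Hypothesis cdfE : forall x, (\int[Q]_(w in X @^-1` `]-oo, x]) (h w)%:E = c%:E * gauss_cdf v x)%E.

(** Integrates out the variable [X] while everything else stays in the weight [h]: the masses of the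
    rays determine the image of [weighted_measure] under [X]. In [Ex_cos_box] this handles a
    Gaussian sequence one variable at a time. *)
Lemma weighted_law (f : R -> R) : measurable_fun setT f -> (exists C, forall x, `|f x| <= C) ->
  Ex Q (fun w => h w * f (X w)) = c * Ex (normal_prob 0 (Num.sqrt v)) f.
Proof.
move=> mf [C fC].
have s0 : 0 < Num.sqrt v by rewrite sqrtr_gt0.
have mX' : @measurable_fun _ _ T (measurableTypeR R) setT X := mX.
pose m1 : {measure set (measurableTypeR R) -> \bar R} :=
  measure_function_pushforward__canonical__measure_function_Measure weighted_measure mX'.
pose m2 : {measure set (measurableTypeR R) -> \bar R} :=
  mscale (NngNum c_ge0) (normal_prob 0 (Num.sqrt v)).
have rayE x : m1 `]-oo, x]%classic = m2 `]-oo, x]%classic.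
  transitivity (c%:E * normal_prob 0 (Num.sqrt v) `]-oo, x])%E; last by [].
  by rewrite (normal_prob_cdf s0) sqr_sqrtr ?ltW// -cdfE.
have m1_lty A : measurable A -> (m1 A < +oo)%E.
  move=> mA; rewrite ltey_eq; apply/orP; left.
  by apply: (fin_num_measure nu); rewrite -[X in measurable X]setTI; exact: (mX' measurableT _ mA).
(* Half-open intervals form a generating pi-system, and their masses are differences of the masses
   of two rays, both measures being finite. *)
have m12 (A : set (measurableTypeR R)) : measurable A -> m1 A = m2 A.
  refine (@measure_unique _ R (measurableTypeR R) (@ocitv R) (fun n => `]- n%:R, n%:R]%classic)
    erefl (@ocitvI R) _ _ m1 m2 _ _ A) => //.
  - by move=> n; exact: is_ocitv.
  - apply/seteqP; split => // x _; exists (Num.truncn `|x|).+1 => //=.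
    have := truncnS_gt `|x|; rewrite in_itv/= ltr_norml => /andP[-> /ltW].
    by [].
  - move=> _ [[a b] _ <-]; have [ab|ba] := leP a b; last first.
      by rewrite set_itv_ge ?measure0// bnd_simp -leNgt ltW.
    have -> : `](a, b).1, (a, b).2]%classic = `]-oo, b] `\` `]-oo, a].
      by rewrite -[RHS]setCK setCD setCitvl setUC -[LHS]setCK setCitv.
    have ab' : `]-oo, a]%classic `<=` `]-oo, b]%classic by exact: subset_itvl.
    have hD (m : {measure set (measurableTypeR R) -> \bar R}) :
        (m `]-oo, b]%classic < +oo -> m (`]-oo, b] `\` `]-oo, a]) = m `]-oo, b]%classic - m `]-oo, a]%classic)%E.
      by move=> mb; rewrite measureD ?(setIidr ab')//; exact: measurable_itv.
    by rewrite (hD m1) ?(hD m2) -?rayE// m1_lty//; exact: measurable_itv.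
  - by move=> n; exact: m1_lty.
have ifX : nu.-integrable setT (EFin \o (f \o X)).
  apply: (@le_integrable _ _ _ nu setT measurableT _ (EFin \o cst `|C|)).
  - by apply/measurable_EFinP; exact: measurableT_comp.
  - by move=> w _ /=; rewrite lee_fin normr_id (le_trans (fC _)) ?ler_norm.
  - exact: finite_measure_integrable_cst.
rewrite {1}/Ex.
under eq_integral do rewrite mulrC.
rewrite -(@integral_density _ _ _ nu Q h (f \o X))//; last exact: measurableT_comp.
have mfE : measurable_fun (setT : set (measurableTypeR R)) (EFin \o f) by exact/measurable_EFinP.
have := @integral_pushforward _ _ T (measurableTypeR R) R X mX' nu setT (EFin \o f) mfE ifX measurableT.
rewrite preimage_setT => <-.
rewrite (eq_measure_integral m2); last by move=> A mA _; exact: m12.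
have ifN : (normal_prob 0 (Num.sqrt v)).-integrable setT (EFin \o f).
  by apply: (@L1_bounded _ _ _ (normal_prob 0 (Num.sqrt v)) _ C).
have [pN nN] : (\int[normal_prob 0 (Num.sqrt v)]_x (EFin \o f)^\+ x \is a fin_num)%E /\
    (\int[normal_prob 0 (Num.sqrt v)]_x (EFin \o f)^\- x \is a fin_num)%E.
  by split; apply: integrable_fin_num => //; [exact: integrable_funepos|exact: integrable_funeneg].
rewrite /Ex integralE [in RHS]integralE !ge0_integral_mscale//; last 2 first.
- exact/measurable_funeneg/measurable_EFinP.
- exact/measurable_funepos/measurable_EFinP.
set a := (X in (_ * X - _)%E); set b := (X in (_ - _ * X)%E).
have aE : a \is a fin_num := pN; have bE : b \is a fin_num := nN.
transitivity (c * fine (a - b)%E); last by [].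
by rewrite -(fineK aE) -(fineK bE) -!EFinM -!EFinB /= mulrBr.
Qed.

End WeightedLaw.

Lemma L1_powers {R : realType} {d : measure_display} {T : measurableType d}
    (P : probability T R) (f g : T -> R) (n k : nat) : (k <= n)%N ->
  measurable_fun setT f -> L1 P (fun w => g w ^+ n) ->
  (forall w, `|f w| <= g w) -> L1 P (fun w => f w ^+ k).
Proof.
move=> kn mf ig fg.
apply: (L1_le (g := fun w => 1 + g w ^+ n)).
- exact: measurable_funX.
- by apply: L1D ig; exact: L1_cst.
- move=> w; rewrite normrX.
  apply: le_trans (_ : g w ^+ k <= _); first by rewrite lerXn2r ?nnegrE// (le_trans _ (fg w)).
  have g0 : 0 <= g w by apply: le_trans (fg w).
  have [g1|/ltW g1] := leP (g w) 1.
    by apply: le_trans (exprn_ile1 _ g0 g1) _; rewrite lerDl exprn_ge0.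
  by apply: le_trans (ler_weXn2l g1 kn) _; rewrite lerDr.
Qed.

(** * The process with exactly one child per individual *)

Section Process.
Context {R : realType} {d : measure_display} {T : measurableType d}.
Variables (P : probability T R).
Variables (xi : nat -> nat -> bool -> T -> nat * nat) (eps : nat -> T -> nat * nat).
Variables alpha beta : R.
Let I := (nat * nat * bool + nat)%type.
Let Y (i : I) := match i with inl (k, j, i) => xi k j i | inr k => eps k end.
Hypothesis mxi : forall k j i, discrete_rv (xi k j i).
Hypothesis meps : forall k, discrete_rv (eps k).
Hypothesis indY : mutually_indep P Y.
Hypothesis xi_law : forall k j i v,
  P [set w | xi k j i w = v] = P [set w | xi 0%N 0%N i w = v].
Hypothesis eps_law : forall k v,
  P [set w | eps k w = v] = P [set w | eps 0%N w = v].
Hypothesis xi_unit : forall k j i w, ((xi k j i w).1 + (xi k j i w).2)%N = 1%N.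
Hypotheses (alpha_gt0 : 0 < alpha) (beta_gt0 : 0 < beta).
Hypothesis alphaDbeta : alpha + beta = 1.
Hypothesis xi_mean : forall i,
  Ex P (fun w => (xi 0%N 0%N i w).1%:R) = if i then beta else alpha.
Hypothesis eps8 : L1 P (fun w => ((eps 0%N w).1%:R + (eps 0%N w).2%:R) ^+ 8).

Local Notation X := (Xproc xi eps).

Lemma mY i : discrete_rv (Y i).
Proof. by case: i => [[[k j] i]|k]; [exact: mxi|exact: meps]. Qed.

Definition delta := alpha - beta.
Definition gam := 1 - delta ^+ 2.

(** A parent of type 2, coded by [true], has the two offspring means interchanged, so the mean
    difference of its offspring is [- delta]. *)
Definition bsign (i : bool) (r : R) := if i then - r else r.

Definition immig k w : R := (eps k w).1%:R + (eps k w).2%:R.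
Definition immigV k w : R := (eps k w).1%:R - (eps k w).2%:R.
Definition mU := Ex P (immig 0).
Definition mV := Ex P (immigV 0).
Definition incU k w := immig k w - mU.
Definition incE k w := immigV k w - mV.
(* The centred contribution of the individual [p = (j, type)] of generation [k] to [VV k.+1]. *)
Definition zz k (p : nat * bool) w : R :=
  (xi k p.1 p.2 w).1%:R - (xi k p.1 p.2 w).2%:R - bsign p.2 delta.
Definition Ssum k (l : seq (nat * bool)) w := \sum_(p <- l) zz k p w.
Definition idx (x : nat * nat) : seq (nat * bool) :=
  [seq (j, false) | j <- iota 0 x.1] ++ [seq (j, true) | j <- iota 0 x.2].
(** The innovation of [VV] with the population frozen at [x]. It involves generation [k] only and is
    therefore independent of the past; [dX] inserts the actual population. *)
Definition dd k x w := Ssum k (idx x) w + incE k w.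
Definition UU k w : R := (X k w).1%:R + (X k w).2%:R.
Definition VV k w : R := (X k w).1%:R - (X k w).2%:R.
Definition dX k w := dd k (X k w) w.

Lemma delta_norm : `|delta| < 1.
Proof.
move: alpha_gt0 beta_gt0 alphaDbeta => a0 b0 ab.
by rewrite /delta ltr_norml; apply/andP; split; lra.
Qed.

Lemma gam_gt0 : 0 < gam.
Proof.
move: alpha_gt0 beta_gt0 alphaDbeta => a0 b0 ab.
have be : beta = 1 - alpha by lra.
by rewrite /gam /delta; have := mulr_gt0 a0 b0; rewrite be; nra.
Qed.

Lemma gam_le1 : gam <= 1.
Proof. by rewrite /gam; have := sqr_ge0 delta; lra. Qed.

Lemma size_idx x : size (idx x) = (x.1 + x.2)%N.
Proof. by rewrite size_cat !size_map !size_iota. Qed.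

Lemma uniq_idx x : uniq (idx x).
Proof.
rewrite cat_uniq !map_inj_uniq ?iota_uniq; try by move=> ? ? [].
by rewrite andbT/=; apply/hasPn => _ /mapP[j _ ->]; apply/negP => /mapP[? _ []].
Qed.

Lemma UU_step k w : UU k.+1 w = UU k w + immig k w.
Proof.
rewrite /UU /immig /= !natrD.
have s i n : (\sum_(j < n) (xi k j i w).1)%:R + (\sum_(j < n) (xi k j i w).2)%:R = n%:R :> R.
  rewrite -natrD -big_split/=; congr (_%:R).
  by rewrite (eq_bigr (fun=> 1%N)) ?sum1_card ?card_ord// => j _; exact: xi_unit.
by have := s false (X k w).1; have := s true (X k w).2; lra.
Qed.

Lemma VV_step k w : VV k.+1 w = delta * VV k w + mV + dX k w.
Proof.
rewrite /VV /dX /dd /incE /immigV /Ssum /idx /= big_cat/= !big_map.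
have s i n : (\sum_(j < n) (xi k j i w).1)%:R - (\sum_(j < n) (xi k j i w).2)%:R =
   \sum_(j <- iota 0 n) zz k (j, i) w + n%:R * bsign i delta :> R.
  rewrite !natr_sum -sumrB -[X in iota 0 X]subn0 big_mkord.
  rewrite (eq_bigr (fun j : 'I_n => zz k (val j, i) w + bsign i delta)).
    by rewrite big_split/= sumr_const card_ord mulr_natl.
  by move=> j _; rewrite /zz/= subrK.
have := s false (X k w).1; have := s true (X k w).2.
by rewrite !natrD /bsign; lra.
Qed.

(** * The filtration of generations *)

Definition past k : set I := fun i =>
  match i with inl (j, _, _) => (j < k)%N | inr j => (j < k)%N end.
Definition now k : set I := fun i =>
  match i with inl (j, _, _) => j = k | inr j => j = k end.

Lemma past_now k i : past k i -> now k i -> False.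
Proof. by case: i => [[[j ?] ?]|j] /= + jk; rewrite jk ltnn. Qed.

Lemma zz_known k p A : A (inl (k, p.1, p.2) : I) -> known Y A (zz k p).
Proof.
move=> /(knownN_self (Y := Y)) kY.
exact: (knownN_comp (fun x => x.1%:R - x.2%:R - bsign p.2 delta) kY).
Qed.

Lemma incE_known k A : A (inr k : I) -> known Y A (incE k).
Proof.
move=> /(knownN_self (Y := Y)) kY.
exact: (knownN_comp (fun x => x.1%:R - x.2%:R - mV) kY).
Qed.

Lemma immig_known k A : A (inr k : I) -> known Y A (immig k).
Proof.
move=> /(knownN_self (Y := Y)) kY.
exact: (knownN_comp (fun x => x.1%:R + x.2%:R) kY).
Qed.

Lemma incU_known k A : A (inr k : I) -> known Y A (incU k).
Proof. by move=> /immig_known kY; apply: knownB kY _; exact: known_cst. Qed.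

Lemma Ssum_known k l (A : set I) : (forall p, p \in l -> A (inl (k, p.1, p.2))) ->
  known Y A (Ssum k l).
Proof.
elim: l => [|p l IH] Al.
  rewrite /Ssum; under eq_fun do rewrite big_nil; exact: known_cst.
rewrite /Ssum; under eq_fun do rewrite big_cons; apply: knownD.
  by apply: zz_known; apply: Al; rewrite inE eqxx.
by apply: IH => q ql; apply: Al; rewrite inE ql orbT.
Qed.

Lemma dd_known k x A : (forall i, now k i -> A i) -> known Y A (dd k x).
Proof.
move=> kA; apply: knownD; last by apply: incE_known; exact: kA.
by apply: Ssum_known => p _; exact: kA.
Qed.

Lemma sub_past k : forall i, past k i -> past k.+1 i.
Proof. by case=> [[[j ?] ?]|j] /= /ltnW. Qed.

Lemma now_past k : forall i, now k i -> past k.+1 i.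
Proof. by case=> [[[j ?] ?]|j] /= ->. Qed.

Lemma known_S k (H : T -> R) : known Y (past k) H -> known Y (past k.+1) H.
Proof. apply: sub_known; exact: sub_past. Qed.

Lemma UV_X k w : ((X k w).1%:R = (UU k w + VV k w) / 2) /\
  ((X k w).2%:R = (UU k w - VV k w) / 2).
Proof. by rewrite /UU /VV; split; lra. Qed.

Lemma X_known_UV k : known Y (past k) (UU k) -> known Y (past k) (VV k) ->
  knownN Y (past k) (X k).
Proof.
move=> kU kV; apply: (@knownN_cmp R).
  under eq_fun do rewrite (UV_X k _).1.
  by apply: knownM (knownD kU kV) _; exact: known_cst.
under eq_fun do rewrite (UV_X k _).2.
by apply: knownM (knownB kU kV) _; exact: known_cst.
Qed.

Lemma dX_known_X k : knownN Y (past k) (X k) -> known Y (past k.+1) (dX k).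
Proof.
move=> kX; apply: (knownN_glue (F := dd k)).
  by apply: sub_knownN (@sub_past k) kX.
by move=> v; apply: dd_known; exact: now_past.
Qed.

(** A joint induction, because the step of [VV] involves the population [X k], which is recovered
    from [UU k] and [VV k] together. *)
Lemma UV_known k : known Y (past k) (UU k) /\ known Y (past k) (VV k).
Proof.
elim: k => [|k [kU kV]].
  by split; [exact: (@known_cst R _ _ _ Y _ (0%:R + 0%:R))|exact: (@known_cst R _ _ _ Y _ (0%:R - 0%:R))].
split.
  rewrite (funext (UU_step k)); apply: knownD; first exact: known_S.
  by apply: immig_known => /=.
rewrite (funext (VV_step k)); apply: knownD; last first.
  by apply: dX_known_X; exact: X_known_UV.
apply: knownD; last exact: known_cst.
by apply: knownM; [exact: known_cst|exact: known_S].
Qed.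

Lemma UU_known k : known Y (past k) (UU k). Proof. by have [] := UV_known k. Qed.
Lemma VV_known k : known Y (past k) (VV k). Proof. by have [] := UV_known k. Qed.
Lemma X_known k : knownN Y (past k) (X k).
Proof. by apply: X_known_UV; [exact: UU_known|exact: VV_known]. Qed.
Lemma dX_known k : known Y (past k.+1) (dX k).
Proof. by apply: dX_known_X; exact: X_known. Qed.

Lemma known_mfun A (H : T -> R) : known Y A H -> measurable_fun setT H.
Proof. by apply: known_measurable; exact: mY. Qed.

Lemma cond_Ex k (H : T -> R) (f : nat * nat -> T -> R) :
  known Y (past k) H -> (forall x, known Y (now k) (f x)) ->
  (forall x, L1 P (f x)) -> L1 P H ->
  L1 P (fun w => H w * f (X k w) w) -> L1 P (fun w => H w * Ex P (f (X k w))) ->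
  Ex P (fun w => H w * f (X k w) w) = Ex P (fun w => H w * Ex P (f (X k w))).
Proof.
move=> kH kf if_ iH iHf iHp.
pose A n := [set w | pickle (X k w) = n].
have mX v : measurable [set w | X k w = v].
  exact: (sigma_cylinders_measurable mY (@X_known k v)).
have mA n : measurable (A n).
  rewrite -[A n]setTI; by apply: (measurable_pickle mX measurableT (Y := [set n])).
have cA : \bigcup_n A n = setT.
  by apply/seteqP; split => // w _; exists (pickle (X k w)).
have tA : trivIset setT A by move=> i j _ _ [w [<- <-]].
congr fine; rewrite -cA !integral_bigcup ?cA//.
apply: eq_eseriesr => n _.
case E : (pickle_inv (T := (nat * nat)%type) n) => [v|]; last first.
  have -> : A n = set0; last by rewrite !integral_set0.
  by apply/seteqP; split => // w; rewrite /A/= => Xn; move: E; rewrite -Xn pickleK_inv.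
have An : A n = [set w | X k w = v].
  apply/seteqP; split => w; rewrite /A /=.
    by move=> Xn; move: E; rewrite -Xn pickleK_inv => -[].
  by move=> ->; have := @pickle_invK (nat * nat)%type n; rewrite E.
pose H1 w := H w * \1_(A n) w.
have kH1 : known Y (past k) H1.
  apply: knownM => //.
  have := @measurable_indic _ (g_sigma_algebraType (cylinders Y (past k))) R setT (A n).
  by apply; rewrite An; exact: X_known.
have iH1 : L1 P H1.
  apply: L1_le (L1_norm iH) _; first exact: known_mfun kH1.
  by move=> w; rewrite normrM ler_piMr// indicE; case: (_ \in _); rewrite ?normr1 ?normr0.
have [iH1f eH1f] := known_Ex mY indY (@past_now k) kH1 (kf v) iH1 (if_ v).
have mk (g : nat * nat -> T -> R) :
  (\int[P]_(w in A n) (H w * g (X k w) w)%:E = \int[P]_w (H1 w * g v w)%:E)%E.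
  rewrite [LHS]integral_mkcond; apply: eq_integral => w _.
  rewrite patchE /H1 indicE; case: ifPn => wA; rewrite ?mulr1 ?mulr0 ?mul0r//.
  by move: wA; rewrite inE An /= => ->.
rewrite (mk f) (mk (fun x _ => Ex P (f x))) integral_Ex// eH1f.
rewrite integral_Ex; last first.
  by under eq_fun do rewrite mulrC; exact: L1Z.
congr EFin; under [RHS]eq_Ex do rewrite mulrC.
by rewrite ExZ// mulrC.
Qed.

(** * Moments of the innovations *)

Lemma zz_bound k p w : `|zz k p w| <= 2.
Proof.
have := xi_unit k p.1 p.2 w; rewrite /zz /bsign.
have /ltW := delta_norm; rewrite !ler_norml => /andP[d1 d2].
case: (xi k p.1 p.2 w) => [[|[|x]] [|[|y]]]//= _; case: p.2; lra.
Qed.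

(** With exactly one child the difference of the two counts is 1 or -1 and squares to 1. The
    resulting quadratic equation yields the variance from the mean alone. *)
Lemma zz_sqr k p w : zz k p w ^+ 2 = gam - 2 * bsign p.2 delta * zz k p w.
Proof.
have := xi_unit k p.1 p.2 w; rewrite /zz /gam /bsign.
by case: (xi k p.1 p.2 w) => [[|[|x]] [|[|y]]]//= _; case: p.2; ring.
Qed.

Lemma zz_measurable k p : measurable_fun setT (zz k p).
Proof. by apply: (@known_mfun (now k)); exact: zz_known. Qed.

Lemma zz_L1 k p n : L1 P (fun w => zz k p w ^+ n).
Proof.
apply: (@L1_bounded _ _ _ P _ (2 ^+ n)); first exact: measurable_funX (@zz_measurable k p).
by move=> w; rewrite normrX lerXn2r ?nnegrE//; exact: zz_bound.
Qed.

Lemma zz_L1' k p : L1 P (zz k p).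
Proof. by have := zz_L1 k p 1; under eq_fun do rewrite expr1. Qed.

Lemma zz_mean k p : Ex P (zz k p) = 0.
Proof.
have -> : Ex P (zz k p) = Ex P (fun w => (xi 0%N 0%N p.2 w).1%:R -
    (xi 0%N 0%N p.2 w).2%:R - bsign p.2 delta).
  exact: (Ex_same_law (mxi k p.1 p.2) (mxi 0 0 p.2) (@xi_law k p.1 p.2)
    (fun x => x.1%:R - x.2%:R - bsign p.2 delta)).
have mf : measurable_fun setT (fun w => (xi 0%N 0%N p.2 w).1%:R : R).
  apply: (@known_mfun (now 0)).
  by apply: (knownN_comp (fun x => x.1%:R)); exact: (@knownN_self _ _ _ Y _ (inl (0, 0, p.2)%N)).
have iF : L1 P (fun w => (xi 0%N 0%N p.2 w).1%:R).
  apply: (@L1_bounded _ _ _ P _ 1 mf) => w.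
  by have := xi_unit 0 0 p.2 w; case: (xi 0%N 0%N p.2 w) => [[|[|x]] [|[|y]]]//= _;
    rewrite ?normr0 ?normr1.
rewrite (@eq_Ex _ _ _ _ _ (fun w => 2 * (xi 0%N 0%N p.2 w).1%:R - (1 + bsign p.2 delta))).
  rewrite ExB ?ExZ ?Ex_cst; [|exact: iF|exact: L1Z|exact: L1_cst].
  rewrite xi_mean /delta /bsign; move: alphaDbeta => ab; case: p.2; lra.
move=> w; have := xi_unit 0 0 p.2 w; move=> /(congr1 (fun n : nat => n%:R : R)).
by rewrite natrD; lra.
Qed.

Lemma zz_var k p : Ex P (fun w => zz k p w ^+ 2) = gam.
Proof.
under eq_Ex do rewrite zz_sqr.
rewrite ExB ?ExZ ?Ex_cst ?zz_mean ?mulr0 ?subr0//; [exact: zz_L1'|exact: L1_cst|].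
by apply: L1Z; exact: zz_L1'.
Qed.

Lemma Ssum_bound k l w : `|Ssum k l w| <= 2 * (size l)%:R.
Proof.
elim: l => [|p l IH]; rewrite /Ssum ?big_nil ?big_cons.
  by rewrite normr0 mulr0.
apply: le_trans (ler_normD _ _) _; rewrite /= -[(size l).+1%:R]natr1 mulrDr mulr1 addrC.
by apply: lerD => //; exact: zz_bound.
Qed.

Lemma Ssum_now k l : known Y (now k) (Ssum k l).
Proof. exact: Ssum_known. Qed.

Lemma Ssum_L1 k l n : L1 P (fun w => Ssum k l w ^+ n).
Proof.
apply: (@L1_bounded _ _ _ P _ ((2 * (size l)%:R) ^+ n)).
  by apply: measurable_funX; apply: known_mfun (@Ssum_now k l).
by move=> w; rewrite normrX lerXn2r ?nnegrE ?mulr_ge0//; exact: Ssum_bound.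
Qed.

Lemma Ssum_cons_Ex k p l i j : p \notin l ->
  L1 P (fun w => zz k p w ^+ i * Ssum k l w ^+ j) /\
  Ex P (fun w => zz k p w ^+ i * Ssum k l w ^+ j) =
  Ex P (fun w => zz k p w ^+ i) * Ex P (fun w => Ssum k l w ^+ j).
Proof.
move=> pl.
apply: (known_Ex mY indY (A := [set (inl (k, p.1, p.2) : I)])
   (B := [set (inl (k, q.1, q.2) : I) | q in [set` l]])).
- by move=> _ -> [q /= ql [q1 q2]]; move: pl; rewrite (surjective_pairing p) -q1 -q2 -surjective_pairing ql.
- by apply: knownX; exact: zz_known.
- by apply: knownX; apply: Ssum_known => q ql; exists q.
- exact: zz_L1.
- exact: Ssum_L1.
Qed.

(** Mixed terms with a first power vanish by independence and centring. The step for the fourth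
    moment adds at most 6 n + 16 to 16 n^2, which stays below 16 (n + 1)^2. Growth of order n^2 is
    what keeps the fourth moment of [dh] bounded. *)
Lemma Ssum_moments k l : uniq l ->
  [/\ Ex P (Ssum k l) = 0, Ex P (fun w => Ssum k l w ^+ 2) = gam * (size l)%:R &
      Ex P (fun w => Ssum k l w ^+ 4) <= 16 * (size l)%:R ^+ 2].
Proof.
elim: l => [_|p l IH /= /andP[pl ul]].
  rewrite /Ssum; split.
  - by under eq_Ex do rewrite big_nil; rewrite Ex_cst.
  - by under eq_Ex do rewrite big_nil; rewrite Ex_cst expr0n mulr0.
  - by under eq_Ex do rewrite big_nil; rewrite Ex_cst !expr0n/= mulr0.
have [E1 E2 E4] := IH ul.
have Sc w : Ssum k (p :: l) w = zz k p w + Ssum k l w by rewrite /Ssum big_cons.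
have L i j := (@Ssum_cons_Ex k p l i j pl).1.
have E i j := (@Ssum_cons_Ex k p l i j pl).2.
have z1 : Ex P (fun w => zz k p w ^+ 1) = 0.
  by under eq_Ex do rewrite expr1; exact: zz_mean.
have S1 : Ex P (fun w => Ssum k l w ^+ 1) = 0.
  by under eq_Ex do rewrite expr1.
have z4 : Ex P (fun w => zz k p w ^+ 4) <= 16.
  apply: le_trans (ler_norm _) _; apply: Ex_norm_bounded.
    exact: measurable_funX (@zz_measurable k p).
  move=> w; rewrite normrX (_ : 16 = 2 ^+ 4); last by rewrite -natrX.
  by rewrite lerXn2r ?nnegrE//; exact: zz_bound.
split.
- rewrite (@eq_Ex _ _ _ _ _ (fun w => zz k p w + Ssum k l w))//.
  rewrite ExD; [by rewrite zz_mean E1 addr0|exact: zz_L1'|].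
  by have := Ssum_L1 k l 1; under eq_fun do rewrite expr1.
- rewrite (@eq_Ex _ _ _ _ _ (fun w => zz k p w ^+ 2 +
    2 * (zz k p w ^+ 1 * Ssum k l w ^+ 1) + Ssum k l w ^+ 2)); last first.
    by move=> w; rewrite Sc; ring.
  rewrite !ExD ?ExZ ?E; try by do ?[exact: L|exact: zz_L1|exact: Ssum_L1|apply: L1D|apply: L1Z].
  by rewrite z1 S1 E2 zz_var -[(size l).+1%:R]natr1; ring.
- rewrite (@eq_Ex _ _ _ _ _ (fun w => zz k p w ^+ 4 +
    4 * (zz k p w ^+ 3 * Ssum k l w ^+ 1) + 6 * (zz k p w ^+ 2 * Ssum k l w ^+ 2) +
    4 * (zz k p w ^+ 1 * Ssum k l w ^+ 3) + Ssum k l w ^+ 4)); last first.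
    by move=> w; rewrite Sc; ring.
  rewrite !ExD ?ExZ ?E; try by do ?[exact: L|exact: zz_L1|exact: Ssum_L1|apply: L1D|apply: L1Z].
  rewrite z1 S1 E2 zz_var -[(size l).+1%:R]natr1.
  have n0 : (0:R) <= (size l)%:R by [].
  have gg : gam * (gam * (size l)%:R) <= (size l)%:R.
    have g0 := ltW gam_gt0; have g1 := gam_le1.
    rewrite mulrA ler_piMl// -[leRHS](mulr1 1); exact: ler_pM.
  move: E4 z4; set x := (size l)%:R in n0 gg *; nra.
Qed.

Lemma immig_ge0 k w : 0 <= immig k w.
Proof. by rewrite addr_ge0. Qed.

Lemma immig8 k : L1 P (fun w => immig k w ^+ 8).
Proof.
exact: (L1_same_law (meps k) (meps 0) (@eps_law k)
  (f := fun x => (x.1%:R + x.2%:R) ^+ 8)).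
Qed.

Lemma immig_measurable k : measurable_fun setT (immig k).
Proof. by apply: (@known_mfun (now k)); exact: immig_known. Qed.

Lemma immigD8 k (c : R) : 0 <= c -> L1 P (fun w => (immig k w + c) ^+ 8).
Proof.
move=> c0.
apply: (L1_le (g := fun w => 2 ^+ 8 * immig k w ^+ 8 + (2 * c) ^+ 8)).
- apply: measurable_funX; apply: measurable_funD => //; exact: immig_measurable.
- by apply: L1D; [apply: L1Z; exact: immig8|exact: L1_cst].
move=> w; have u0 := immig_ge0 k w.
rewrite ger0_norm ?exprn_ge0 ?addr_ge0// -exprMn.
have [uc|/ltW uc] := leP (immig k w) c.
  apply: le_trans (_ : (2 * c) ^+ 8 <= _).
    by rewrite lerXn2r ?nnegrE ?addr_ge0 ?mulr_ge0//; lra.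
  by rewrite lerDr exprn_ge0// mulr_ge0.
apply: le_trans (_ : (2 * immig k w) ^+ 8 <= _).
  by rewrite lerXn2r ?nnegrE ?addr_ge0 ?mulr_ge0//; lra.
by rewrite lerDl exprn_ge0// mulr_ge0.
Qed.

Lemma immigV_le k w : `|immigV k w| <= immig k w.
Proof.
rewrite /immigV /immig ler_norml; apply/andP; split.
  by have : (0:R) <= (eps k w).1%:R by []; lra.
by have : (0:R) <= (eps k w).2%:R by []; lra.
Qed.

Lemma immig_L1 k : L1 P (immig k).
Proof.
have := L1_powers (P := P) (k := 1) _ (@immig_measurable k) (immig8 k).
under eq_fun do rewrite expr1; apply => // w; rewrite ger0_norm//; exact: immig_ge0.
Qed.

Lemma immigV_L1 k : L1 P (immigV k).
Proof.
apply: L1_le (immig_L1 k) (immigV_le k).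
apply: (@known_mfun (now k)).
apply: (knownN_comp (fun x => x.1%:R - x.2%:R)).
exact: (@knownN_self _ _ _ Y _ (inr k)).
Qed.

Lemma incU_mean k : Ex P (incU k) = 0.
Proof.
rewrite /incU ExB; [|exact: immig_L1|exact: L1_cst].
rewrite Ex_cst /mU; apply/eqP; rewrite subr_eq0; apply/eqP.
exact: (Ex_same_law (meps k) (meps 0) (@eps_law k) (fun x => x.1%:R + x.2%:R)).
Qed.

Lemma incE_mean k : Ex P (incE k) = 0.
Proof.
rewrite /incE ExB; [|exact: immigV_L1|exact: L1_cst].
rewrite Ex_cst /mV; apply/eqP; rewrite subr_eq0; apply/eqP.
exact: (Ex_same_law (meps k) (meps 0) (@eps_law k) (fun x => x.1%:R - x.2%:R)).
Qed.

Definition s2U := Ex P (fun w => incU 0 w ^+ 2).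
Definition s2V := Ex P (fun w => incE 0 w ^+ 2).
Definition covUV := Ex P (fun w => incU 0 w * incE 0 w).
Definition m4U := Ex P (fun w => incU 0 w ^+ 4).
Definition m4V := Ex P (fun w => incE 0 w ^+ 4).

Lemma incU_var k : Ex P (fun w => incU k w ^+ 2) = s2U.
Proof.
exact: (Ex_same_law (meps k) (meps 0) (@eps_law k) (fun x => (x.1%:R + x.2%:R - mU) ^+ 2)).
Qed.
Lemma incE_var k : Ex P (fun w => incE k w ^+ 2) = s2V.
Proof.
exact: (Ex_same_law (meps k) (meps 0) (@eps_law k) (fun x => (x.1%:R - x.2%:R - mV) ^+ 2)).
Qed.
Lemma incUE_cov k : Ex P (fun w => incU k w * incE k w) = covUV.
Proof.
exact: (Ex_same_law (meps k) (meps 0) (@eps_law k)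
  (fun x => (x.1%:R + x.2%:R - mU) * (x.1%:R - x.2%:R - mV))).
Qed.
Lemma incU_m4 k : Ex P (fun w => incU k w ^+ 4) = m4U.
Proof.
exact: (Ex_same_law (meps k) (meps 0) (@eps_law k) (fun x => (x.1%:R + x.2%:R - mU) ^+ 4)).
Qed.
Lemma incE_m4 k : Ex P (fun w => incE k w ^+ 4) = m4V.
Proof.
exact: (Ex_same_law (meps k) (meps 0) (@eps_law k) (fun x => (x.1%:R - x.2%:R - mV) ^+ 4)).
Qed.

Lemma incU_L1 k n : (n <= 8)%N -> L1 P (fun w => incU k w ^+ n).
Proof.
move=> n8; apply: L1_powers n8 _ (immigD8 k (normr_ge0 mU)) _.
  by apply: (@known_mfun (now k)); exact: incU_known.
move=> w; apply: le_trans (ler_normB _ _) _.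
by rewrite lerD2r ger0_norm// immig_ge0.
Qed.

Lemma incE_L1 k n : (n <= 8)%N -> L1 P (fun w => incE k w ^+ n).
Proof.
move=> n8; apply: L1_powers n8 _ (immigD8 k (normr_ge0 mV)) _.
  by apply: (@known_mfun (now k)); exact: incE_known.
move=> w; apply: le_trans (ler_normB _ _) _.
by rewrite lerD2r immigV_le.
Qed.

Lemma incUE_L1 k : L1 P (fun w => incU k w * incE k w).
Proof.
apply: (L1_le (g := fun w => incU k w ^+ 2 + incE k w ^+ 2)).
- by apply: (@known_mfun (now k)); apply: knownM; [exact: incU_known|exact: incE_known].
- by apply: L1D; [exact: incU_L1|exact: incE_L1].
- move=> w; rewrite ler_norml; apply/andP; split; nra.
Qed.

Lemma pow4D_le (a b : R) : (a + b) ^+ 4 <= 8 * a ^+ 4 + 8 * b ^+ 4.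
Proof.
have h1 : (a + b) ^+ 2 <= 2 * (a ^+ 2 + b ^+ 2) by have := sqr_ge0 (a - b); nra.
rewrite !(exprM _ 2 2); apply: (le_trans (y := (2 * (a ^+ 2 + b ^+ 2)) ^+ 2)).
  by rewrite lerXn2r ?nnegrE ?sqr_ge0 ?mulr_ge0 ?addr_ge0 ?sqr_ge0.
by have := sqr_ge0 (a ^+ 2 - b ^+ 2); nra.
Qed.

Lemma dd_split_Ex k x i j : (j <= 8)%N ->
  L1 P (fun w => Ssum k (idx x) w ^+ i * incE k w ^+ j) /\
  Ex P (fun w => Ssum k (idx x) w ^+ i * incE k w ^+ j) =
  Ex P (fun w => Ssum k (idx x) w ^+ i) * Ex P (fun w => incE k w ^+ j).
Proof.
move=> j8.
apply: (known_Ex mY indY (A := [set i : I | if i is inl _ then True else False])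
   (B := [set (inr k : I)])).
- by move=> [] // y _ [].
- by apply: knownX; exact: Ssum_known.
- by apply: knownX; exact: incE_known.
- exact: Ssum_L1.
- exact: incE_L1.
Qed.

Lemma Ssum_L1' k l : L1 P (Ssum k l).
Proof. by have := Ssum_L1 k l 1; under eq_fun do rewrite expr1. Qed.

Lemma incE_L1' k : L1 P (incE k).
Proof. by have := @incE_L1 k 1 isT; under eq_fun do rewrite expr1. Qed.

Lemma incU_L1' k : L1 P (incU k).
Proof. by have := @incU_L1 k 1 isT; under eq_fun do rewrite expr1. Qed.

Lemma dd_mean k x : Ex P (dd k x) = 0.
Proof.
rewrite /dd ExD; [|exact: Ssum_L1'|exact: incE_L1'].
by rewrite incE_mean addr0; have [] := Ssum_moments k (uniq_idx x).
Qed.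

Lemma dd_var k x :
  Ex P (fun w => dd k x w ^+ 2) = gam * (x.1 + x.2)%:R + s2V.
Proof.
have [E1 E2 E4] := Ssum_moments k (uniq_idx x).
have [L E] := @dd_split_Ex k x 1 1 isT.
rewrite (@eq_Ex _ _ _ _ _ (fun w => Ssum k (idx x) w ^+ 2 +
    2 * (Ssum k (idx x) w ^+ 1 * incE k w ^+ 1) + incE k w ^+ 2)); last first.
  by move=> w; rewrite /dd; ring.
rewrite !ExD ?ExZ ?E; try by do ?[exact: L|exact: Ssum_L1|exact: incE_L1|apply: L1D|apply: L1Z].
rewrite E2 incE_var size_idx.
have -> : Ex P (fun w => incE k w ^+ 1) = 0.
  by under eq_Ex do rewrite expr1; exact: incE_mean.
by ring.
Qed.

Lemma s2V_ge0 : 0 <= s2V.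
Proof. by apply: Ex_ge0 => w; exact: sqr_ge0. Qed.
Lemma s2U_ge0 : 0 <= s2U.
Proof. by apply: Ex_ge0 => w; exact: sqr_ge0. Qed.
Lemma m4V_ge0 : 0 <= m4V.
Proof. by apply: Ex_ge0 => w; exact: exprn_even_ge0. Qed.
Lemma m4U_ge0 : 0 <= m4U.
Proof. by apply: Ex_ge0 => w; exact: exprn_even_ge0. Qed.

(** The terms of E (S + e)^4 that survive are the two fourth moments and six times the product of
    the second moments; these are their coefficients. *)
Definition cst4 := 16 + 6 * s2V + m4V.

Lemma dd_L1 k x n : (n <= 4)%N -> L1 P (fun w => dd k x w ^+ n).
Proof.
move=> n4.
have m i : measurable_fun setT (fun w => dd k x w ^+ i).
  by apply: measurable_funX; apply: (@known_mfun (now k)); exact: dd_known.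
have L4 : L1 P (fun w => dd k x w ^+ 4).
  apply: (L1_le (g := fun w => 8 * (Ssum k (idx x) w ^+ 4) + 8 * (incE k w ^+ 4))) => //.
    by apply: L1D; apply: L1Z; [exact: Ssum_L1|exact: incE_L1].
  move=> w; rewrite ger0_norm ?exprn_even_ge0// /dd.
  exact: pow4D_le.
apply: (L1_le (g := fun w => 1 + dd k x w ^+ 4)) => //.
  by apply: L1D L4; exact: L1_cst.
move=> w; rewrite normrX -(@ger0_norm _ (dd k x w ^+ 4)) ?exprn_even_ge0// normrX.
set a := `|_|; have a0 : 0 <= a by exact: normr_ge0.
have [a1|/ltW a1] := leP a 1.
  by apply: le_trans (exprn_ile1 _ a0 a1) _; rewrite lerDl exprn_ge0.
by apply: le_trans (ler_weXn2l a1 n4) _; rewrite lerDr.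
Qed.

Lemma dd_m4 k x :
  Ex P (fun w => dd k x w ^+ 4) <= cst4 * (1 + (x.1 + x.2)%:R) ^+ 2.
Proof.
have [E1 E2 E4] := Ssum_moments k (uniq_idx x).
have L i j (h : (j <= 8)%N) := (@dd_split_Ex k x i j h).1.
have E i j (h : (j <= 8)%N) := (@dd_split_Ex k x i j h).2.
have S1 : Ex P (fun w => Ssum k (idx x) w ^+ 1) = 0.
  by under eq_Ex do rewrite expr1.
have i1 : Ex P (fun w => incE k w ^+ 1) = 0.
  by under eq_Ex do rewrite expr1; exact: incE_mean.
rewrite (@eq_Ex _ _ _ _ _ (fun w => Ssum k (idx x) w ^+ 4 +
    4 * (Ssum k (idx x) w ^+ 3 * incE k w ^+ 1) +
    6 * (Ssum k (idx x) w ^+ 2 * incE k w ^+ 2) +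
    4 * (Ssum k (idx x) w ^+ 1 * incE k w ^+ 3) + incE k w ^+ 4)); last first.
  by move=> w; rewrite /dd; ring.
rewrite !ExD ?ExZ ?E//; try by do ?[exact: (L _ 1%N)|exact: (L _ 2%N)|exact: (L _ 3%N)|exact: Ssum_L1|exact: incE_L1|apply: L1D|apply: L1Z].
rewrite S1 i1 E2 incE_var incE_m4 -size_idx.
move: E4; rewrite /cst4; set q := (size _)%:R => E4.
have q0 : 0 <= q by [].
have v0 := s2V_ge0; have m0 := m4V_ge0; have g0 := gam_gt0; have g1 := gam_le1.
have qv0 : 0 <= q * s2V by exact: mulr_ge0.
have : gam * (q * s2V) <= q * s2V by exact: ler_piMl.
have : 0 <= q ^+ 2 * s2V by rewrite mulr_ge0// sqr_ge0.
have : 0 <= q ^+ 2 * m4V by rewrite mulr_ge0// sqr_ge0.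
have : 0 <= q * m4V by exact: mulr_ge0.
by nra.
Qed.

(** Only the immigrants are common to both factors, so the covariance stays constant, whereas the
    variance of [dd k x] grows with the population [x]. *)
Lemma dd_cov k x : L1 P (fun w => incU k w * dd k x w) /\
  Ex P (fun w => incU k w * dd k x w) = covUV.
Proof.
have kE : (known Y [set (inr k : I)] (incU k)) by exact: incU_known.
have kS : known Y [set i : I | if i is inl _ then True else False] (Ssum k (idx x)).
  exact: Ssum_known.
have [L E] := known_Ex mY indY (A := [set (inr k : I)])
   (B := [set i : I | if i is inl _ then True else False])
   (fun i (h : i = inr k) => ltac:(by rewrite h)) kE kS (incU_L1' k) (Ssum_L1' k _).
have DE : (fun w => incU k w * dd k x w) =
    (fun w => incU k w * Ssum k (idx x) w + incU k w * incE k w).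
  by apply/funext => w; rewrite /dd mulrDr.
rewrite DE; split; first by apply: L1D L _; exact: incUE_L1.
rewrite ExD//; last exact: incUE_L1.
rewrite E incUE_cov incU_mean mul0r add0r//.
Qed.

(** * Integrability through one majorant for all generations *)

Definition Lam n w := 1 + UU n w + `|mU| + `|mV|.

(* Since [Lam n] has eight moments, [dom n p f] with [p <= 8] implies integrability. *)
Definition dom n p (f : T -> R) :=
  measurable_fun setT f /\ exists C, forall w, `|f w| <= C * Lam n w ^+ p.

Lemma UU_ge0 k w : 0 <= UU k w.
Proof. by rewrite addr_ge0. Qed.

(** The total population never decreases, which lets [Lam n] dominate every generation up to [n]. *)
Lemma UU_mono k n w : (k <= n)%N -> UU k w <= UU n w.
Proof.
elim: n => [|n IH]; first by rewrite leqn0 => /eqP ->.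
rewrite leq_eqVlt => /orP[/eqP -> //|]; rewrite ltnS => /IH h.
by rewrite UU_step (le_trans h)// lerDl immig_ge0.
Qed.

Lemma VV_le k w : `|VV k w| <= UU k w.
Proof.
rewrite /VV /UU ler_norml; apply/andP; split.
  by have : (0:R) <= (X k w).1%:R by []; lra.
by have : (0:R) <= (X k w).2%:R by []; lra.
Qed.

Lemma Lam_ge1 n w : 1 <= Lam n w.
Proof.
by rewrite /Lam; have := UU_ge0 n w; have := normr_ge0 mU; have := normr_ge0 mV; lra.
Qed.

Lemma Lam_ge0 n w : 0 <= Lam n w.
Proof. exact: le_trans (Lam_ge1 n w). Qed.

Lemma UU_measurable k : measurable_fun setT (UU k).
Proof. by apply: (@known_mfun (past k)); exact: UU_known. Qed.
Lemma VV_measurable k : measurable_fun setT (VV k).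
Proof. by apply: (@known_mfun (past k)); exact: VV_known. Qed.

Lemma sqr_convex (l x y : R) : 0 <= l <= 1 ->
  (l * x + (1 - l) * y) ^+ 2 <= l * x ^+ 2 + (1 - l) * y ^+ 2.
Proof.
move=> /andP[l0 l1]; rewrite -subr_ge0.
have -> : l * x ^+ 2 + (1 - l) * y ^+ 2 - (l * x + (1 - l) * y) ^+ 2 =
  l * (1 - l) * (x - y) ^+ 2 by ring.
by rewrite mulr_ge0 ?sqr_ge0// mulr_ge0// subr_ge0.
Qed.

Lemma pow4_convex (l x y : R) : 0 <= l <= 1 ->
  (l * x + (1 - l) * y) ^+ 4 <= l * x ^+ 4 + (1 - l) * y ^+ 4.
Proof.
move=> l01; rewrite !(exprM _ 2 2); apply: le_trans (sqr_convex _ _ l01).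
rewrite lerXn2r ?nnegrE ?sqr_ge0 ?sqr_convex//.
by case/andP: l01 => l0 l1; rewrite addr_ge0// mulr_ge0 ?sqr_ge0// subr_ge0.
Qed.

Lemma pow8_convex (l x y : R) : 0 <= l <= 1 ->
  (l * x + (1 - l) * y) ^+ 8 <= l * x ^+ 8 + (1 - l) * y ^+ 8.
Proof.
move=> l01; rewrite !(exprM _ 2 4); apply: le_trans (pow4_convex _ _ l01).
rewrite lerXn2r ?nnegrE ?sqr_ge0 ?sqr_convex//.
by case/andP: l01 => l0 l1; rewrite addr_ge0// mulr_ge0 ?sqr_ge0// subr_ge0.
Qed.

Definition u8 := Ex P (fun w => immig 0 w ^+ 8).

Lemma immig_u8 k : Ex P (fun w => immig k w ^+ 8) = u8.
Proof.
exact: (Ex_same_law (meps k) (meps 0) (@eps_law k) (fun x => (x.1%:R + x.2%:R) ^+ 8)).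
Qed.

(** Minkowski's bound in convex form: U_(k+1) / (k+1) is the convex combination of U_k / k, with
    weight k / (k+1), and of the new immigrants. *)
Lemma UU8 k : L1 P (fun w => UU k w ^+ 8) /\
  Ex P (fun w => UU k w ^+ 8) <= k%:R ^+ 8 * u8.
Proof.
elim: k => [|k [L E]].
  have U0 w : UU 0 w ^+ 8 = 0 by rewrite /UU/= addr0 expr0n.
  split; first by rewrite (funext U0); exact: L1_cst.
  by rewrite (eq_Ex _ U0) Ex_cst expr0n mul0r.
pose l : R := k%:R / k.+1%:R.
have k0 : (0:R) < k.+1%:R by [].
have l01 : 0 <= l <= 1 by rewrite /l divr_ge0//= ler_pdivrMr// mul1r ler_nat.
have l1E : 1 - l = k.+1%:R^-1 by rewrite /l -[k.+1%:R]natr1; field; rewrite natr1 pnatr_eq0.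
have cvx w : UU k.+1 w ^+ 8 <=
    k.+1%:R ^+ 8 * (l * (UU k w / k%:R) ^+ 8 + (1 - l) * immig k w ^+ 8).
  (* For [k = 0] the quotient by zero is 0, the weight [l] is 0 and U_1 consists of immigrants
     only. *)
  case: (posnP k) => [k00|kpos].
    rewrite UU_step k00 expr1n mul1r /l k00 mul0r mul0r add0r subr0 mul1r.
    by rewrite /UU/= add0r add0r.
  rewrite -[X in X <= _]mul1r; apply: le_trans (ler_wpM2l _ (pow8_convex _ _ l01)); last by rewrite exprn_ge0.
  rewrite -exprMn mul1r UU_step l1E /l.
  rewrite (_ : _ * (_ + _) = UU k w + immig k w)//.
  have k1 : k.+1%:R != 0 :> R by rewrite pnatr_eq0.
  have k2 : k%:R != 0 :> R by rewrite pnatr_eq0 -lt0n.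
  move: k1 k2; move: (k.+1%:R : R) (k%:R : R) => A B A0 B0.
  by field; rewrite A0 B0.
have LI : L1 P (fun w => k.+1%:R ^+ 8 *
     (l * (UU k w / k%:R) ^+ 8 + (1 - l) * immig k w ^+ 8)).
  apply: L1Z; apply: L1D; apply: L1Z; last exact: immig8.
  under eq_fun do rewrite exprMn mulrC; exact: L1Z.
have L' : L1 P (fun w => UU k.+1 w ^+ 8).
  apply: L1_le LI _; first exact: measurable_funX (@UU_measurable _).
  by move=> w; rewrite ger0_norm// exprn_ge0// UU_ge0.
split => //; apply: le_trans (Ex_le L' LI cvx) _.
have LU : L1 P (fun w => (UU k w / k%:R) ^+ 8).
  under eq_fun do rewrite exprMn mulrC; exact: L1Z.
rewrite ExZ ?ExD ?ExZ ?immig_u8; try by do ?[exact: immig8|exact: LU|apply: L1D|apply: L1Z].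
apply: ler_wpM2l; first by rewrite exprn_ge0.
have u0 : 0 <= u8 by apply: Ex_ge0 => w; rewrite exprn_ge0// immig_ge0.
have -> : u8 = l * u8 + (1 - l) * u8 by ring.
rewrite [X in _ + (1 - l) * X](_ : _ = u8)//; last by ring.
rewrite lerD2r; apply: ler_wpM2l; first by case/andP: l01.
under eq_Ex do rewrite exprMn mulrC.
rewrite ExZ// exprVn; case: (posnP k) => [->|kpos].
  by rewrite expr0n/= invr0 mul0r.
by rewrite mulrC ler_pdivrMr ?exprn_gt0 ?ltr0n// mulrC.
Qed.

Lemma Lam8 n : L1 P (fun w => Lam n w ^+ 8).
Proof.
pose c : R := 1 + `|mU| + `|mV|.
have c0 : 0 <= c by rewrite !addr_ge0.
apply: (L1_le (g := fun w => 2 ^+ 8 * UU n w ^+ 8 + (2 * c) ^+ 8)).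
- apply: measurable_funX; rewrite (_ : Lam n = fun w => UU n w + c).
    by apply: measurable_funD => //; exact: UU_measurable.
  by apply/funext => w; rewrite /Lam /c; ring.
- by apply: L1D; [apply: L1Z; exact: (UU8 n).1|exact: L1_cst].
move=> w; have u0 := UU_ge0 n w.
have -> : Lam n w = UU n w + c by rewrite /Lam /c; ring.
rewrite ger0_norm ?exprn_ge0 ?addr_ge0// -exprMn.
have [uc|/ltW uc] := leP (UU n w) c.
  apply: le_trans (_ : (2 * c) ^+ 8 <= _).
    by rewrite lerXn2r ?nnegrE ?addr_ge0 ?mulr_ge0//; lra.
  by rewrite lerDr exprn_ge0// mulr_ge0.
apply: le_trans (_ : (2 * UU n w) ^+ 8 <= _).
  by rewrite lerXn2r ?nnegrE ?addr_ge0 ?mulr_ge0//; lra.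
by rewrite lerDl exprn_ge0// mulr_ge0.
Qed.

Implicit Types f g : T -> R.

Lemma Lam_measurable n : measurable_fun setT (Lam n).
Proof.
rewrite (_ : Lam n = fun w => UU n w + (1 + `|mU| + `|mV|)).
  by apply: measurable_funD => //; exact: UU_measurable.
by apply/funext => w; rewrite /Lam; ring.
Qed.

Lemma LamX_L1 n p : (p <= 8)%N -> L1 P (fun w => Lam n w ^+ p).
Proof.
move=> p8; apply: L1_powers p8 (@Lam_measurable n) (Lam8 n) _ => w.
by rewrite ger0_norm// Lam_ge0.
Qed.

Lemma dom_ex n p f : dom n p f -> exists2 C, 0 <= C & forall w, `|f w| <= C * Lam n w ^+ p.
Proof.
move=> [_ [C h]]; exists `|C|; first exact: normr_ge0.
move=> w; apply: le_trans (h w) _; apply: ler_wpM2r (ler_norm C).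
by rewrite exprn_ge0// Lam_ge0.
Qed.

Lemma dom_L1 n p f : (p <= 8)%N -> dom n p f -> L1 P f.
Proof.
move=> p8 [mf [C h]]; apply: L1_le mf _ h; apply: L1Z; exact: LamX_L1.
Qed.

Lemma dom_weaken n p q f : (p <= q)%N -> dom n p f -> dom n q f.
Proof.
move=> pq df; split; first by case: df.
have [C C0 h] := dom_ex df; exists C => w; apply: le_trans (h w) _.
by apply: ler_wpM2l => //; apply: ler_weXn2l => //; exact: Lam_ge1.
Qed.

Lemma dom_bounded n c f : measurable_fun setT f -> (forall w, `|f w| <= c) -> dom n 0 f.
Proof. by move=> mf fc; split => //; exists c => w; rewrite expr0 mulr1. Qed.

Lemma dom_cst n c : dom n 0 (fun=> c).
Proof. exact: (@dom_bounded n `|c|). Qed.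

Lemma domD n p q f g : dom n p f -> dom n q g -> dom n (maxn p q) (fun w => f w + g w).
Proof.
move=> /(dom_weaken (leq_maxl p q)) df /(dom_weaken (leq_maxr p q)) dg.
split; first by apply: measurable_funD; [case: df|case: dg].
have [C C0 h] := dom_ex df; have [D D0 h'] := dom_ex dg; exists (C + D) => w.
by rewrite mulrDl; apply: le_trans (ler_normD _ _) _; exact: lerD.
Qed.

Lemma domM n p q f g : dom n p f -> dom n q g -> dom n (p + q) (fun w => f w * g w).
Proof.
move=> df dg; split; first by apply: measurable_funM; [case: df|case: dg].
have [C C0 h] := dom_ex df; have [D D0 h'] := dom_ex dg; exists (C * D) => w.
by rewrite exprD mulrACA normrM; exact: ler_pM.
Qed.

Lemma domN n p f : dom n p f -> dom n p (fun w => - f w).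
Proof.
move=> df; split.
  under eq_fun do rewrite -sub0r.
  by apply: measurable_funB => //; case: df.
by have [C C0 h] := dom_ex df; exists C => w; rewrite normrN.
Qed.

Lemma domB n p q f g : dom n p f -> dom n q g -> dom n (maxn p q) (fun w => f w - g w).
Proof. by move=> df dg; apply: domD df _; exact: domN. Qed.

Lemma domX n p f k : dom n p f -> dom n (p * k) (fun w => f w ^+ k).
Proof.
move=> df; split; first by apply: measurable_funX; case: df.
have [C C0 h] := dom_ex df; exists (C ^+ k) => w.
by rewrite normrX exprM -exprMn lerXn2r ?nnegrE ?mulr_ge0 ?exprn_ge0 ?Lam_ge0.
Qed.

Lemma dom_norm n p f : dom n p f -> dom n p (fun w => `|f w|).
Proof.
move=> df; split; first by apply: measurableT_comp => //; case: df.
by have [C C0 h] := dom_ex df; exists C => w; rewrite normr_id.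
Qed.

Lemma known_cos A (f : T -> R) : known Y A f -> known Y A (fun w => cos (f w)).
Proof. by apply: known_comp; apply: continuous_measurable_fun; exact: continuous_cos. Qed.

Lemma known_sin A (f : T -> R) : known Y A f -> known Y A (fun w => sin (f w)).
Proof. by apply: known_comp; apply: continuous_measurable_fun; exact: continuous_sin. Qed.

Lemma known_norm A (f : T -> R) : known Y A f -> known Y A (fun w => `|f w|).
Proof. exact: known_comp. Qed.

Lemma dom_UU n k : (k <= n)%N -> dom n 1 (UU k).
Proof.
move=> kn; split; first exact: UU_measurable.
exists 1 => w; rewrite mul1r expr1 ger0_norm ?UU_ge0//.
apply: le_trans (UU_mono w kn) _; rewrite /Lam.
by have := normr_ge0 mU; have := normr_ge0 mV; lra.
Qed.

Lemma dom_VV n k : (k <= n)%N -> dom n 1 (VV k).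
Proof.
move=> kn; split; first exact: VV_measurable.
have [C C0 h] := dom_ex (dom_UU kn); exists C => w.
by apply: le_trans (VV_le k w) _; apply: le_trans (h w); exact: ler_norm.
Qed.

Lemma dom_incU n k : (k < n)%N -> dom n 1 (incU k).
Proof.
move=> kn.
have E : incU k = fun w => UU k.+1 w - UU k w - mU.
  by apply/funext => w; rewrite UU_step /incU; ring.
rewrite E; apply: (dom_weaken (p := maxn (maxn 1 1) 0)) => //.
by apply: domB (dom_cst _ _); apply: domB; apply: dom_UU => //; exact: ltnW.
Qed.

Lemma dom_dX n k : (k < n)%N -> dom n 1 (dX k).
Proof.
move=> kn.
have E : dX k = fun w => VV k.+1 w - delta * VV k w - mV.
  by apply/funext => w; rewrite VV_step; ring.
rewrite E; apply: (dom_weaken (p := maxn (maxn 1 (0 + 1)) 0)) => //.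
apply: domB (dom_cst _ _); apply: domB; first exact: dom_VV.
by apply: domM (dom_cst _ _) _; apply: dom_VV; exact: ltnW.
Qed.

Lemma incU_Ex k n p j (H : T -> R) : (p <= 8)%N -> (j <= 8)%N ->
  known Y (past k) H -> dom n p H ->
  Ex P (fun w => H w * incU k w ^+ j) = Ex P H * Ex P (fun w => incU k w ^+ j).
Proof.
move=> p8 j8 kH dH.
have kU : known Y (now k) (fun w => incU k w ^+ j).
  by apply: knownX; exact: incU_known.
by have [] := known_Ex mY indY (@past_now k) kH kU (dom_L1 p8 dH) (@incU_L1 k j j8).
Qed.

Lemma incU_Ex1 k n p (H : T -> R) : (p <= 8)%N ->
  known Y (past k) H -> dom n p H -> Ex P (fun w => H w * incU k w) = 0.
Proof.
move=> p8 kH dH.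
rewrite (@eq_Ex _ _ _ _ _ (fun w => H w * incU k w ^+ 1)); last by move=> w; rewrite expr1.
rewrite (@incU_Ex k n p 1 H)// [X in _ * X](_ : _ = 0) ?mulr0//.
by under eq_Ex do rewrite expr1; exact: incU_mean.
Qed.

Lemma dd_now k x : known Y (now k) (dd k x).
Proof. exact: dd_known. Qed.

Lemma dX_Ex n k p j (H : T -> R) (phi : nat * nat -> R) :
  (k < n)%N -> (p + j <= 8)%N -> (j <= 4)%N ->
  known Y (past k) H -> dom n p H ->
  (forall x, Ex P (fun w => dd k x w ^+ j) = phi x) ->
  dom n j (fun w => phi (X k w)) ->
  Ex P (fun w => H w * dX k w ^+ j) = Ex P (fun w => H w * phi (X k w)).
Proof.
move=> kn p8 j4 kH dH Ephi dphi.
have := @cond_Ex k H (fun x w => dd k x w ^+ j) kH.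
have -> : (fun w => H w * Ex P (fun w0 => dd k (X k w) w0 ^+ j)) =
          (fun w => H w * phi (X k w)) by apply/funext => w; rewrite Ephi.
apply.
- by move=> x; apply: knownX; exact: dd_now.
- by move=> x; exact: dd_L1.
- by apply: dom_L1 dH; apply: leq_trans p8; exact: leq_addr.
- apply: (dom_L1 p8); apply: domM dH _.
  by apply: (@dom_weaken _ (1 * j)); [rewrite mul1n|apply: domX; exact: dom_dX].
- by apply: (dom_L1 p8); exact: domM dH dphi.
Qed.

Lemma dX_Ex1 n k p (H : T -> R) : (k < n)%N -> (p <= 7)%N ->
  known Y (past k) H -> dom n p H -> Ex P (fun w => H w * dX k w) = 0.
Proof.
move=> kn p7 kH dH.
rewrite (@eq_Ex _ _ _ _ _ (fun w => H w * dX k w ^+ 1)); last by move=> w; rewrite expr1.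
rewrite (@dX_Ex n k p 1 H (fun=> 0))//.
- by under eq_Ex do rewrite mulr0; rewrite Ex_cst.
- by rewrite addn1.
- by move=> x; under eq_Ex do rewrite expr1; exact: dd_mean.
- by apply: dom_weaken (dom_cst _ _).
Qed.

Lemma dX_Ex2 n k p (H : T -> R) : (k < n)%N -> (p <= 6)%N ->
  known Y (past k) H -> dom n p H ->
  Ex P (fun w => H w * dX k w ^+ 2) = Ex P (fun w => H w * (gam * UU k w + s2V)).
Proof.
move=> kn p6 kH dH.
rewrite (@dX_Ex n k p 2 H (fun x => gam * (x.1 + x.2)%:R + s2V))//.
- by apply: eq_Ex => w; rewrite natrD.
- by rewrite addn2.
- by move=> x; exact: dd_var.
- apply: (dom_weaken (p := maxn (0 + 1) 0)) => //.
  apply: domD (dom_cst _ _); apply: domM (dom_cst _ _) _.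
  have -> : (fun w => ((X k w).1 + (X k w).2)%:R) = UU k.
    by apply/funext => w; rewrite natrD.
  by apply: dom_UU; exact: ltnW.
Qed.

Lemma cst4_ge0 : 0 <= cst4.
Proof. by rewrite /cst4; have := s2V_ge0; have := m4V_ge0; lra. Qed.

Lemma dX_Ex4 n k p (H : T -> R) : (k < n)%N -> (p <= 4)%N ->
  known Y (past k) H -> dom n p H -> (forall w, 0 <= H w) ->
  Ex P (fun w => H w * dX k w ^+ 4) <= cst4 * Ex P (fun w => H w * (1 + UU k w) ^+ 2).
Proof.
move=> kn p4 kH dH H0.
pose phi x := Ex P (fun w => dd k x w ^+ 4).
have phi0 x : 0 <= phi x by apply: Ex_ge0 => w; exact: exprn_even_ge0.
have phile w : phi (X k w) <= cst4 * (1 + UU k w) ^+ 2.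
  by have := dd_m4 k (X k w); rewrite natrD.
have dU : dom n 2 (fun w => cst4 * (1 + UU k w) ^+ 2).
  have := domM (dom_cst n cst4) (domX 2 (domD (dom_cst n 1) (dom_UU (ltnW kn)))).
  exact.
have dphi : dom n 2 (fun w => phi (X k w)).
  split; first by apply: (@known_mfun (past k)); apply: knownN_comp; exact: X_known.
  have [C C0 h] := dom_ex dU; exists C => w.
  rewrite ger0_norm//; apply: le_trans (phile w) _.
  by apply: le_trans (h w); exact: ler_norm.
rewrite (@dX_Ex n k p 4 H phi)//; [|by rewrite addn4|exact: dom_weaken dphi].
rewrite -ExZ; last first.
  apply: (@dom_L1 n (p + 2)); first by rewrite addn2 (leq_trans _ (_ : 6 <= 8)%N).
  have dU' := domX 2 (domD (dom_cst n 1) (dom_UU (ltnW kn))).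
  exact: domM dH dU'.
apply: Ex_le.
- by apply: (@dom_L1 n (p + 2)); [rewrite addn2 (leq_trans _ (_ : 6 <= 8)%N)|exact: domM dH dphi].
- rewrite (_ : (fun w => _) = (fun w => H w * (cst4 * (1 + UU k w) ^+ 2))); last first.
    by apply/funext => w; ring.
  by apply: (@dom_L1 n (p + 2)); [rewrite addn2 (leq_trans _ (_ : 6 <= 8)%N)|exact: domM dH dU].
- move=> w; rewrite mulrCA; exact: ler_wpM2l.
Qed.

Lemma incUdX_Ex n k p (H : T -> R) : (k < n)%N -> (p <= 6)%N ->
  known Y (past k) H -> dom n p H ->
  Ex P (fun w => H w * (incU k w * dX k w)) = covUV * Ex P H.
Proof.
move=> kn p6 kH dH.
have := @cond_Ex k H (fun x w => incU k w * dd k x w) kH.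
have -> : (fun w => H w * Ex P (fun w0 => incU k w0 * dd k (X k w) w0)) =
          (fun w => covUV * H w).
  by apply/funext => w; rewrite (dd_cov k _).2 mulrC.
have LH : L1 P H by apply: dom_L1 dH; exact: leq_trans p6 _.
rewrite ExZ//; apply => //.
- by move=> x; apply: knownM; [exact: incU_known|exact: dd_now].
- by move=> x; exact: (dd_cov k x).1.
- apply: (@dom_L1 n (p + 2)); first by rewrite addn2.
  by apply: domM dH _; apply: (domM (p := 1) (q := 1)); [exact: dom_incU|exact: dom_dX].
- exact: L1Z.
Qed.

(** * Rescaled variables and uniform moment bounds *)

Definition hh n : R := n%:R^-1.
Definition gg n : R := Num.sqrt (hh n).
(* Rescaled variables: U/n, V/sqrt n, (U - m k)/sqrt n, d/sqrt n; their moments are bounded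
   uniformly over [k <= n]. *)
Definition uh n k w := hh n * UU k w.
Definition vh n k w := gg n * VV k w.
Definition eh n k w := gg n * (UU k w - mU * k%:R).
Definition dh n k w := gg n * dX k w.
Definition tk n k : R := k%:R * hh n.
(** The exponents are those with which Young-type inequalities absorb every product that occurs: e
    u, e v^2 and u v through squares and fourth powers, and |v|^3 (1 + u)^2 through v^4 and u^8. *)
Definition QQ n k w := 1 + uh n k w ^+ 8 + vh n k w ^+ 4 + eh n k w ^+ 2.

Lemma hh_ge0 n : 0 <= hh n.
Proof. by rewrite invr_ge0. Qed.

Lemma hh_le1 n : hh n <= 1.
Proof.
case: n => [|n]; first by rewrite /hh invr0.
by rewrite /hh invf_le1// ler1n.
Qed.

Lemma gg_ge0 n : 0 <= gg n. Proof. exact: sqrtr_ge0. Qed.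

Lemma ggE n : gg n * gg n = hh n.
Proof. by rewrite -expr2 sqr_sqrtr// hh_ge0. Qed.

Lemma gg_le1 n : gg n <= 1.
Proof. by rewrite -sqrtr1 ler_wsqrtr// hh_le1. Qed.

Lemma hh_le_gg n : hh n <= gg n.
Proof. by rewrite -ggE ler_piMr ?gg_ge0// gg_le1. Qed.

Lemma tk_ge0 n k : 0 <= tk n k.
Proof. by rewrite mulr_ge0// hh_ge0. Qed.

Lemma tk_le1 n k : (k <= n)%N -> tk n k <= 1.
Proof.
case: n => [|n]; first by rewrite leqn0 => /eqP ->; rewrite /tk mul0r.
by move=> kn; rewrite /tk ler_pdivrMr// mul1r ler_nat.
Qed.

Lemma uhE n k w : uh n k w = mU * tk n k + gg n * eh n k w.
Proof. by rewrite /uh /tk /eh -ggE; ring. Qed.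

Lemma vh_step n k w : vh n k.+1 w = delta * vh n k w + gg n * mV + dh n k w.
Proof. by rewrite /vh VV_step /dh; ring. Qed.

Lemma eh_step n k w : eh n k.+1 w = eh n k w + gg n * incU k w.
Proof. by rewrite /eh UU_step /incU -[k.+1%:R]natr1; ring. Qed.

Lemma known_uh n k : known Y (past k) (uh n k).
Proof. by apply: knownM; [exact: known_cst|exact: UU_known]. Qed.
Lemma known_vh n k : known Y (past k) (vh n k).
Proof. by apply: knownM; [exact: known_cst|exact: VV_known]. Qed.
Lemma known_eh n k : known Y (past k) (eh n k).
Proof.
apply: knownM; first exact: known_cst.
by apply: knownB (@UU_known k) _; exact: known_cst.
Qed.

Lemma dom_uh N n k : (k <= N)%N -> dom N 1 (uh n k).
Proof. by move=> kn; apply: domM (dom_cst _ _) (dom_UU kn). Qed.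
Lemma dom_vh N n k : (k <= N)%N -> dom N 1 (vh n k).
Proof. by move=> kn; apply: domM (dom_cst _ _) (dom_VV kn). Qed.
Lemma dom_eh N n k : (k <= N)%N -> dom N 1 (eh n k).
Proof.
by move=> kn; apply: domM (dom_cst _ _) (domB (dom_UU kn) (dom_cst _ _)).
Qed.
Lemma dom_dh N n k : (k < N)%N -> dom N 1 (dh n k).
Proof. by move=> kn; apply: domM (dom_cst _ _) (dom_dX kn). Qed.

Lemma uh_ge0 n k w : 0 <= uh n k w.
Proof. by rewrite mulr_ge0 ?hh_ge0 ?UU_ge0. Qed.

Lemma dh_Ex1 n k p (H : T -> R) : (k < n)%N -> (p <= 7)%N ->
  known Y (past k) H -> dom n p H -> Ex P (fun w => H w * dh n k w) = 0.
Proof.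
move=> kn p7 kH dH.
rewrite (@eq_Ex _ _ _ _ _ (fun w => gg n * (H w * dX k w))); last first.
  by move=> w; rewrite /dh mulrCA.
rewrite ExZ; first by rewrite (dX_Ex1 kn p7)// mulr0.
by apply: (@dom_L1 n (p + 1)); [rewrite addn1|exact: domM dH (dom_dX kn)].
Qed.

Lemma dh_Ex2 n k p (H : T -> R) : (k < n)%N -> (p <= 6)%N ->
  known Y (past k) H -> dom n p H ->
  Ex P (fun w => H w * (dh n k w ^+ 2 - (gam * uh n k w + hh n * s2V))) = 0.
Proof.
move=> kn p6 kH dH; have kn' := ltnW kn.
have D1 : dom n (p + 2) (fun w => H w * dX k w ^+ 2).
  by apply: domM dH _; exact: (domX 2 (dom_dX kn)).
have D2 : dom n (p + 1) (fun w => H w * (gam * UU k w + s2V)).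
  apply: domM dH _.
  exact: (domD (domM (dom_cst n gam) (dom_UU kn')) (dom_cst n s2V)).
rewrite (@eq_Ex _ _ _ _ _ (fun w => hh n * (H w * dX k w ^+ 2) -
    hh n * (H w * (gam * UU k w + s2V)))); last first.
  by move=> w; rewrite /dh /uh -ggE; ring.
have L1' : L1 P (fun w => H w * dX k w ^+ 2) by apply: dom_L1 D1; rewrite addn2.
have L2' : L1 P (fun w => H w * (gam * UU k w + s2V)).
  by apply: dom_L1 D2; rewrite addn1 ltnS (leq_trans p6).
by rewrite ExB ?ExZ ?(dX_Ex2 kn p6)// ?subrr//; exact: L1Z.
Qed.

Lemma adh_Ex n k p (H : T -> R) : (k < n)%N -> (p <= 6)%N ->
  known Y (past k) H -> dom n p H ->
  Ex P (fun w => H w * (incU k w * dh n k w - gg n * covUV)) = 0.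
Proof.
move=> kn p6 kH dH.
have LH : L1 P H by apply: dom_L1 dH; exact: leq_trans p6 _.
have L' : L1 P (fun w => H w * (incU k w * dX k w)).
  apply: (@dom_L1 n (p + 2)); first by rewrite addn2.
  by apply: domM dH _; exact: (domM (dom_incU kn) (dom_dX kn)).
rewrite (@eq_Ex _ _ _ _ _ (fun w => gg n * (H w * (incU k w * dX k w)) -
   (gg n * covUV) * H w)); last by move=> w; rewrite /dh; ring.
rewrite ExB ?ExZ ?(incUdX_Ex kn p6)//; [by ring|exact: L1Z|exact: L1Z].
Qed.

Lemma a2_Ex n k p (H : T -> R) : (k < n)%N -> (p <= 6)%N ->
  known Y (past k) H -> dom n p H ->
  Ex P (fun w => H w * (incU k w ^+ 2 - s2U)) = 0.
Proof.
move=> kn p6 kH dH.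
have LH : L1 P H by apply: dom_L1 dH; exact: leq_trans p6 _.
have L' : L1 P (fun w => H w * incU k w ^+ 2).
  apply: (@dom_L1 n (p + 2)); first by rewrite addn2.
  by apply: domM dH _; exact: (domX 2 (dom_incU kn)).
rewrite (@eq_Ex _ _ _ _ _ (fun w => H w * incU k w ^+ 2 - s2U * H w)); last first.
  by move=> w; ring.
rewrite ExB ?ExZ ?(@incU_Ex k n p 2)//; [|exact: leq_trans p6 _|exact: L1Z].
by rewrite incU_var; ring.
Qed.

Lemma dh_Ex4 n k p (H : T -> R) : (k < n)%N -> (p <= 4)%N ->
  known Y (past k) H -> dom n p H -> (forall w, 0 <= H w) ->
  Ex P (fun w => H w * dh n k w ^+ 4) <= cst4 * Ex P (fun w => H w * (1 + uh n k w) ^+ 2).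
Proof.
move=> kn p4 kH dH H0.
have h0 := hh_ge0 n; have h1 := hh_le1 n.
have D1 : dom n (p + 4) (fun w => H w * dX k w ^+ 4).
  by apply: domM dH _; exact: (domX 4 (dom_dX kn)).
have D2 : dom n (p + 2) (fun w => H w * (1 + UU k w) ^+ 2).
  by apply: domM dH _; exact: (domX 2 (domD (dom_cst n 1) (dom_UU (ltnW kn)))).
have D3 : dom n (p + 2) (fun w => H w * (1 + uh n k w) ^+ 2).
  by apply: domM dH _; exact: (domX 2 (domD (dom_cst n 1) (dom_uh n (ltnW kn)))).
have p8 : (p + 4 <= 8)%N by rewrite addn4.
have p8' : (p + 2 <= 8)%N by rewrite addn2 (leq_trans _ (_ : 6 <= 8)%N).
rewrite (@eq_Ex _ _ _ _ _ (fun w => hh n ^+ 2 * (H w * dX k w ^+ 4))); last first.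
  by move=> w; rewrite /dh -ggE; ring.
rewrite ExZ; last exact: dom_L1 D1.
apply: le_trans (ler_wpM2l _ (dX_Ex4 kn p4 kH dH H0)) _; first exact: sqr_ge0.
rewrite mulrCA; apply: ler_wpM2l; first exact: cst4_ge0.
rewrite -ExZ; last exact: dom_L1 D2.
apply: Ex_le.
- by apply: L1Z; exact: dom_L1 D2.
- exact: dom_L1 D3.
- move=> w; rewrite mulrCA; apply: ler_wpM2l => //.
  rewrite -exprMn mulrDr mulr1; apply: lerXn2r; rewrite ?nnegrE.
  + by rewrite addr_ge0// mulr_ge0// UU_ge0.
  + by rewrite addr_ge0// uh_ge0.
  + by rewrite /uh lerD2r.
Qed.

Lemma uh8 n k : (k <= n)%N -> Ex P (fun w => uh n k w ^+ 8) <= u8.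
Proof.
move=> kn; rewrite (@eq_Ex _ _ _ _ _ (fun w => hh n ^+ 8 * UU k w ^+ 8)); last first.
  by move=> w; rewrite /uh exprMn.
have [L E] := UU8 k; rewrite ExZ//.
have u0 : 0 <= u8 by apply: Ex_ge0 => w; rewrite exprn_ge0// immig_ge0.
apply: le_trans (ler_wpM2l _ E) _; first by rewrite exprn_ge0// hh_ge0.
rewrite mulrA -exprMn; apply: ler_piMl => //.
by apply: exprn_ile1; rewrite mulrC ?tk_ge0// ?tk_le1.
Qed.

Lemma eh2 n k : (k <= n)%N -> Ex P (fun w => eh n k w ^+ 2) <= s2U.
Proof.
(* The increments of [eh] are centred given the past, so the second moments add exactly. *)
move=> kn; suff E : Ex P (fun w => eh n k w ^+ 2) = tk n k * s2U.
  by rewrite E; apply: ler_piMl; [exact: s2U_ge0|exact: tk_le1].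
elim: k kn => [|k IH] kn.
  rewrite (@eq_Ex _ _ _ _ _ (fun=> 0)) ?Ex_cst /tk ?mul0r// => w.
  by rewrite /eh /UU/= addr0 mulr0 subrr mulr0 expr0n.
have de := dom_eh n (ltnW kn); have da := dom_incU kn.
rewrite (@eq_Ex _ _ _ _ _ (fun w => eh n k w ^+ 2 +
  (2 * gg n * (eh n k w * incU k w) + hh n * incU k w ^+ 2))); last first.
  by move=> w; rewrite eh_step -ggE; ring.
have L1a : L1 P (fun w => eh n k w ^+ 2) by apply: dom_L1 (domX 2 de).
have L2a : L1 P (fun w => eh n k w * incU k w) by apply: dom_L1 (domM de da).
have L3a : L1 P (fun w => incU k w ^+ 2) by apply: dom_L1 (domX 2 da).
rewrite !ExD ?ExZ; try by do ?[exact: L1a|exact: L2a|exact: L3a|apply: L1D|apply: L1Z].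
rewrite (incU_Ex1 _ (@known_eh n k) de)// incU_var.
by rewrite IH ?(ltnW kn)// /tk -[k.+1%:R]natr1; ring.
Qed.

(** A bound for E (g mV + d)^4 with rescaled [d]. With l = |delta|, the constant [vbound] is the
    fixed point of the recursion x = l x + vinc / (1 - l)^3 for the fourth moment of [vh]. *)
Definition vinc := 8 * mV ^+ 4 + 8 * (cst4 * (4 + 2 * u8)).
Definition vbound := vinc / (1 - `|delta|) ^+ 4.

Lemma u8_ge0 : 0 <= u8.
Proof. by apply: Ex_ge0 => w; rewrite exprn_ge0// immig_ge0. Qed.

Lemma vinc_ge0 : 0 <= vinc.
Proof.
have c0 := cst4_ge0; have u0 := u8_ge0.
have m4 : 0 <= mV ^+ 4 by exact: exprn_even_ge0.
by rewrite /vinc; have := mulr_ge0 c0 u0; nra.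
Qed.

Lemma vbound_ge0 : 0 <= vbound.
Proof. by rewrite /vbound divr_ge0 ?vinc_ge0 ?exprn_even_ge0. Qed.

Lemma pow2_le_pow8 (x : R) : 0 <= x -> x ^+ 2 <= 1 + x ^+ 8.
Proof.
move=> x0; have [x1|/ltW x1] := leP x 1.
  by apply: le_trans (exprn_ile1 _ x0 x1) _; rewrite lerDl exprn_ge0.
by apply: le_trans (ler_weXn2l x1 (_ : 2 <= 8)%N) _ => //; rewrite lerDr.
Qed.

Lemma vh4 n k : (k <= n)%N -> Ex P (fun w => vh n k w ^+ 4) <= vbound.
Proof.
elim: k => [|k IH] kn.
  rewrite (@eq_Ex _ _ _ _ _ (fun=> 0)) ?Ex_cst ?vbound_ge0// => w.
  by rewrite /vh /VV/= subr0 mulr0 expr0n.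
have kn' := ltnW kn.
set l := `|delta|; have l01 : 0 <= l <= 1 by rewrite normr_ge0 ltW// delta_norm.
have l1 : 0 < 1 - l by rewrite subr_gt0 delta_norm.
have dv := dom_vh n kn'; have db := dom_dh n kn; have du := dom_uh n kn'.
have Lv : L1 P (fun w => vh n k w ^+ 4) by apply: dom_L1 (domX 4 dv).
have Lb : L1 P (fun w => dh n k w ^+ 4) by apply: dom_L1 (domX 4 db).
have Lu : L1 P (fun w => uh n k w ^+ 8) by apply: dom_L1 (domX 8 du).
have Lu2 : L1 P (fun w => (1 + uh n k w) ^+ 2).
  by apply: dom_L1 (domX 2 (domD (dom_cst n 1) du)).
(* Convexity with weights l = |delta| and 1 - l; dividing the inhomogeneous part by 1 - l produces
   the factor (1 - l)^(-3). *)
have path w : vh n k.+1 w ^+ 4 <= l * vh n k w ^+ 4 +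
    (1 - l)^-1 ^+ 3 * (8 * mV ^+ 4 + 8 * dh n k w ^+ 4).
  have sd : (delta * vh n k w) = l * (Num.sg delta * vh n k w).
    by rewrite {1}[delta]numEsg /l; ring.
  have y0 : gg n * mV + dh n k w = (1 - l) * ((gg n * mV + dh n k w) / (1 - l)).
    by rewrite [RHS]mulrC divfK// gt_eqF.
  rewrite vh_step -addrA sd y0; apply: le_trans (pow4_convex _ _ l01) _.
  apply: lerD.
    rewrite exprMn; apply: ler_wpM2l; first by case/andP: l01.
    rewrite ler_piMl ?exprn_even_ge0//; case: sgrP => _.
    - by rewrite expr0n ler01.
    - by rewrite expr1n.
    - by rewrite (exprM _ 2 2) sqrrN !expr1n.
  have -> : (1 - l) * ((gg n * mV + dh n k w) / (1 - l)) ^+ 4 =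
      (1 - l)^-1 ^+ 3 * (gg n * mV + dh n k w) ^+ 4.
    by field; rewrite gt_eqF.
  apply: ler_wpM2l; first by rewrite exprn_ge0// invr_ge0 ltW.
  apply: le_trans (pow4D_le _ _) _; rewrite lerD2r ler_pM2l//.
  rewrite exprMn ler_piMl ?exprn_even_ge0//.
  by apply: exprn_ile1; [exact: gg_ge0|exact: gg_le1].
have LR : L1 P (fun w => l * vh n k w ^+ 4 +
    (1 - l)^-1 ^+ 3 * (8 * mV ^+ 4 + 8 * dh n k w ^+ 4)).
  by apply: L1D; apply: L1Z => //; apply: L1D (L1_cst _ _) _; exact: L1Z.
have LL : L1 P (fun w => vh n k.+1 w ^+ 4).
  by apply: (@dom_L1 n 4) => //; exact: (domX 4 (dom_vh n kn)).
apply: le_trans (Ex_le LL LR path) _.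
rewrite ExD ?ExZ ?ExD ?ExZ ?Ex_cst; try by
  do ?[exact: Lv|exact: Lb|exact: L1_cst|apply: L1D|apply: L1Z].
have Eb : Ex P (fun w => dh n k w ^+ 4) <= cst4 * (4 + 2 * u8).
  have := @dh_Ex4 n k 0 (fun=> 1) kn isT (@known_cst R _ _ _ Y _ 1) (dom_cst _ _) (fun=> ler01).
  rewrite (_ : (fun w => 1 * dh n k w ^+ 4) = fun w => dh n k w ^+ 4); last first.
    by apply/funext => w; rewrite mul1r.
  move=> h; apply: le_trans h _; apply: ler_wpM2l; first exact: cst4_ge0.
  (* (1 + u)^2 <= 2 + 2 u^2, and u^2 <= 1 + u^8. *)
  apply: le_trans (_ : Ex P (fun w => 4 + 2 * uh n k w ^+ 8) <= _).
    apply: Ex_le.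
    + by under eq_fun do rewrite mul1r.
    + by apply: L1D (L1_cst _ _) _; exact: L1Z.
    + move=> w; rewrite mul1r; have := pow2_le_pow8 (uh_ge0 n k w).
      by have := sqr_ge0 (uh n k w - 1); nra.
  rewrite ExD ?ExZ ?Ex_cst//; [|exact: L1_cst|exact: L1Z].
  by rewrite lerD2l ler_pM2l//; exact: uh8.
apply: le_trans (_ : l * vbound + (1 - l)^-1 ^+ 3 * vinc <= _).
  apply: lerD.
    by apply: ler_wpM2l (IH kn'); case/andP: l01.
  apply: ler_wpM2l; first by rewrite exprn_ge0// invr_ge0 ltW.
  by rewrite lerD2l ler_pM2l.
by rewrite /vbound -/l le_eqVlt; apply/orP; left; apply/eqP; field; rewrite gt_eqF.
Qed.

Definition QQbound := 1 + u8 + vbound + s2U.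

Lemma QQ_L1 n k : (k <= n)%N -> L1 P (QQ n k).
Proof.
move=> kn; have := domD (domD (domD (dom_cst n 1) (domX 8 (dom_uh n kn)))
  (domX 4 (dom_vh n kn))) (domX 2 (dom_eh n kn)).
exact: dom_L1.
Qed.

Lemma QQ_Ex n k : (k <= n)%N -> Ex P (QQ n k) <= QQbound.
Proof.
move=> kn.
have L8 : L1 P (fun w => uh n k w ^+ 8) by apply: dom_L1 (domX 8 (dom_uh n kn)).
have L4 : L1 P (fun w => vh n k w ^+ 4) by apply: dom_L1 (domX 4 (dom_vh n kn)).
have L2 : L1 P (fun w => eh n k w ^+ 2) by apply: dom_L1 (domX 2 (dom_eh n kn)).
rewrite /QQ !ExD ?Ex_cst; try by do ?[exact: L8|exact: L4|exact: L2|exact: L1_cst|apply: L1D].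
by rewrite !lerD// ?uh8 ?vh4 ?eh2.
Qed.

(* The drift of one telescoping step: an O(n^(-3/2)) remainder plus five terms that have
   conditional mean zero. *)
Lemma one_step_drift_identity (q r s t m mv kap g e u v a b S C w' dl sig tau kc : R) :
  1 - dl ^+ 2 != 0 -> u = m * kap + g * e ->
  let ga := 1 - dl ^+ 2 in let h := g * g in
  let rho := (s ^+ 2 * sig + t ^+ 2 * ga) * m ^+ 2 in
  let p := q * (u ^+ 2 - m ^+ 2 * kap ^+ 2) + r * (v ^+ 2 - m * kap) in
  let x := s * (u * a) + t * (v * b) in
  let psi := w' * (r * S + t ^+ 2 * ga * m / 2 * kap * C) in
  let v' := dl * v + g * mv + b in
  w' * (h * (rho / 2 * kap ^+ 2) * C - S * (h * p + g * x) - C * (g * x) ^+ 2 / 2)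
    + h / ga * (psi * v ^+ 2 - psi * v' ^+ 2) =
  h * g * (w' * (- (q * S) * (e * u + m * kap * e)
       - C / 2 * (s ^+ 2 * sig * (e * u + m * kap * e) + t ^+ 2 * ga * (e * v ^+ 2)
                  + 2 * s * t * kc * (u * v) + t ^+ 2 * tau * g * v ^+ 2))
     - psi * e - psi / ga * (2 * dl * mv * v + g * mv ^+ 2 + g * tau))
  + ((- (w' * g * s) * (S * u)) * a
   + (- (w' * g * t) * (S * v) - h / ga * 2 * (psi * (dl * v + g * mv))) * b
   + (- (w' * h / 2 * s ^+ 2) * (C * u ^+ 2)) * (a ^+ 2 - sig)
   + (- (w' * h * s * t) * (C * (u * v))) * (a * b - g * kc)
   + (- (w' * h / 2 * t ^+ 2) * (C * v ^+ 2) - h / ga * psi) *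
       (b ^+ 2 - (ga * u + h * tau))).
Proof. by move=> ga0 -> /=; field. Qed.

(** * The telescoping quantity and its one-step errors *)

Section Telescope.
Variables q r s t theta : R.

(** The first two sums are centred term by term. Then u^2 - m^2 t^2 contains the small factor
    [gg n], since u - m t is [gg n] times e, and v^2 - m t is cancelled on average by the
    corrector. *)
Definition pp n k w := q * (uh n k w ^+ 2 - mU ^+ 2 * tk n k ^+ 2)
  + r * (vh n k w ^+ 2 - mU * tk n k).
Definition xx n k w := s * (uh n k w * incU k w) + t * (vh n k w * dh n k w).
Fixpoint Phi n k w : R :=
  if k is k'.+1 then Phi n k' w + (hh n * pp n k' w + gg n * xx n k' w) else theta.
Definition rho := (s ^+ 2 * s2U + t ^+ 2 * gam) * mU ^+ 2.
Fixpoint wt n k : R :=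
  if k is k'.+1 then wt n k' * expR (hh n * (rho / 2 * tk n k' ^+ 2)) else 1.
Arguments wt n k : simpl never.
Lemma wtS n k : wt n k.+1 = wt n k * expR (hh n * (rho / 2 * tk n k ^+ 2)).
Proof. by []. Qed.

(* [hh n / gam * (psi * vh ^+ 2)] is the corrector that replaces [vh ^+ 2] by [uh] in the drift. *)
Definition psi n k w := wt n k.+1 * (r * sin (Phi n k w)
  + t ^+ 2 * gam * mU / 2 * tk n k * cos (Phi n k w)).
Definition Psi n k w := wt n k * cos (Phi n k w) - hh n / gam * (psi n k w * vh n k w ^+ 2).
(** What the corrector leaves of the drift, divided by n^(-3/2). Besides [hh n], every term
    contained a factor [gg n], coming from u - m t, from the mean mV or the variance of the
    immigration, or from its covariance with the innovation. *)
Definition GG n k w := wt n k.+1 * (- (q * sin (Phi n k w)) * (eh n k w * uh n k w + mU * tk n k * eh n k w)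
       - cos (Phi n k w) / 2 * (s ^+ 2 * s2U * (eh n k w * uh n k w + mU * tk n k * eh n k w)
          + t ^+ 2 * gam * (eh n k w * vh n k w ^+ 2)
          + 2 * s * t * covUV * (uh n k w * vh n k w) + t ^+ 2 * s2V * gg n * vh n k w ^+ 2))
     - psi n k w * eh n k w
     - psi n k w / gam * (2 * delta * mV * vh n k w + gg n * mV ^+ 2 + gg n * s2V).
(** Three errors: the expansion of the cosine, the first-order expansion of the weight, and the
    change of [psi] in the telescoped corrector. *)
Definition restT n k w :=
  wt n k.+1 * (cos (Phi n k.+1 w) - (cos (Phi n k w)
     - sin (Phi n k w) * (hh n * pp n k w + gg n * xx n k w)
     - cos (Phi n k w) * (gg n * xx n k w) ^+ 2 / 2))
  + wt n k.+1 * cos (Phi n k w) * (1 - expR (- (hh n * (rho / 2 * tk n k ^+ 2)))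
      - hh n * (rho / 2 * tk n k ^+ 2))
  - hh n / gam * ((psi n k.+1 w - psi n k w) * vh n k.+1 w ^+ 2).
Definition cc1 n k w := - (wt n k.+1 * gg n * s) * (sin (Phi n k w) * uh n k w).
Definition cc2 n k w := - (wt n k.+1 * gg n * t) * (sin (Phi n k w) * vh n k w)
  - hh n / gam * 2 * (psi n k w * (delta * vh n k w + gg n * mV)).
Definition cc3 n k w := - (wt n k.+1 * hh n / 2 * s ^+ 2) * (cos (Phi n k w) * uh n k w ^+ 2).
Definition cc4 n k w := - (wt n k.+1 * hh n * s * t) * (cos (Phi n k w) * (uh n k w * vh n k w)).
Definition cc5 n k w := - (wt n k.+1 * hh n / 2 * t ^+ 2) * (cos (Phi n k w) * vh n k w ^+ 2)
  - hh n / gam * psi n k w.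

Lemma rho_ge0 : 0 <= rho.
Proof.
rewrite mulr_ge0 ?sqr_ge0// addr_ge0// mulr_ge0 ?sqr_ge0//; first exact: s2U_ge0.
exact: ltW gam_gt0.
Qed.

Lemma Psi_step n k w : Psi n k.+1 w - Psi n k w =
  restT n k w + hh n * gg n * GG n k w +
  (cc1 n k w * incU k w + cc2 n k w * dh n k w + cc3 n k w * (incU k w ^+ 2 - s2U)
   + cc4 n k w * (incU k w * dh n k w - gg n * covUV)
   + cc5 n k w * (dh n k w ^+ 2 - (gam * uh n k w + hh n * s2V))).
Proof.
have g0 : 1 - delta ^+ 2 != 0 by have := gam_gt0; rewrite /gam => /gt_eqF ->.
have := one_step_drift_identity q r s t mV (vh n k w) (incU k w) (dh n k w)
  (sin (Phi n k w)) (cos (Phi n k w)) (wt n k.+1) s2U s2V covUV g0 (uhE n k w).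
rewrite -/gam ggE /= -/rho -/(pp n k w) -/(xx n k w) -/(psi n k w) -vh_step => E.
rewrite -[RHS]addrA /GG /cc1 /cc2 /cc3 /cc4 /cc5 -E /restT /Psi.
have -> : wt n k = wt n k.+1 * expR (- (hh n * (rho / 2 * tk n k ^+ 2))).
  by rewrite wtS -mulrA -expRD subrr expR0 mulr1.
rewrite -[Phi n k.+1 w]/(Phi n k w + (hh n * pp n k w + gg n * xx n k w)).
by ring.
Qed.

Lemma wt_gt0 n k : 0 < wt n k.
Proof. by elim: k => [|k IH]; [exact: ltr01|rewrite wtS mulr_gt0// expR_gt0]. Qed.

(** The range goes up to [n.+1] because [dpsi_norm] compares the weights at k + 1 and k + 2 for k <
    n. The exponent is then at most (n + 1) / n * rho / 2, hence at most rho. *)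
Lemma wt_bound n k : (k <= n.+1)%N -> (0 < n)%N -> wt n k <= expR rho.
Proof.
move=> kn n0; apply: le_trans (_ : expR (k%:R * (hh n * (rho / 2))) <= _).
  elim: k kn => [|k IH] kn; first by rewrite mul0r expR0.
  rewrite wtS -[k.+1%:R]natr1 mulrDl mul1r expRD; apply: ler_pM; rewrite ?expR_ge0//.
  - exact: ltW (wt_gt0 _ _).
  - exact: IH (ltnW kn).
  - rewrite ler_expR; apply: ler_wpM2l; first exact: hh_ge0.
    rewrite ler_piMr ?divr_ge0 ?rho_ge0//.
    by apply: exprn_ile1; [exact: tk_ge0|exact: tk_le1].
rewrite ler_expR mulrA mulrCA -[leRHS]mulr1; apply: ler_wpM2l; first exact: rho_ge0.
rewrite ler_pdivrMr// mul1r; apply: le_trans (_ : n.+1%:R * hh n <= _).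
  by apply: ler_wpM2r; rewrite ?hh_ge0// ler_nat.
rewrite -[n.+1%:R]natr1 mulrDl mul1r /hh divff ?pnatr_eq0 -?lt0n//.
by have := hh_le1 n; rewrite /hh; lra.
Qed.

Lemma known_pp n k : known Y (past k) (pp n k).
Proof.
apply: knownD; apply: knownM (@known_cst R _ _ _ Y _ _) _; apply: knownB;
  try exact: known_cst; apply: knownX; [exact: known_uh|exact: known_vh].
Qed.

Lemma known_incU k : known Y (past k.+1) (incU k).
Proof. by apply: incU_known; exact: now_past. Qed.

Lemma known_dh n k : known Y (past k.+1) (dh n k).
Proof. by apply: knownM; [exact: known_cst|exact: dX_known]. Qed.

Lemma known_xx n k : known Y (past k.+1) (xx n k).
Proof.
apply: knownD; apply: knownM (@known_cst R _ _ _ Y _ _) _; apply: knownM.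
- by apply: known_S; exact: known_uh.
- exact: known_incU.
- by apply: known_S; exact: known_vh.
- exact: known_dh.
Qed.

Lemma known_Phi n k : known Y (past k) (Phi n k).
Proof.
elim: k => [|k IH]; first exact: known_cst.
apply: knownD; first exact: known_S.
apply: knownD; apply: knownM (@known_cst R _ _ _ Y _ _) _; last exact: known_xx.
by apply: known_S; exact: known_pp.
Qed.

Lemma dom_cosPhi N n k : dom N 0 (fun w => cos (Phi n k w)).
Proof.
apply: (@dom_bounded _ 1); last by move=> w; exact: cos_max.
by apply: (@known_mfun (past k)); apply: known_cos; exact: known_Phi.
Qed.

Lemma dom_sinPhi N n k : dom N 0 (fun w => sin (Phi n k w)).
Proof.
apply: (@dom_bounded _ 1); last by move=> w; exact: sin_max.
by apply: (@known_mfun (past k)); apply: known_sin; exact: known_Phi.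
Qed.

Lemma dom_psi N n k : dom N 0 (psi n k).
Proof.
have := domM (dom_cst N (wt n k.+1)) (domD (domM (dom_cst N r) (dom_sinPhi N n k))
  (domM (dom_cst N (t ^+ 2 * gam * mU / 2 * tk n k)) (dom_cosPhi N n k))).
exact.
Qed.

Lemma known_cosPhi n k : known Y (past k) (fun w => cos (Phi n k w)).
Proof. by apply: known_cos; exact: known_Phi. Qed.
Lemma known_sinPhi n k : known Y (past k) (fun w => sin (Phi n k w)).
Proof. by apply: known_sin; exact: known_Phi. Qed.

Lemma known_psi n k : known Y (past k) (psi n k).
Proof.
apply: knownM (@known_cst R _ _ _ Y _ _) _; apply: knownD; apply: knownM;
  [exact: known_cst|exact: known_sinPhi|exact: known_cst|exact: known_cosPhi].
Qed.

Lemma cc_zero n k : (k < n)%N ->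
  L1 P (fun w => cc1 n k w * incU k w + cc2 n k w * dh n k w + cc3 n k w * (incU k w ^+ 2 - s2U)
   + cc4 n k w * (incU k w * dh n k w - gg n * covUV)
   + cc5 n k w * (dh n k w ^+ 2 - (gam * uh n k w + hh n * s2V))) /\
  Ex P (fun w => cc1 n k w * incU k w + cc2 n k w * dh n k w + cc3 n k w * (incU k w ^+ 2 - s2U)
   + cc4 n k w * (incU k w * dh n k w - gg n * covUV)
   + cc5 n k w * (dh n k w ^+ 2 - (gam * uh n k w + hh n * s2V))) = 0.
Proof.
move=> kn; have kn' := ltnW kn.
have du := dom_uh n kn'; have dv := dom_vh n kn'; have da := dom_incU kn.
have db := dom_dh n kn; have dS := dom_sinPhi n n k; have dC := dom_cosPhi n n k.
have dp := dom_psi n n k; have cst := dom_cst n.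
have ku := @known_uh n k; have kv := @known_vh n k; have kS := @known_sinPhi n k.
have kC := @known_cosPhi n k; have kp := @known_psi n k.
have kc (x : R) := @known_cst R _ _ _ Y (past k) x.
have d1 : dom n 1 (cc1 n k) := domM (cst _) (domM dS du).
have k1 : known Y (past k) (cc1 n k) := knownM (kc _) (knownM kS ku).
have d2 : dom n 1 (cc2 n k) := domB (domM (cst _) (domM dS dv))
  (domM (cst _) (domM dp (domD (domM (cst _) dv) (cst _)))).
have k2 : known Y (past k) (cc2 n k) := knownB (knownM (kc _) (knownM kS kv))
  (knownM (kc _) (knownM kp (knownD (knownM (kc _) kv) (kc _)))).
have d3 : dom n 2 (cc3 n k) := domM (cst _) (domM dC (domX 2 du)).
have k3 : known Y (past k) (cc3 n k) := knownM (kc _) (knownM kC (knownX 2 ku)).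
have d4 : dom n 2 (cc4 n k) := domM (cst _) (domM dC (domM du dv)).
have k4 : known Y (past k) (cc4 n k) := knownM (kc _) (knownM kC (knownM ku kv)).
have d5 : dom n 2 (cc5 n k) := domB (domM (cst _) (domM dC (domX 2 dv))) (domM (cst _) dp).
have k5 : known Y (past k) (cc5 n k) :=
  knownB (knownM (kc _) (knownM kC (knownX 2 kv))) (knownM (kc _) kp).
have m1 : L1 P (fun w => cc1 n k w * incU k w) := dom_L1 (isT : 1 + 1 <= 8)%N (domM d1 da).
have m2 : L1 P (fun w => cc2 n k w * dh n k w) := dom_L1 (isT : 1 + 1 <= 8)%N (domM d2 db).
have m3 : L1 P (fun w => cc3 n k w * (incU k w ^+ 2 - s2U)).
  exact: (dom_L1 _ (domM d3 (domB (domX 2 da) (cst s2U)))).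
have m4 : L1 P (fun w => cc4 n k w * (incU k w * dh n k w - gg n * covUV)).
  exact: (dom_L1 _ (domM d4 (domB (domM da db) (cst _)))).
have m5 : L1 P (fun w => cc5 n k w * (dh n k w ^+ 2 - (gam * uh n k w + hh n * s2V))).
  exact: (dom_L1 _ (domM d5 (domB (domX 2 db) (domD (domM (cst gam) du) (cst _))))).
split; first by do 4 apply: L1D => //.
rewrite !ExD; try by do ?[exact: m1|exact: m2|exact: m3|exact: m4|exact: m5|apply: L1D].
rewrite (incU_Ex1 (isT : 1 <= 8)%N k1 d1) (dh_Ex1 kn (isT : 1 <= 7)%N k2 d2).
rewrite (a2_Ex kn (isT : 2 <= 6)%N k3 d3) (adh_Ex kn (isT : 2 <= 6)%N k4 d4).
by rewrite (dh_Ex2 kn (isT : 2 <= 6)%N k5 d5) !addr0.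
Qed.

Lemma bdD (Q x y c e : R) : `|x| <= c * Q -> `|y| <= e * Q -> `|x + y| <= (c + e) * Q.
Proof. by move=> hx hy; rewrite mulrDl; apply: le_trans (ler_normD _ _) (lerD hx hy). Qed.

Lemma bdN (Q x c : R) : `|x| <= c * Q -> `|- x| <= c * Q.
Proof. by rewrite normrN. Qed.

Lemma bdM (Q z x c e : R) : `|z| <= c -> `|x| <= e * Q -> `|z * x| <= (c * e) * Q.
Proof. by move=> hz hx; rewrite normrM -mulrA; exact: ler_pM. Qed.

Lemma bd_cst (Q z : R) : 1 <= Q -> `|z| <= `|z| * Q.
Proof. by move=> Q1; rewrite ler_peMr. Qed.

Lemma QQ_ge1 n k w : 1 <= QQ n k w.
Proof.
rewrite /QQ -!addrA lerDl addr_ge0 ?exprn_even_ge0// addr_ge0 ?exprn_even_ge0//.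
Qed.

Lemma sqr_le_pow4 (x : R) : x ^+ 2 <= 1 + x ^+ 4.
Proof. by have := sqr_ge0 (x ^+ 2 - 1); nra. Qed.

Lemma norm_le_sqr (x : R) : `|x| <= 1 + x ^+ 2.
Proof. by rewrite -[x ^+ 2]real_normK ?num_real//; have := sqr_ge0 (`|x| - 1); nra. Qed.

Lemma QQ_parts n k w : let Q := QQ n k w in
  [/\ 0 <= uh n k w ^+ 8 /\ 0 <= vh n k w ^+ 4, 0 <= eh n k w ^+ 2,
   uh n k w ^+ 2 <= 1 + uh n k w ^+ 8, uh n k w ^+ 4 <= 1 + uh n k w ^+ 8 &
   vh n k w ^+ 2 <= 1 + vh n k w ^+ 4].
Proof.
have u0 := uh_ge0 n k w; split; rewrite ?exprn_even_ge0//.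
- exact: pow2_le_pow8.
- by rewrite (exprM _ 2 4) (exprM _ 2 2); have := sqr_le_pow4 (uh n k w ^+ 2).
- exact: sqr_le_pow4.
Qed.

Lemma norm_mul_le (x y : R) : `|x * y| <= x ^+ 2 + y ^+ 2.
Proof. by rewrite ler_norml; apply/andP; split; have := sqr_ge0 (x + y); have := sqr_ge0 (x - y); nra. Qed.

Section Monomials.
Variables (n k : nat) (w : T).
Let Q := QQ n k w.

Lemma Q_e : `|eh n k w| <= 1 * Q.
Proof.
have [[u8' v4] e2' u2 u4 v2] := QQ_parts n k w.
by rewrite mul1r; apply: le_trans (norm_le_sqr _) _; rewrite /Q /QQ; lra.
Qed.

Lemma Q_v : `|vh n k w| <= 2 * Q.
Proof.
have [[u8' v4] e2' u2 u4 v2] := QQ_parts n k w.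
by apply: le_trans (norm_le_sqr _) _; rewrite /Q /QQ; lra.
Qed.

Lemma Q_v2 : `|vh n k w ^+ 2| <= 1 * Q.
Proof.
have [[u8' v4] e2' u2 u4 v2] := QQ_parts n k w.
by rewrite ger0_norm ?sqr_ge0// mul1r /Q /QQ; lra.
Qed.

Lemma Q_u2 : `|uh n k w ^+ 2| <= 1 * Q.
Proof.
have [[u8' v4] e2' u2 u4 v2] := QQ_parts n k w.
by rewrite ger0_norm ?sqr_ge0// mul1r /Q /QQ; lra.
Qed.

Lemma Q_eu : `|eh n k w * uh n k w| <= 1 * Q.
Proof.
have [[u8' v4] e2' u2 u4 v2] := QQ_parts n k w.
by apply: le_trans (norm_mul_le _ _) _; rewrite /Q /QQ; lra.
Qed.

Lemma Q_ev2 : `|eh n k w * vh n k w ^+ 2| <= 1 * Q.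
Proof.
have [[u8' v4] e2' u2 u4 v2] := QQ_parts n k w.
apply: le_trans (norm_mul_le _ _) _; rewrite -exprM /Q /QQ; lra.
Qed.

Lemma Q_uv : `|uh n k w * vh n k w| <= 2 * Q.
Proof.
have [[u8' v4] e2' u2 u4 v2] := QQ_parts n k w.
by apply: le_trans (norm_mul_le _ _) _; rewrite /Q /QQ; lra.
Qed.

End Monomials.

Definition W0 := expR rho.
Definition K0 := t ^+ 2 * gam * mU / 2.
Definition Kpsi := W0 * (`|r| + `|K0|).

Lemma norm_wt n k : (k <= n.+1)%N -> (0 < n)%N -> `|wt n k| <= W0.
Proof. by move=> kn n0; rewrite gtr0_norm ?wt_gt0//; exact: wt_bound. Qed.

Lemma norm_tk n k : (k <= n)%N -> `|tk n k| <= 1.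
Proof. by move=> kn; rewrite ger0_norm ?tk_ge0 ?tk_le1. Qed.

Lemma norm_sin_le (c x : R) : `|c * sin x| <= `|c|.
Proof. by rewrite normrM ler_piMr// sin_max. Qed.

Lemma norm_tkcos_le n k (c x : R) : (k <= n)%N -> `|c * tk n k * cos x| <= `|c|.
Proof.
move=> kn; rewrite -mulrA normrM ler_piMr// normrM -[leRHS]mulr1.
by apply: ler_pM => //; [exact: norm_tk|exact: cos_max].
Qed.

Lemma norm_psi n k w : (k <= n)%N -> (0 < n)%N -> `|psi n k w| <= Kpsi.
Proof.
move=> kn n0; rewrite /psi normrM; apply: ler_pM => //; first exact: norm_wt.
apply: le_trans (ler_normD _ _) _; apply: lerD; first exact: norm_sin_le.
exact: norm_tkcos_le.
Qed.

Lemma norm_gg n : `|gg n| <= 1.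
Proof. by rewrite ger0_norm ?gg_ge0 ?gg_le1. Qed.

Lemma GG_bound : exists K, forall n k w, (0 < n)%N -> (k < n)%N ->
  `|GG n k w| <= K * QQ n k w.
Proof.
(* The constant is left open and assembled by unification from the rules [bdD], [bdN] and [bdM] for
   bounds of the form [|x| <= c * Q]. *)
eexists => n k w n0 kn; rewrite /GG.
have tm : `|mU * tk n k| <= `|mU| by rewrite normrM ler_piMr// norm_tk// ltnW.
have Q1 := QQ_ge1 n k w.
have X := bdD (Q_eu n k w) (bdM tm (Q_e n k w)).
have sn : `|- (q * sin (Phi n k w))| <= `|q| by rewrite normrN norm_sin_le.
have cs : `|cos (Phi n k w) / 2| <= 1.
  rewrite normrM; apply: le_trans (_ : 1 * `|2^-1| <= _).
    by apply: ler_wpM2r => //; exact: cos_max.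
  by rewrite mul1r ger0_norm// invf_le1// ler1n.
have sg : `|t ^+ 2 * s2V * gg n| <= `|t ^+ 2 * s2V| by rewrite normrM ler_piMr ?norm_gg.
apply: bdD; first apply: bdD.
- apply: bdM; first by apply: norm_wt => //; apply: leqW.
  apply: bdD; first exact: bdM sn X.
  apply: bdN; apply: bdM cs _.
  apply: bdD; [apply: bdD; [apply: bdD|]|].
  + exact: bdM (lexx _) X.
  + exact: bdM (lexx _) (Q_ev2 n k w).
  + exact: bdM (lexx _) (Q_uv n k w).
  + exact: bdM sg (Q_v2 n k w).
- by apply: bdN; apply: bdM (Q_e n k w); apply: norm_psi => //; exact: ltnW.
- apply: bdN; rewrite -mulrA; apply: bdM; first by apply: norm_psi => //; exact: ltnW.
  apply: bdM (lexx _) _; apply: bdD; first apply: bdD.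
  + exact: bdM (lexx _) (Q_v n k w).
  + by apply: bdM (norm_gg n) _; exact: bd_cst.
  + by apply: bdM (norm_gg n) _; exact: bd_cst.
Qed.

(** One majorant for all errors of a step. Cubes of increments are replaced by 1 plus fourth powers,
    whose conditional moments are controlled; [QQ n k.+1] covers the factor [vh n k.+1 w ^+ 2] in
    [restT]. *)
Definition bnd n k w := QQ n k w + QQ n k.+1 w + (uh n k w * incU k w) ^+ 2
  + (vh n k w * dh n k w) ^+ 2 + uh n k w ^+ 3 * (1 + incU k w ^+ 4)
  + `|vh n k w| ^+ 3 * (1 + dh n k w ^+ 4).

Lemma pow3_mul_le (x y : R) : 0 <= x -> 0 <= y -> x ^+ 3 * y <= x ^+ 4 + y ^+ 4.
Proof.
move=> x0 y0; have [xy|/ltW yx] := leP x y.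
  apply: le_trans (_ : y ^+ 3 * y <= _).
    by apply: ler_wpM2r => //; apply: lerXn2r; rewrite ?nnegrE.
  by rewrite -exprSr lerDr exprn_ge0.
apply: le_trans (_ : x ^+ 3 * x <= _).
  by apply: ler_wpM2l => //; rewrite exprn_ge0.
by rewrite -exprSr lerDl exprn_ge0.
Qed.

Lemma pow3_le_pow4 (x : R) : 0 <= x -> x ^+ 3 <= 1 + x ^+ 4.
Proof. by move=> x0; have := pow3_mul_le x0 ler01; rewrite expr1n mulr1 addrC. Qed.

Lemma bnd_L1 n k : (k < n)%N -> L1 P (bnd n k).
Proof.
move=> kn; have kn' := ltnW kn.
have du := dom_uh n kn'; have dv := dom_vh n kn'; have da := dom_incU kn.
have db := dom_dh n kn.
apply: L1D; [apply: L1D; [apply: L1D; [apply: L1D; [apply: L1D|]|]|]|].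
- exact: QQ_L1.
- exact: QQ_L1.
- exact: (dom_L1 _ (domX 2 (domM du da))).
- exact: (dom_L1 _ (domX 2 (domM dv db))).
- exact: (dom_L1 _ (domM (domX 3 du) (domD (dom_cst n 1) (domX 4 da)))).
- exact: (dom_L1 _ (domM (domX 3 (dom_norm dv)) (domD (dom_cst n 1) (domX 4 db)))).
Qed.

Lemma bnd_Ex : exists K, forall n k, (k < n)%N -> Ex P (bnd n k) <= K.
Proof.
(* The summands match those of [bnd]. The generous 300 covers |v|^3 (1 + u)^2 <= v^4 + (1 + u)^8
   together with (1 + u)^8 <= 256 (1 + u^8). *)
exists (QQbound + QQbound + QQbound * s2U + 2 * (1 + s2V) * QQbound
  + 2 * QQbound * (1 + m4U) + (2 + cst4 * 300) * QQbound) => n k kn.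
have kn' := ltnW kn.
have du := dom_uh n kn'; have dv := dom_vh n kn'; have da := dom_incU kn.
have db := dom_dh n kn; have cst := dom_cst n.
have ku := @known_uh n k; have kv := @known_vh n k.
have kc (x : R) := @known_cst R _ _ _ Y (past k) x.
have LQ := QQ_L1 kn'; have LQ' := QQ_L1 kn.
have La : L1 P (fun w => (uh n k w * incU k w) ^+ 2).
  exact: (dom_L1 _ (domX 2 (domM du da))).
have Lb : L1 P (fun w => (vh n k w * dh n k w) ^+ 2).
  exact: (dom_L1 _ (domX 2 (domM dv db))).
have Lc : L1 P (fun w => uh n k w ^+ 3 * (1 + incU k w ^+ 4)).
  exact: (dom_L1 _ (domM (domX 3 du) (domD (cst 1) (domX 4 da)))).
have Ld : L1 P (fun w => `|vh n k w| ^+ 3 * (1 + dh n k w ^+ 4)).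
  exact: (dom_L1 _ (domM (domX 3 (dom_norm dv)) (domD (cst 1) (domX 4 db)))).
do 5 (rewrite [X in X <= _]ExD || rewrite [X in X + _ <= _]ExD || rewrite [X in X + _ + _ <= _]ExD || rewrite [X in X + _ + _ + _ <= _]ExD || rewrite [X in X + _ + _ + _ + _ <= _]ExD;
  try by do ?[exact: LQ|exact: LQ'|exact: La|exact: Lb|exact: Lc|exact: Ld|apply: L1D]).
have leQ f c : L1 P f -> 0 <= c -> (forall w, f w <= c * QQ n k w) -> Ex P f <= c * QQbound.
  move=> Lf c0 fle; apply: le_trans (Ex_le Lf (L1Z c LQ) fle) _.
  by rewrite ExZ//; apply: ler_wpM2l => //; exact: QQ_Ex.
have s0 := s2U_ge0; have s0' := s2V_ge0; have m0 := m4U_ge0; have c0 := cst4_ge0.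
have Lu2 : L1 P (fun w => uh n k w ^+ 2) by apply: dom_L1 (domX 2 du).
have Lu3 : L1 P (fun w => uh n k w ^+ 3) by apply: dom_L1 (domX 3 du).
have Eu2 : Ex P (fun w => uh n k w ^+ 2) <= 1 * QQbound.
  apply: leQ => // w; have := Q_u2 n k w; rewrite ger0_norm ?sqr_ge0//.
have Eu3 : Ex P (fun w => uh n k w ^+ 3) <= 2 * QQbound.
  apply: leQ => // w; have [[u8' v4] e2' u2 u4 v2] := QQ_parts n k w.
  by apply: le_trans (pow3_le_pow4 (uh_ge0 n k w)) _; rewrite /QQ; lra.
apply: lerD; [apply: lerD; [apply: lerD; [apply: lerD; [apply: lerD|]|]|]|].
- exact: QQ_Ex kn'.
- exact: QQ_Ex kn.
- rewrite (@eq_Ex _ _ _ _ _ (fun w => uh n k w ^+ 2 * incU k w ^+ 2)); last first.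
    by move=> w; rewrite exprMn.
  rewrite (@incU_Ex k n 2 2 _ isT isT (knownX 2 ku) (domX 2 du)) incU_var.
  by apply: ler_wpM2r => //; rewrite mul1r in Eu2.
- have E := dh_Ex2 kn (isT : 2 <= 6)%N (knownX 2 kv) (domX 2 dv).
  have Lv : L1 P (fun w => vh n k w ^+ 2 * (gam * uh n k w + hh n * s2V)).
    exact: (dom_L1 _ (domM (domX 2 dv) (domD (domM (cst gam) du) (cst _)))).
  rewrite (@eq_Ex _ _ _ _ _ (fun w => vh n k w ^+ 2 *
    (dh n k w ^+ 2 - (gam * uh n k w + hh n * s2V)) +
     vh n k w ^+ 2 * (gam * uh n k w + hh n * s2V))); last by move=> w; ring.
  rewrite ExD//; last first.
    exact: (dom_L1 _ (domM (domX 2 dv) (domB (domX 2 db) (domD (domM (cst gam) du) (cst _))))).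
  rewrite E add0r; apply: leQ => //; first by rewrite mulr_ge0// addr_ge0.
  move=> w; have [[u8' v4] e2' u2 u4 v2] := QQ_parts n k w.
  have v20 := sqr_ge0 (vh n k w); have u0 := uh_ge0 n k w.
  have h1 : vh n k w ^+ 2 * uh n k w <= vh n k w ^+ 4 + uh n k w ^+ 2.
    by have := norm_mul_le (vh n k w ^+ 2) (uh n k w); rewrite -exprM; apply: le_trans; exact: ler_norm.
  apply: le_trans (_ : vh n k w ^+ 2 * uh n k w + s2V * vh n k w ^+ 2 <= _).
    rewrite mulrDr; apply: lerD.
      by apply: ler_wpM2l => //; rewrite ler_piMl ?gam_le1.
    by rewrite mulrC; apply: ler_wpM2r => //; rewrite ler_piMl ?hh_le1.
  have : s2V * vh n k w ^+ 2 <= s2V * QQ n k w.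
    by apply: ler_wpM2l => //; rewrite /QQ; lra.
  have := QQ_ge1 n k w; have : 0 <= s2V * QQ n k w.
    by rewrite mulr_ge0// (le_trans _ (QQ_ge1 n k w)).
  by rewrite /QQ in h1 *; nra.
- rewrite (@eq_Ex _ _ _ _ _ (fun w => uh n k w ^+ 3 + uh n k w ^+ 3 * incU k w ^+ 4)); last first.
    by move=> w; rewrite mulrDr mulr1.
  rewrite ExD//; last exact: (dom_L1 _ (domM (domX 3 du) (domX 4 da))).
  rewrite (@incU_Ex k n 3 4 _ isT isT (knownX 3 ku) (domX 3 du)) incU_m4.
  rewrite -[X in X + _]mulr1 -mulrDr; apply: ler_wpM2r => //.
  by rewrite addr_ge0.
have dv3 := domX 3 (dom_norm dv).
have Lv3 : L1 P (fun w => `|vh n k w| ^+ 3) by apply: dom_L1 dv3.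
rewrite (@eq_Ex _ _ _ _ _ (fun w => `|vh n k w| ^+ 3 + `|vh n k w| ^+ 3 * dh n k w ^+ 4)); last first.
  by move=> w; rewrite mulrDr mulr1.
rewrite ExD//; last exact: (dom_L1 _ (domM dv3 (domX 4 db))).
rewrite mulrDl; apply: lerD.
  apply: leQ => // w; have [[u8' v4] e2' u2 u4 v2] := QQ_parts n k w.
  apply: le_trans (pow3_le_pow4 (normr_ge0 _)) _.
  by rewrite -normrX (@ger0_norm _ (_ ^+ 4)) ?exprn_even_ge0// /QQ; lra.
apply: le_trans (dh_Ex4 kn (isT : 3 <= 4)%N (knownX 3 (known_norm kv)) dv3 _) _.
  by move=> w; rewrite exprn_ge0.
rewrite -mulrA; apply: ler_wpM2l => //; apply: leQ => //.
  exact: (dom_L1 _ (domM dv3 (domX 2 (domD (cst 1) du)))).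
move=> w; have [[u8' v4] e2' u2 u4 v2] := QQ_parts n k w.
have u0 := uh_ge0 n k w.
apply: le_trans (pow3_mul_le (normr_ge0 _) (sqr_ge0 _)) _.
rewrite -normrX (@ger0_norm _ (_ ^+ 4)) ?exprn_even_ge0// -exprM.
have : (1 + uh n k w) ^+ 8 <= 256 * (1 + uh n k w ^+ 8).
  have half : 0 <= (2^-1 : R) <= 1 by rewrite invr_ge0 ler0n invf_le1 ?ltr0n// ler1n.
  have := pow8_convex 1 (uh n k w) half.
  rewrite (_ : 1 - 2^-1 = 2^-1 :> R); last by field.
  rewrite -mulrDr exprMn expr1n => h.
  have -> : (1 + uh n k w) ^+ 8 = 256 * (2^-1 ^+ 8 * (1 + uh n k w) ^+ 8) by field.
  by move: h u8'; move: (2^-1 ^+ 8 * _) => Z; lra.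
by rewrite /QQ; lra.
Qed.

Lemma bnd_ge n k w : [/\ QQ n k w <= bnd n k w, QQ n k.+1 w <= bnd n k w,
  (uh n k w * incU k w) ^+ 2 + (vh n k w * dh n k w) ^+ 2 <= bnd n k w &
  uh n k w ^+ 3 * (1 + incU k w ^+ 4) + `|vh n k w| ^+ 3 * (1 + dh n k w ^+ 4) <= bnd n k w].
Proof.
have Q1 := QQ_ge1 n k w; have Q2 := QQ_ge1 n k.+1 w.
have u0 := uh_ge0 n k w.
have a4 : 0 <= incU k w ^+ 4 by exact: exprn_even_ge0.
have d4 : 0 <= dh n k w ^+ 4 by exact: exprn_even_ge0.
have A := sqr_ge0 (uh n k w * incU k w); have B := sqr_ge0 (vh n k w * dh n k w).
have C : 0 <= uh n k w ^+ 3 * (1 + incU k w ^+ 4) by rewrite mulr_ge0 ?exprn_ge0 ?addr_ge0.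
have D : 0 <= `|vh n k w| ^+ 3 * (1 + dh n k w ^+ 4) by rewrite mulr_ge0 ?exprn_ge0 ?addr_ge0.
by rewrite /bnd; split; lra.
Qed.

Lemma pp2_bound : exists K, forall n k w, (k < n)%N -> pp n k w ^+ 2 <= K * QQ n k w.
Proof.
exists (2 * (q ^+ 2 * (2 + 2 * mU ^+ 4)) + 2 * (r ^+ 2 * (2 + 2 * mU ^+ 2))) => n k w kn.
have [[u8' v4] e2' u2 u4 v2] := QQ_parts n k w.
have k1 : tk n k ^+ 2 <= 1 by apply: exprn_ile1; [exact: tk_ge0|exact/tk_le1/ltnW].
have k0 := sqr_ge0 (tk n k).
have Q1 := QQ_ge1 n k w.
have sq (x y : R) : (x + y) ^+ 2 <= 2 * x ^+ 2 + 2 * y ^+ 2 by have := sqr_ge0 (x - y); nra.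
have sq' (x y : R) : (x - y) ^+ 2 <= 2 * x ^+ 2 + 2 * y ^+ 2 by have := sqr_ge0 (x + y); nra.
rewrite /pp; apply: le_trans (sq _ _) _; rewrite [leRHS]mulrDl.
have m4 : 0 <= mU ^+ 4 by exact: exprn_even_ge0.
have m2 := sqr_ge0 mU.
apply: lerD; rewrite -[leRHS]mulrA -[X in _ <= _ * X]mulrA ler_pM2l// exprMn;
  apply: ler_wpM2l; rewrite ?sqr_ge0//.
  apply: le_trans (sq' _ _) _.
  rewrite (_ : (uh n k w ^+ 2) ^+ 2 = uh n k w ^+ 4); last by rewrite -exprM.
  rewrite (_ : (mU ^+ 2 * _) ^+ 2 = mU ^+ 4 * tk n k ^+ 4); last by ring.
  have h : mU ^+ 4 * tk n k ^+ 4 <= mU ^+ 4.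
    by apply: ler_piMr => //; apply: exprn_ile1; [exact: tk_ge0|exact/tk_le1/ltnW].
  have : mU ^+ 4 <= mU ^+ 4 * QQ n k w by rewrite ler_peMr.
  by rewrite mulrDl; move: h; rewrite /QQ; lra.
apply: le_trans (sq' _ _) _.
rewrite (_ : (vh n k w ^+ 2) ^+ 2 = vh n k w ^+ 4); last by rewrite -exprM.
rewrite (exprMn _ mU).
have h : mU ^+ 2 * tk n k ^+ 2 <= mU ^+ 2 by exact: ler_piMr.
have : mU ^+ 2 <= mU ^+ 2 * QQ n k w by rewrite ler_peMr.
by rewrite mulrDl; move: h; rewrite /QQ; lra.
Qed.

Lemma xx2_bound : exists K, forall n k w, xx n k w ^+ 2 <= K * bnd n k w.
Proof.
exists (2 * s ^+ 2 + 2 * t ^+ 2) => n k w; have [_ _ h _] := bnd_ge n k w.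
have sq (x y : R) : (x + y) ^+ 2 <= 2 * x ^+ 2 + 2 * y ^+ 2 by have := sqr_ge0 (x - y); nra.
rewrite /xx; apply: le_trans (sq _ _) _; rewrite !(exprMn _ s) !(exprMn _ t).
have A := sqr_ge0 (uh n k w * incU k w); have B := sqr_ge0 (vh n k w * dh n k w).
rewrite [leRHS]mulrDl; apply: lerD; rewrite -[leRHS]mulrA ler_pM2l//; apply: ler_wpM2l;
  rewrite ?sqr_ge0//; lra.
Qed.

Lemma xx3_bound : exists K, forall n k w, `|xx n k w| ^+ 3 <= K * bnd n k w.
Proof.
exists (4 * `|s| ^+ 3 + 4 * `|t| ^+ 3) => n k w; have [_ _ _ h] := bnd_ge n k w.
have cub (x y : R) : 0 <= x -> 0 <= y -> (x + y) ^+ 3 <= 4 * x ^+ 3 + 4 * y ^+ 3.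
  move=> x0 y0; have := mulr_ge0 (addr_ge0 x0 y0) (sqr_ge0 (x - y)); nra.
have pw (x y : R) : (`|x| * `|y|) ^+ 3 <= `|x| ^+ 3 * (1 + y ^+ 4).
  rewrite exprMn; apply: ler_wpM2l; first by rewrite exprn_ge0.
  apply: le_trans (pow3_le_pow4 (normr_ge0 y)) _.
  by rewrite -normrX (@ger0_norm _ (_ ^+ 4)) ?exprn_even_ge0.
have A : 0 <= uh n k w ^+ 3 * (1 + incU k w ^+ 4).
  by rewrite mulr_ge0 ?exprn_ge0 ?uh_ge0// addr_ge0// exprn_even_ge0.
have B : 0 <= `|vh n k w| ^+ 3 * (1 + dh n k w ^+ 4).
  by rewrite mulr_ge0 ?exprn_ge0// addr_ge0// exprn_even_ge0.
apply: le_trans (_ : (`|s| * (`|uh n k w| * `|incU k w|) +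
   `|t| * (`|vh n k w| * `|dh n k w|)) ^+ 3 <= _).
  apply: lerXn2r; rewrite ?nnegrE ?addr_ge0 ?mulr_ge0//.
  by rewrite /xx -!normrM ler_normD.
apply: le_trans (cub _ _ _ _) _; rewrite ?mulr_ge0//.
rewrite (exprMn _ `|s|) (exprMn _ `|t|) [leRHS]mulrDl; apply: lerD;
  rewrite -[leRHS]mulrA ler_pM2l//; apply: ler_wpM2l; rewrite ?exprn_ge0//;
  apply: le_trans (pw _ _) _; last by lra.
by rewrite (ger0_norm (uh_ge0 _ _ _)); lra.
Qed.

Lemma dPhi_norm n k w : `|Phi n k.+1 w - Phi n k w| <= gg n * (`|pp n k w| + `|xx n k w|).
Proof.
have -> : Phi n k.+1 w - Phi n k w = hh n * pp n k w + gg n * xx n k w.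
  by rewrite /= addrAC subrr add0r.
rewrite [leRHS]mulrDr; apply: le_trans (ler_normD _ _) _; rewrite !normrM (ger0_norm (hh_ge0 n)) (ger0_norm (gg_ge0 n)).
by apply: lerD => //; apply: ler_wpM2r => //; exact: hh_le_gg.
Qed.

(** Weight, time factor and phase each change by at most order n^(-1/2) in one step, up to the sizes
    of [pp] and [xx]. Hence shifting the index of [psi] in the corrector, which carries a further
    1/n, costs only n^(-3/2). *)
Lemma dpsi_norm n k w : (k < n)%N -> (0 < n)%N ->
  `|psi n k.+1 w - psi n k w| <=
  gg n * (Kpsi * (1 + rho) * (1 + `|pp n k w| + `|xx n k w|)).
Proof.
move=> kn n0; have kn' := ltnW kn.
pose A j := r * sin (Phi n j w) + K0 * tk n j * cos (Phi n j w).
have -> : psi n k.+1 w - psi n k w =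
   (wt n k.+2 - wt n k.+1) * A k.+1 + wt n k.+1 * (A k.+1 - A k).
  by rewrite /psi -!/K0 -!/(A _); ring.
have r0 := rho_ge0; have h0 := hh_ge0 n; have g0 := gg_ge0 n; have hg := hh_le_gg n.
have Anorm j : (j <= n)%N -> `|A j| <= `|r| + `|K0|.
  move=> jn; apply: le_trans (ler_normD _ _) _; apply: lerD; first exact: norm_sin_le.
  exact: norm_tkcos_le.
have dw : `|wt n k.+2 - wt n k.+1| <= W0 * (gg n * rho).
  pose y := hh n * (rho / 2 * tk n k.+1 ^+ 2).
  have y0 : 0 <= y by rewrite mulr_ge0// mulr_ge0 ?sqr_ge0// divr_ge0.
  have -> : wt n k.+2 - wt n k.+1 = wt n k.+2 * (1 - expR (- y)).
    rewrite mulrBr mulr1 [X in _ = _ - X]mulrC [X in _ = _ - _ * X]wtS.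
    by rewrite -/y mulrCA -expRD addNr expR0 mulr1.
  have /andP[e0 e1] := expR_sub1_bound y0.
  rewrite normrM; apply: ler_pM => //; first exact: norm_wt.
  rewrite ger0_norm//; apply: le_trans e1 _; apply: ler_pM => //.
    by rewrite mulr_ge0 ?sqr_ge0// divr_ge0.
  apply: le_trans (_ : rho / 2 <= _); last by lra.
  by rewrite ler_piMr ?divr_ge0//; apply: exprn_ile1; [exact: tk_ge0|exact: tk_le1].
have dP := dPhi_norm n k w; set D := `|Phi n k.+1 w - Phi n k w| in dP.
have dA : `|A k.+1 - A k| <= (`|r| + `|K0|) * (D + gg n).
  have -> : A k.+1 - A k = r * (sin (Phi n k.+1 w) - sin (Phi n k w)) +
     K0 * (tk n k * (cos (Phi n k.+1 w) - cos (Phi n k w)) + hh n * cos (Phi n k.+1 w)).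
    by rewrite /A /tk -[k.+1%:R]natr1; ring.
  have D0 : 0 <= D by exact: normr_ge0.
  apply: le_trans (ler_normD _ _) _; rewrite mulrDl; apply: lerD; rewrite normrM.
    apply: ler_wpM2l => //; apply: le_trans (sin_lipschitz _ _) _; rewrite -/D; lra.
  apply: ler_wpM2l => //; apply: le_trans (ler_normD _ _) _.
  rewrite (normrM (tk n k)) (normrM (hh n)); apply: lerD.
    apply: le_trans (_ : 1 * D <= _); last by rewrite mul1r.
    by apply: ler_pM => //; [exact: norm_tk|exact: cos_lipschitz].
  rewrite (ger0_norm h0); apply: le_trans (_ : hh n * 1 <= _); last by rewrite mulr1.
  by apply: ler_wpM2l => //; exact: cos_max.
have W00 : 0 <= W0 by exact: expR_ge0.
have rK : 0 <= `|r| + `|K0| by rewrite addr_ge0.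
apply: le_trans (ler_normD _ _) _.
rewrite (normrM _ (A k.+1)) (normrM _ (A k.+1 - A k)).
apply: le_trans (lerD (ler_pM (normr_ge0 _) (normr_ge0 _) dw (Anorm k.+1 kn))
   (ler_pM (normr_ge0 _) (normr_ge0 _) (norm_wt (leqW kn) n0) dA)) _.
rewrite /Kpsi.
have a0 := normr_ge0 (pp n k w); have b0 := normr_ge0 (xx n k w).
move: dP a0 b0; move: (`|pp n k w|) (`|xx n k w|) => a b dP a0 b0.
apply: le_trans (_ : W0 * (`|r| + `|K0|) * (gg n * rho + (gg n * (a + b) + gg n)) <= _).
  rewrite -mulrA -mulrA [leRHS]mulrA.
  have : W0 * (`|r| + `|K0|) * D <= W0 * (`|r| + `|K0|) * (gg n * (a + b)).
    by apply: ler_wpM2l => //; exact: mulr_ge0.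
  by set X := W0 * (`|r| + `|K0|); rewrite /X; nra.
have X0 : 0 <= W0 * (`|r| + `|K0|) by exact: mulr_ge0.
rewrite [leRHS]mulrCA -!mulrA mulrA; rewrite [leRHS]mulrA; apply: ler_wpM2l => //.
rewrite (_ : _ + _ = gg n * (rho + (a + b) + 1)); last by ring.
rewrite [leRHS]mulrCA; apply: ler_wpM2l => //.
have := mulr_ge0 r0 (addr_ge0 a0 b0); nra.
Qed.

Lemma restT_bound : exists K, forall n k w, (k < n)%N -> (0 < n)%N ->
  `|restT n k w| <= hh n * gg n * (K * bnd n k w).
Proof.
have [Kp hp] := pp2_bound; have [Kx hx] := xx2_bound; have [Kc hc] := xx3_bound.
pose C3 := Kpsi * (1 + rho) / gam.
exists (W0 * (3 * `|Kp| + `|Kx| + `|Kc|) + W0 * rho ^+ 2 + C3 * (4 + `|Kp| + `|Kx|)) => n k w kn n0.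
have kn' := ltnW kn.
have h0 := hh_ge0 n; have g0 := gg_ge0 n; have hg := hh_le_gg n; have h1 := hh_le1 n.
have gE := ggE n; have g1 := gg_le1 n.
have W00 : 0 <= W0 by exact: expR_ge0.
have r0 := rho_ge0.
have [B1 B2 _ _] := bnd_ge n k w.
have b1 : 1 <= bnd n k w by apply: le_trans B1; exact: QQ_ge1.
have b0 : 0 <= bnd n k w by exact: le_trans b1.
have p2 : pp n k w ^+ 2 <= `|Kp| * bnd n k w.
  apply: le_trans (hp n k w kn) _; apply: le_trans (_ : `|Kp| * QQ n k w <= _).
    by apply: ler_wpM2r (ler_norm _); apply: le_trans (QQ_ge1 n k w).
  exact: ler_wpM2l.
have x2 : xx n k w ^+ 2 <= `|Kx| * bnd n k w.
  by apply: le_trans (hx n k w) _; apply: ler_wpM2r (ler_norm _).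
have x3 : `|xx n k w| ^+ 3 <= `|Kc| * bnd n k w.
  by apply: le_trans (hc n k w) _; apply: ler_wpM2r (ler_norm _).
have hgg0 : 0 <= hh n * gg n by exact: mulr_ge0.
have T1 : `|wt n k.+1 * (cos (Phi n k.+1 w) - (cos (Phi n k w)
     - sin (Phi n k w) * (hh n * pp n k w + gg n * xx n k w)
     - cos (Phi n k w) * (gg n * xx n k w) ^+ 2 / 2))| <=
   hh n * gg n * (W0 * (3 * `|Kp| + `|Kx| + `|Kc|) * bnd n k w).
  rewrite normrM.
  have tay := cos_taylor_add (Phi n k w) (hh n * pp n k w) (gg n * xx n k w).
  rewrite -[Phi n k w + _]/(Phi n k.+1 w) in tay.
  apply: le_trans (ler_pM (normr_ge0 _) (normr_ge0 _) (norm_wt (leqW kn) n0) tay) _.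
  rewrite -[X in _ <= _ * X]mulrA [leRHS]mulrCA; apply: ler_wpM2l => //.
  rewrite !normrM (ger0_norm h0) (ger0_norm g0) !exprMn.
  have g3 : gg n ^+ 3 = hh n * gg n by rewrite -gE; ring.
  have hh2 : hh n ^+ 2 <= hh n * gg n by rewrite expr2; exact: ler_wpM2l.
  rewrite g3.
  have pxl : `|pp n k w| * `|xx n k w| <= pp n k w ^+ 2 + xx n k w ^+ 2.
    by rewrite -normrM norm_mul_le.
  apply: le_trans (_ : hh n * gg n * (2 * pp n k w ^+ 2 + `|pp n k w| * `|xx n k w| + `|xx n k w| ^+ 3) <= _).
    rewrite !mulrDr -!addrA; apply: lerD.
      by rewrite [leRHS]mulrCA ler_pM2l//; apply: ler_wpM2r; rewrite ?sqr_ge0.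
    by rewrite mulrACA.
  apply: ler_wpM2l => //; lra.
have T2 : `|wt n k.+1 * cos (Phi n k w) * (1 - expR (- (hh n * (rho / 2 * tk n k ^+ 2)))
      - hh n * (rho / 2 * tk n k ^+ 2))| <= hh n * gg n * (W0 * rho ^+ 2 * bnd n k w).
  have z0 : 0 <= rho / 2 * tk n k ^+ 2 by rewrite mulr_ge0 ?sqr_ge0// divr_ge0.
  have z1 : rho / 2 * tk n k ^+ 2 <= rho.
    apply: le_trans (_ : rho / 2 <= _); last by lra.
    by rewrite ler_piMr ?divr_ge0//; apply: exprn_ile1; [exact: tk_ge0|exact: tk_le1].
  have tay := expR_taylor1 (mulr_ge0 h0 z0).
  rewrite (normrM (wt n k.+1 * _)) (normrM (wt n k.+1)).
  apply: le_trans (_ : W0 * 1 * (hh n ^+ 2 * rho ^+ 2) <= _).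
    apply: ler_pM; [exact: mulr_ge0|exact: normr_ge0| |].
      by apply: ler_pM => //; [apply: norm_wt => //; exact: leqW|exact: cos_max].
    apply: le_trans tay _; rewrite exprMn; apply: ler_wpM2l; first exact: sqr_ge0.
    by apply: lerXn2r; rewrite ?nnegrE.
  rewrite mulr1 mulrCA -[X in _ <= _ * X]mulrA.
  apply: ler_pM; [exact: sqr_ge0|by apply: mulr_ge0 => //; exact: sqr_ge0| |].
    by rewrite expr2; exact: ler_wpM2l.
  by apply: ler_wpM2l => //; rewrite ler_peMr//; exact: sqr_ge0.
have T3 : `|hh n / gam * ((psi n k.+1 w - psi n k w) * vh n k.+1 w ^+ 2)| <=
    hh n * gg n * (C3 * (4 + `|Kp| + `|Kx|) * bnd n k w).
  have ga0 := gam_gt0.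
  have c30 : 0 <= Kpsi * (1 + rho).
    by rewrite mulr_ge0 ?addr_ge0// mulr_ge0// addr_ge0.
  rewrite (normrM (hh n / _)) (normrM (hh n)) (normrM (psi n k.+1 w - _)) (ger0_norm h0).
  rewrite (ger0_norm (sqr_ge0 (vh n k.+1 w))) (gtr0_norm (_ : 0 < gam^-1)) ?invr_gt0//.
  rewrite -[X in X <= _]mulrA -[leRHS]mulrA; apply: ler_wpM2l => //.
  apply: le_trans (_ : gam^-1 * (gg n * (Kpsi * (1 + rho) * (1 + `|pp n k w| + `|xx n k w|)) * vh n k.+1 w ^+ 2) <= _).
    apply: ler_wpM2l; first by rewrite invr_ge0 ltW.
    by apply: ler_wpM2r; [exact: sqr_ge0|exact: dpsi_norm].
  rewrite /C3.
  have key : (1 + `|pp n k w| + `|xx n k w|) * vh n k.+1 w ^+ 2 <=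
      (4 + `|Kp| + `|Kx|) * bnd n k w.
    have v4 : vh n k.+1 w ^+ 4 <= bnd n k w.
      apply: le_trans B2; have [[u8' v4] e2' _ _ _] := QQ_parts n k.+1 w.
      by rewrite /QQ; lra.
    have v2 := sqr_le_pow4 (vh n k.+1 w).
    have m1 := norm_mul_le (pp n k w) (vh n k.+1 w ^+ 2).
    have m2 := norm_mul_le (xx n k w) (vh n k.+1 w ^+ 2).
    rewrite normrM (ger0_norm (sqr_ge0 (vh n k.+1 w))) -exprM in m1.
    rewrite normrM (ger0_norm (sqr_ge0 (vh n k.+1 w))) -exprM in m2.
    rewrite !mulrDl mul1r; lra.
  have e1 (a b c : R) : gam^-1 * (gg n * (a * b) * c) = gg n * (a / gam * (b * c)) by ring.
  rewrite e1 -[X in _ <= _ * X]mulrA; apply: ler_wpM2l => //.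
  by apply: ler_wpM2l key; rewrite divr_ge0// ltW.
rewrite /restT; apply: le_trans (ler_normB _ _) _.
apply: le_trans (lerD (ler_normD _ _) (lexx _)) _.
apply: le_trans (lerD (lerD T1 T2) T3) _.
by rewrite le_eqVlt; apply/orP; left; apply/eqP; ring.
Qed.

Lemma dom_Psi n k : (k <= n)%N -> dom n 2 (Psi n k).
Proof.
move=> kn; have := domB (domM (dom_cst n (wt n k)) (dom_cosPhi n n k))
  (domM (dom_cst n (hh n / gam)) (domM (dom_psi n n k) (domX 2 (dom_vh n kn)))).
exact.
Qed.

Lemma Psi_step_Ex : exists K, forall n k, (k < n)%N -> (0 < n)%N ->
  `|Ex P (Psi n k.+1) - Ex P (Psi n k)| <= hh n * gg n * K.
Proof.
have [Kr hr] := restT_bound; have [Kg hg] := GG_bound; have [Kb hb] := bnd_Ex.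
exists ((`|Kr| + `|Kg|) * Kb) => n k kn n0.
have [Lc Ec] := cc_zero kn; set cc := (fun w => _) in Lc Ec.
have L0 : L1 P (Psi n k) := dom_L1 (isT : 2 <= 8)%N (dom_Psi (ltnW kn)).
have L1' : L1 P (Psi n k.+1) := dom_L1 (isT : 2 <= 8)%N (dom_Psi kn).
have e w : restT n k w + hh n * gg n * GG n k w = Psi n k.+1 w - Psi n k w - cc w.
  by rewrite Psi_step /cc addrK.
have LR : L1 P (fun w => restT n k w + hh n * gg n * GG n k w).
  by rewrite (funext e); exact: L1B (L1B L1' L0) Lc.
have Lb := bnd_L1 kn.
have -> : Ex P (Psi n k.+1) - Ex P (Psi n k) =
    Ex P (fun w => restT n k w + hh n * gg n * GG n k w).
  by rewrite (eq_Ex _ e) (ExB (L1B L1' L0) Lc) Ec subr0 (ExB L1' L0).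
have hg0 : 0 <= hh n * gg n by rewrite mulr_ge0 ?hh_ge0 ?gg_ge0.
apply: le_trans (Ex_norm_le (g := fun w => (hh n * gg n * (`|Kr| + `|Kg|)) * bnd n k w) LR (L1Z _ Lb) _) _.
  move=> w; have [B1 _ _ _] := bnd_ge n k w.
  have b0 : 0 <= bnd n k w by apply: le_trans B1; apply: le_trans (QQ_ge1 n k w).
  rewrite -[leRHS]mulrA [X in _ <= _ * X]mulrDl [leRHS]mulrDr.
  apply: le_trans (ler_normD _ _) _; apply: lerD.
    apply: le_trans (hr n k w kn n0) _; apply: ler_wpM2l => //.
    by apply: ler_wpM2r => //; exact: ler_norm.
  rewrite normrM ger0_norm//; apply: ler_wpM2l => //.
  apply: le_trans (hg n k w n0 kn) _; apply: le_trans (_ : `|Kg| * QQ n k w <= _).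
    by apply: ler_wpM2r; [apply: le_trans (QQ_ge1 n k w)|exact: ler_norm].
  exact: ler_wpM2l.
rewrite ExZ// -mulrA; apply: ler_wpM2l => //; apply: ler_wpM2l; last exact: hb.
by rewrite addr_ge0.
Qed.

Lemma wt_cosPhi : exists K, forall n, (0 < n)%N ->
  `|wt n n * Ex P (fun w => cos (Phi n n w)) - cos theta| <= K * gg n.
Proof.
have [K hK] := Psi_step_Ex.
have Kp0 : 0 <= Kpsi by rewrite mulr_ge0 ?expR_ge0// addr_ge0.
exists (K + gam^-1 * (Kpsi * QQbound)) => n n0.
have tel k : (k <= n)%N -> `|Ex P (Psi n k) - Ex P (Psi n 0)| <= k%:R * (hh n * gg n * K).
  elim: k => [|k IH] kn; first by rewrite subrr normr0 mul0r.
  rewrite (_ : _ - _ = (Ex P (Psi n k.+1) - Ex P (Psi n k)) + (Ex P (Psi n k) - Ex P (Psi n 0))); last by ring.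
  apply: le_trans (ler_normD _ _) _; rewrite -[k.+1%:R]natr1 mulrDl mul1r addrC.
  by apply: lerD; [exact: IH (ltnW kn)|exact: hK].
(* V_0 = 0 kills the corrector at time 0; at time n its expectation is at most
   [hh n / gam * (Kpsi * QQbound)] in absolute value, by [psiv]. *)
have E0 : Ex P (Psi n 0) = cos theta.
  rewrite (@eq_Ex _ _ _ _ _ (fun=> cos theta)) ?Ex_cst// => w.
  rewrite /Psi [wt n 0]/1 /= mul1r (_ : vh n 0 w = 0) ?expr0n/= ?mulr0 ?subr0//.
  by rewrite /vh /VV/= subrr mulr0.
have dv := dom_vh n (leqnn n).
have Lv : L1 P (fun w => psi n n w * vh n n w ^+ 2).
  exact: (dom_L1 _ (domM (dom_psi n n n) (domX 2 dv))).
have Lcos : L1 P (fun w => cos (Phi n n w)) := dom_L1 (isT : 0 <= 8)%N (dom_cosPhi n n n).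
have En : Ex P (Psi n n) = wt n n * Ex P (fun w => cos (Phi n n w))
    - hh n / gam * Ex P (fun w => psi n n w * vh n n w ^+ 2).
  by rewrite /Psi ExB ?ExZ//; exact: L1Z.
have psiv : `|Ex P (fun w => psi n n w * vh n n w ^+ 2)| <= Kpsi * QQbound.
  apply: le_trans (Ex_norm_le (g := fun w => Kpsi * QQ n n w) Lv (L1Z _ (QQ_L1 (leqnn n))) _) _.
    move=> w; rewrite normrM; apply: ler_pM => //; first exact: norm_psi.
    by have := Q_v2 n n w; rewrite mul1r.
  rewrite ExZ; last exact: QQ_L1.
  by apply: ler_wpM2l => //; exact: QQ_Ex.
rewrite (_ : _ - _ = (Ex P (Psi n n) - Ex P (Psi n 0)) +
   hh n / gam * Ex P (fun w => psi n n w * vh n n w ^+ 2)); last by rewrite E0 En; ring.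
apply: le_trans (ler_normD _ _) _; rewrite [leRHS]mulrDl; apply: lerD.
  apply: le_trans (tel n (leqnn n)) _; rewrite !mulrA /hh divff ?pnatr_eq0 -?lt0n//.
  by rewrite mul1r mulrC.
have ga0 := gam_gt0.
rewrite normrM normrM (ger0_norm (hh_ge0 n)) (gtr0_norm (_ : 0 < gam^-1)) ?invr_gt0//.
apply: le_trans (_ : gg n * gam^-1 * (Kpsi * QQbound) <= _); last by rewrite -mulrA mulrC.
apply: ler_pM => //; first by rewrite mulr_ge0 ?hh_ge0// invr_ge0 ltW.
by apply: ler_wpM2r; [rewrite invr_ge0 ltW|exact: hh_le_gg].
Qed.

Lemma wtE n k : wt n k = expR (rho / 2 * (hh n * \sum_(j < k) tk n j ^+ 2)).
Proof.
elim: k => [|k IH]; first by rewrite big_ord0 !mulr0 expR0.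
by rewrite wtS IH -expRD big_ord_recr/=; congr expR; ring.
Qed.

Lemma PhiE n k w : Phi n k w = theta
  + q * (hh n * \sum_(j < k) uh n j w ^+ 2 - mU ^+ 2 * (hh n * \sum_(j < k) tk n j ^+ 2))
  + r * (hh n * \sum_(j < k) vh n j w ^+ 2 - mU * (hh n * \sum_(j < k) tk n j))
  + s * (gg n * \sum_(j < k) (uh n j w * incU j w))
  + t * (gg n * \sum_(j < k) (vh n j w * dh n j w)).
Proof.
elim: k => [|k IH]; first by rewrite !big_ord0 /=; ring.
by rewrite [LHS]/= IH !big_ord_recr/= /pp /xx; ring.
Qed.

End Telescope.

(** * Limits of the expected cosines and second moments of the sums *)

Lemma sum_nat_R n : \sum_(j < n) (j%:R : R) = n%:R * (n%:R - 1) / 2.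
Proof.
elim: n => [|n IH]; first by rewrite big_ord0 mul0r mul0r.
by rewrite big_ord_recr/= IH -[n.+1%:R]natr1; field.
Qed.

Lemma sum_sqr_R n : \sum_(j < n) (j%:R ^+ 2 : R) = n%:R * (n%:R - 1) * (2 * n%:R - 1) / 6.
Proof.
elim: n => [|n IH]; first by rewrite big_ord0 !mul0r.
by rewrite big_ord_recr/= IH -[n.+1%:R]natr1; field.
Qed.

Lemma hh_neq0 n : (n.+1%:R : R) != 0.
Proof. by rewrite pnatr_eq0. Qed.

Lemma sum_tk n : hh n.+1 * \sum_(j < n.+1) tk n.+1 j = (1 - hh n.+1) / 2.
Proof.
have n0 := hh_neq0 n; rewrite /tk -mulr_suml sum_nat_R /hh.
by move: (n.+1%:R : R) n0 => x x0; field.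
Qed.

Lemma sum_tk2 n :
  hh n.+1 * \sum_(j < n.+1) tk n.+1 j ^+ 2 = (1 - hh n.+1) * (2 - hh n.+1) / 6.
Proof.
have n0 := hh_neq0 n.
have -> : \sum_(j < n.+1) tk n.+1 j ^+ 2 = hh n.+1 ^+ 2 * \sum_(j < n.+1) (j%:R ^+ 2 : R).
  by rewrite mulr_sumr; apply: eq_bigr => j _; rewrite /tk exprMn mulrC.
by rewrite sum_sqr_R /hh; move: (n.+1%:R : R) n0 => x x0; field.
Qed.

Lemma cvg_hh : (fun n => hh n.+1) @ \oo --> (0 : R).
Proof. exact: cvg_harmonic. Qed.

Lemma cvg_gg : (fun n => gg n.+1) @ \oo --> (0 : R).
Proof.
have : (fun n => Num.sqrt (hh n.+1)) @ \oo --> Num.sqrt (0 : R).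
  exact: (continuous_cvg _ (@sqrt_continuous R 0) cvg_hh).
by rewrite sqrtr0.
Qed.

Lemma cvg_sum_tk : (fun n => hh n.+1 * \sum_(j < n.+1) tk n.+1 j) @ \oo --> (2^-1 : R).
Proof.
have : (fun n => (1 - hh n.+1) / 2) @ \oo --> ((1 - 0) / 2 : R).
  apply: cvgM (cvg_cst _); apply: cvgB (cvg_cst _) cvg_hh.
by rewrite subr0 mul1r (_ : (fun n => _) =
    fun n => hh n.+1 * \sum_(j < n.+1) tk n.+1 j)//; apply/funext => n; rewrite sum_tk.
Qed.

Lemma cvg_sum_tk2 : (fun n => hh n.+1 * \sum_(j < n.+1) tk n.+1 j ^+ 2) @ \oo --> (3^-1 : R).
Proof.
have : (fun n => (1 - hh n.+1) * (2 - hh n.+1) / 6) @ \oo --> ((1 - 0) * (2 - 0) / 6 : R).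
  apply: cvgM (cvg_cst _); apply: cvgM; apply: cvgB (cvg_cst _) cvg_hh.
rewrite (_ : _ / 6 = 3^-1 :> R); last by field.
by rewrite (_ : (fun n => _) =
    fun n => hh n.+1 * \sum_(j < n.+1) tk n.+1 j ^+ 2)//; apply/funext => n; rewrite sum_tk2.
Qed.

Definition SA n w := hh n * \sum_(j < n) uh n j w ^+ 2.
Definition SB n w := hh n * \sum_(j < n) vh n j w ^+ 2.
Definition SC n w := gg n * \sum_(j < n) (uh n j w * incU j w).
Definition SD n w := gg n * \sum_(j < n) (vh n j w * dh n j w).

Lemma cvg_cosPhi q r s t theta :
  (fun n => Ex P (fun w => cos (Phi q r s t theta n.+1 n.+1 w))) @ \oo -->
  cos theta * expR (- (rho s t / 6)).
Proof.
have [K hK] := wt_cosPhi q r s t theta.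
pose E n := Ex P (fun w => cos (Phi q r s t theta n.+1 n.+1 w)).
have cw : (fun n => wt s t n.+1 n.+1 * E n) @ \oo --> cos theta.
  apply: (@cvg_of_dist _ _ (fun n => K * gg n.+1)); first by move=> n; exact: hK.
  by rewrite -(mulr0 K); apply: cvgM (cvg_cst _) cvg_gg.
have cv : (fun n => expR (- (rho s t / 2 * (hh n.+1 * \sum_(j < n.+1) tk n.+1 j ^+ 2)))) @ \oo
    --> expR (- (rho s t / 6)).
  have -> : rho s t / 6 = rho s t / 2 * 3^-1 by field.
  have cN : (fun n => - (rho s t / 2 * (hh n.+1 * \sum_(j < n.+1) tk n.+1 j ^+ 2))) @ \oo
      --> - (rho s t / 2 * 3^-1).
    by apply: cvgN; apply: cvgM (cvg_cst _) cvg_sum_tk2.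
  exact: (continuous_cvg _ (@continuous_expR R _) cN).
have WE n : E n = wt s t n.+1 n.+1 * E n *
     expR (- (rho s t / 2 * (hh n.+1 * \sum_(j < n.+1) tk n.+1 j ^+ 2))).
  rewrite wtE; set y := rho s t / 2 * _.
  by rewrite mulrAC -expRD subrr expR0 mul1r.
rewrite -/E (funext WE).
exact: cvgM.
Qed.

Lemma Phi_shift q r s t theta x n w :
  Phi q r s t (theta + x) n n w = Phi q r s t theta n n w + x.
Proof. by rewrite !PhiE; ring. Qed.

(** The four sums differ from the centred phase [Phi] by the deterministic shift [c n], which
    converges. The addition formula separates the shift, the sine of [Phi] being the cosine with
    phase [theta - pi / 2]. *)
Lemma process_cf q r s t theta :
  (fun n => Ex P (fun w => cos (q * SA n.+1 w + r * SB n.+1 w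
     + s * SC n.+1 w + t * SD n.+1 w + theta))) @ \oo -->
  cos (q * (mU ^+ 2 / 3) + r * (mU / 2) + theta) * expR (- (rho s t / 6)).
Proof.
pose c n := q * (mU ^+ 2 * (hh n * \sum_(j < n) tk n j ^+ 2)) +
  r * (mU * (hh n * \sum_(j < n) tk n j)).
pose F x n := Ex P (fun w => cos (Phi q r s t x n n w)).
have FE n : Ex P (fun w => cos (q * SA n w + r * SB n w + s * SC n w + t * SD n w + theta)) =
    F theta n * cos (c n) - F (theta - pi / 2) n * sin (c n).
  have Lc x : L1 P (fun w => cos (Phi q r s t x n n w)).
    exact: (dom_L1 (isT : 0 <= 8)%N (dom_cosPhi _ _ _ _ _ n n n)).
  rewrite ![F _ _ * _]mulrC -!ExZ// -ExB; [|exact: L1Z|exact: L1Z].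
  apply: eq_Ex => w; rewrite Phi_shift cosBpihalf -cosD.
  by congr cos; rewrite PhiE /SA /SB /SC /SD /c; ring.
have cc : (fun n => c n.+1) @ \oo --> q * (mU ^+ 2 / 3) + r * (mU / 2).
  by apply: cvgD; apply: cvgM (cvg_cst _) _; apply: cvgM (cvg_cst _) _; [exact: cvg_sum_tk2|exact: cvg_sum_tk].
under eq_fun do rewrite FE.
set y := q * _ + _.
have -> : cos (y + theta) * expR (- (rho s t / 6)) =
   cos theta * expR (- (rho s t / 6)) * cos y - cos (theta - pi / 2) * expR (- (rho s t / 6)) * sin y.
  by rewrite cosBpihalf cosD; ring.
apply: cvgB; apply: cvgM; try exact: cvg_cosPhi.
  exact: (continuous_cvg _ (@continuous_cos R _) cc).
exact: (continuous_cvg _ (@continuous_sin R _) cc).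
Qed.

Lemma rho_sqr s t : rho s t = (s ^+ 2 * s2U + t ^+ 2 * gam) * mU ^+ 2.
Proof. by []. Qed.

(** Orthogonality: the cross term pairs [S * H k], which is known from the past, with [D k], so
    second moments add. The degree in [dom] stays 2 because a sum has the larger of the degrees of
    its terms. *)
Lemma martingale_sq (n : nat) (H D : nat -> T -> R) (C : R) :
  (forall j, (j < n)%N -> known Y (past j) (H j)) ->
  (forall j, (j < n)%N -> dom n 1 (H j)) ->
  (forall j, (j < n)%N -> known Y (past j.+1) (D j)) ->
  (forall j, (j < n)%N -> dom n 1 (D j)) ->
  (forall j p (K : T -> R), (j < n)%N -> (p <= 7)%N -> known Y (past j) K -> dom n p K ->
     Ex P (fun w => K w * D j w) = 0) ->
  (forall j, (j < n)%N -> Ex P (fun w => (H j w * D j w) ^+ 2) <= C) ->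
  dom n 2 (fun w => \sum_(j < n) H j w * D j w) /\
  Ex P (fun w => (\sum_(j < n) H j w * D j w) ^+ 2) <= n%:R * C.
Proof.
move=> kH dH kD dD E0 E2.
suff S k : (k <= n)%N -> [/\ known Y (past k) (fun w => \sum_(j < k) H j w * D j w),
    dom n 2 (fun w => \sum_(j < k) H j w * D j w) &
    Ex P (fun w => (\sum_(j < k) H j w * D j w) ^+ 2) <= k%:R * C].
  by have [] := S n (leqnn n).
elim: k => [|k IH] kn.
  have e0 : (fun w : T => \sum_(j < 0) H j w * D j w) = fun=> 0.
    by apply/funext => w; rewrite big_ord0.
  rewrite e0; split; [exact: known_cst|exact: dom_weaken (dom_cst _ _)|].
  by rewrite (@eq_Ex _ _ _ _ _ (fun=> 0)) ?Ex_cst ?mul0r// => w; rewrite big_ord0 expr0n.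
have [kS dS eS] := IH (ltnW kn).
set S := (fun w => _) in kS dS eS.
have eS' : (fun w : T => \sum_(j < k.+1) H j w * D j w) = fun w => S w + H k w * D k w.
  by apply/funext => w; rewrite big_ord_recr.
have dHD : dom n 2 (fun w => H k w * D k w) := domM (dH k kn) (dD k kn).
rewrite eS'; split.
- by apply: knownD; [exact: known_S|apply: knownM; [exact: known_S (kH k kn)|exact: kD]].
- exact: domD dS dHD.
have LS2 : L1 P (fun w => S w ^+ 2) by apply: dom_L1 (domX 2 dS).
have dSH : dom n 3 (fun w => S w * H k w) := domM dS (dH k kn).
have LSH : L1 P (fun w => S w * H k w * D k w) by apply: dom_L1 (domM dSH (dD k kn)).
have LHD : L1 P (fun w => (H k w * D k w) ^+ 2) by apply: dom_L1 (domX 2 dHD).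
rewrite (@eq_Ex _ _ _ _ _ (fun w => S w ^+ 2 + (2 * (S w * H k w * D k w) + (H k w * D k w) ^+ 2))); last first.
  by move=> w; rewrite -/(S w) (congr1 (@^~ w) eS'); ring.
rewrite ExD//; last by apply: L1D LHD; exact: L1Z.
rewrite ExD//; last exact: L1Z.
rewrite ExZ// (E0 k 3 _ kn)//; last by apply: knownM => //; exact: kH.
rewrite mulr0 add0r -[k.+1%:R]natr1 mulrDl mul1r; apply: lerD => //; exact: E2.
Qed.

(** The first two sums are nonnegative, so their first moments suffice; the two martingale sums are
    controlled in second moment by [martingale_sq]. *)
Lemma process_tight : exists K, forall n,
  L1 P (fun w => SA n w + SB n w + SC n w ^+ 2 + SD n w ^+ 2) /\
  Ex P (fun w => SA n w + SB n w + SC n w ^+ 2 + SD n w ^+ 2) <= K.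
Proof.
have [Kb hb] := bnd_Ex.
exists (QQbound + QQbound + `|Kb| + `|Kb|) => n.
have hn (c : R) : 0 <= c -> hh n * (n%:R * c) <= c.
  move=> c0; rewrite mulrA mulrC; apply: ler_piMr => //.
  by rewrite mulrC; exact: tk_le1.
have QQ0 : 0 <= QQbound.
  by rewrite /QQbound; have := u8_ge0; have := vbound_ge0; have := s2U_ge0; lra.
have avg (f : nat -> T -> R) : (forall j, (j < n)%N -> L1 P (f j)) ->
    (forall j, (j < n)%N -> Ex P (f j) <= QQbound) ->
    L1 P (fun w => hh n * \sum_(j < n) f j w) /\
    Ex P (fun w => hh n * \sum_(j < n) f j w) <= QQbound.
  move=> Lf Ef; have Ls : L1 P (fun w => \sum_(j < n) f j w).
    by apply: (@L1_sum _ _ _ P _ _ (fun (j : 'I_n) w => f j w)) => j; exact: Lf.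
  split; first exact: L1Z.
  rewrite ExZ// (@Ex_sum _ _ _ P _ _ (fun (j : 'I_n) w => f j w)); last by move=> j; exact: Lf.
  apply: le_trans (hn QQbound QQ0); apply: ler_wpM2l; first exact: hh_ge0.
  apply: le_trans (ler_sum _ (fun (j : 'I_n) _ => Ef j (ltn_ord j))) _.
  by rewrite sumr_const card_ord mulr_natl.
have leQ f k : (k <= n)%N -> L1 P f -> (forall w, f w <= QQ n k w) -> Ex P f <= QQbound.
  by move=> kn Lf fle; apply: le_trans (Ex_le Lf (QQ_L1 kn) fle) _; exact: QQ_Ex.
have [LA EA] : L1 P (SA n) /\ Ex P (SA n) <= QQbound.
  apply: (avg (fun j w => uh n j w ^+ 2)) => j jn.
    by apply: dom_L1 (domX 2 (dom_uh n (ltnW jn))).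
  apply: (leQ _ j (ltnW jn)); first by apply: dom_L1 (domX 2 (dom_uh n (ltnW jn))).
  by move=> w; have := Q_u2 n j w; rewrite ger0_norm ?sqr_ge0// mul1r.
have [LB EB] : L1 P (SB n) /\ Ex P (SB n) <= QQbound.
  apply: (avg (fun j w => vh n j w ^+ 2)) => j jn.
    by apply: dom_L1 (domX 2 (dom_vh n (ltnW jn))).
  apply: (leQ _ j (ltnW jn)); first by apply: dom_L1 (domX 2 (dom_vh n (ltnW jn))).
  by move=> w; have := Q_v2 n j w; rewrite ger0_norm ?sqr_ge0// mul1r.
have mart (H D : nat -> T -> R) :
    dom n 2 (fun w => \sum_(j < n) H j w * D j w) ->
    Ex P (fun w => (\sum_(j < n) H j w * D j w) ^+ 2) <= n%:R * `|Kb| ->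
    L1 P (fun w => (gg n * \sum_(j < n) H j w * D j w) ^+ 2) /\
    Ex P (fun w => (gg n * \sum_(j < n) H j w * D j w) ^+ 2) <= `|Kb|.
  move=> dS eS.
  have -> : (fun w => (gg n * \sum_(j < n) H j w * D j w) ^+ 2) =
     (fun w => hh n * (\sum_(j < n) H j w * D j w) ^+ 2).
    by apply/funext => w; rewrite exprMn [gg n ^+ 2]ggE.
  have L2 : L1 P (fun w => (\sum_(j < n) H j w * D j w) ^+ 2).
    by apply: dom_L1 (domX 2 dS).
  split; first exact: L1Z.
  rewrite ExZ//; apply: le_trans (hn _ (normr_ge0 Kb)).
  by apply: ler_wpM2l => //; exact: hh_ge0.
have bndE j : (j < n)%N -> forall f, L1 P f -> (forall w, f w <= bnd n j w) -> Ex P f <= `|Kb|.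
  move=> jn f Lf fle; apply: le_trans (Ex_le Lf (bnd_L1 jn) fle) _.
  by apply: le_trans (hb n j jn) _; exact: ler_norm.
have [LC EC] : L1 P (fun w => SC n w ^+ 2) /\ Ex P (fun w => SC n w ^+ 2) <= `|Kb|.
  have [dS eS] := @martingale_sq n (uh n) incU `|Kb| (fun j _ => @known_uh n j)
    (fun j jn => dom_uh n (ltnW jn)) (fun j _ => @known_incU j) (fun j jn => dom_incU jn)
    (fun j p K _ p7 kK dK => incU_Ex1 (leqW p7) kK dK)
    (fun j jn => bndE j jn _ (dom_L1 (isT : (1 + 1) * 2 <= 8)%N (domX 2 (domM (dom_uh n (ltnW jn)) (dom_incU jn))))
     (fun w => ltac:(have [_ _ h _] := bnd_ge n j w; have := sqr_ge0 (vh n j w * dh n j w); lra))).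
  exact: mart dS eS.
have [LD ED] : L1 P (fun w => SD n w ^+ 2) /\ Ex P (fun w => SD n w ^+ 2) <= `|Kb|.
  have [dS eS] := @martingale_sq n (vh n) (dh n) `|Kb| (fun j _ => @known_vh n j)
    (fun j jn => dom_vh n (ltnW jn)) (fun j _ => @known_dh n j) (fun j jn => dom_dh n jn)
    (fun j p K jn p7 kK dK => dh_Ex1 jn p7 kK dK)
    (fun j jn => bndE j jn _ (dom_L1 (isT : (1 + 1) * 2 <= 8)%N (domX 2 (domM (dom_vh n (ltnW jn)) (dom_dh n jn))))
     (fun w => ltac:(have [_ _ h _] := bnd_ge n j w; have := sqr_ge0 (uh n j w * incU j w); lra))).
  exact: mart dS eS.
split; first by do 3 apply: L1D => //.
rewrite (ExD (L1D (L1D LA LB) LC) LD) (ExD (L1D LA LB) LC) (ExD LA LB).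
by rewrite !lerD.
Qed.

End Process.
(** * Wiener integrals *)

Section GaussianSequence.
Context {R : realType} {d : measure_display} {T : measurableType d} (Q : probability T R).
Variables (X : nat -> T -> R) (v : nat -> R) (m : nat).
Hypothesis mX : forall i, measurable_fun setT (X i).
Hypothesis v_gt0 : forall i, 0 < v i.
Hypothesis joint_cdf : forall x : nat -> R,
  Q (\bigcap_(i in [set i | (i < m)%N]) [set w | X i w <= x i]) =
  (\prod_(i < m) gauss_cdf (v i) (x i))%E.

Let box j (x : nat -> R) w : R := \prod_(j <= i < m) (X i w <= x i)%R%:R.

Let box01 j x w : 0 <= box j x w <= 1.
Proof.
rewrite /box; elim/big_rec: _ => [|i y _ /andP[y0 y1]]; first by rewrite ler01 lexx.
by case: (X i w <= x i)%R; rewrite ?mul1r ?mul0r ?y0 ?y1 ?lexx ?ler01.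
Qed.

Let measurable_ray i c : measurable [set w | X i w <= c].
Proof.
have h := mX i measurableT (measurable_itv `]-oo, c]); rewrite setTI in h.
by rewrite (_ : [set w | X i w <= c] = X i @^-1` `]-oo, c]%classic)//; apply/seteqP; split => w; rewrite /= in_itv.
Qed.

Let measurable_le i y : measurable_fun setT (fun w => (X i w <= y)%R%:R : R).
Proof.
rewrite (_ : (fun _ => _) = \1_[set w | X i w <= y]); first exact: measurable_indic.
by apply/funext => w; rewrite indicE (_ : (w \in _) = (X i w <= y))//; apply/idP/idP; rewrite inE.
Qed.

Let measurable_box j x : measurable_fun setT (box j x).
Proof.
by apply: measurable_prod => i _; exact: measurable_le.
Qed.

Let gcdf i (x : nat -> R) : R := fine (gauss_cdf (v i) (x i)).

Let gcdfE i x : (gcdf i x)%:E = gauss_cdf (v i) (x i).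
Proof.
have s0 : 0 < Num.sqrt (v i) by rewrite sqrtr_gt0.
rewrite /gcdf fineK// -[v i]sqr_sqrtr ?ltW// -(normal_prob_cdf s0).
exact: fin_num_measure.
Qed.

Let gcdf_ge0 i x : 0 <= gcdf i x.
Proof. by apply: fine_ge0; apply: integral_ge0 => y _; rewrite lee_fin normal_pdf_ge0. Qed.

Let S (c : nat -> R) j w := \sum_(i < j) c i * X i w.

Let measurable_S c j : measurable_fun setT (S c j).
Proof. by apply: measurable_sum => i; apply: measurable_funM. Qed.

Let measurable_cosS c j th : measurable_fun setT (fun w => cos (S c j w + th)).
Proof.
apply: (measurableT_comp (f := cos)); first by apply: continuous_measurable_fun; exact: continuous_cos.
exact: measurable_funD.
Qed.

Let L1_box j x : L1 Q (box j x).
Proof.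
apply: (@L1_bounded _ _ _ _ _ 1) => // w.
by have /andP[b0 b1] := box01 j x w; rewrite ger0_norm.
Qed.

Let boxS j x w : (j < m)%N -> box j x w = (X j w <= x j)%R%:R * box j.+1 x w.
Proof. by move=> jm; rewrite /box big_ltn. Qed.

Let ray_integral i y (h : T -> R) : measurable_fun setT h -> (forall w, `|h w| <= 2) ->
  (\int[Q]_(w in X i @^-1` `]-oo, y]) (h w)%:E = (Ex Q (fun w => h w * (X i w <= y)%R%:R))%:E)%E.
Proof.
move=> mh h2; rewrite integral_mkcond -integral_Ex; last first.
  apply: (@L1_bounded _ _ _ _ _ 2); first by apply: measurable_funM.
  move=> w; rewrite normrM normr_nat; case: (X i w <= y)%R; rewrite ?mulr1 ?mulr0//.
apply: eq_integral => w _; rewrite patchE.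
have -> : (w \in X i @^-1` `]-oo, y]) = (X i w <= y) by apply/idP/idP; rewrite inE/= in_itv.
by case: (X i w <= y)%R; rewrite ?mulr1 ?mulr0.
Qed.

(** Induction on the number of variables moved from the indicator [box] into the cosine: j = 0 is
    the assumption on joint distribution functions, and j = m, with an empty box, is the
    characteristic function. Each move is an application of [weighted_law] with the other variables
    in the weight. *)
Lemma Ex_cos_box j (c x : nat -> R) theta : (j <= m)%N ->
  Ex Q (fun w => cos (S c j w + theta) * box j x w) =
  cos theta * expR (- (\sum_(i < j) c i ^+ 2 * v i / 2)) * \prod_(j <= i < m) gcdf i x.
Proof.
elim: j c x theta => [|j IH] c x theta jm.
  rewrite big_ord0 oppr0 expR0 mulr1.
  rewrite (@eq_Ex _ _ _ _ _ (fun w => cos theta * box 0 x w)); last by move=> w; rewrite /S big_ord0 add0r.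
  rewrite ExZ//; congr (_ * _); apply: EFin_inj; rewrite big_mkord -prodEFin.
  under [RHS]eq_bigr do rewrite gcdfE.
  rewrite -joint_cdf.
  have mB : measurable (\bigcap_(i in [set i | (i < m)%N]) [set w | X i w <= x i]).
    by apply: fin_bigcap_measurable => //; exact: finite_II.
  rewrite -[in RHS](setIT (\bigcap_(_ in _) _)) -integral_indic// -integral_Ex//.
  apply: eq_integral => w _; congr EFin; rewrite /box big_mkord indicE.
  have [/allP/= h|/allPn/=[i _ hi]] := boolP (all (fun i : 'I_m => X i w <= x i) (enum 'I_m)).
    rewrite mem_set; last by move=> i /= im; have := h (Ordinal im); rewrite mem_enum; exact.
    by rewrite big1// => i _; rewrite h// mem_enum.
  rewrite memNset; last by move=> /(_ i (ltn_ord i))/=; exact/negP.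
  by rewrite (bigD1 i)//= (negbTE hi) mul0r.
have s0 : 0 < Num.sqrt (v j) by rewrite sqrtr_gt0.
set e := expR (- (\sum_(i < j) c i ^+ 2 * v i / 2)).
set p := \prod_(j.+1 <= i < m) gcdf i x.
have p0 : 0 <= p by apply: prodr_ge0.
have e01 : 0 < e <= 1.
  rewrite expR_gt0/= /e expRN invf_le1 ?expR_gt0// -expR0 ler_expR sumr_ge0// => i _.
  by rewrite divr_ge0// mulr_ge0 ?sqr_ge0// ltW.
(* Weights must be nonnegative, so 1 is added to the cosine; [E3] subtracts its contribution again
   by means of [E1]. *)
pose h1 phi w := (1 + cos (S c j w + phi)) * box j.+1 x w.
(* Letting only the bound of X_j vary turns the induction hypothesis into the distribution function
   of X_j under the weight. *)
pose xj y i := if i == j then y else x i.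
have boxj y w : box j (xj y) w = box j.+1 x w * (X j w <= y)%R%:R.
  rewrite boxS// /xj eqxx mulrC; congr (_ * _).
  by apply: eq_big_nat => i /andP[ji _]; rewrite gtn_eqF.
have gj y : \prod_(j <= i < m) gcdf i (xj y) = gcdf j (fun=> y) * p.
  rewrite big_ltn// /gcdf /xj eqxx; congr (_ * _).
  by apply: eq_big_nat => i /andP[ji _]; rewrite gtn_eqF.
have box1 y : Ex Q (fun w => box j.+1 x w * (X j w <= y)%R%:R) = gcdf j (fun=> y) * p.
  have := IH (fun=> 0) (xj y) 0 (ltnW jm).
  rewrite big1 ?oppr0 ?expR0 ?cos0 ?mul1r; last by move=> i _; rewrite expr0n/= !mul0r.
  rewrite gj => <-; apply: eq_Ex => w; rewrite boxj /S big1 ?add0r ?cos0 ?mul1r//.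
  by move=> i _; rewrite mul0r.
have E1 (g : R -> R) : measurable_fun setT g -> (exists C, forall y, `|g y| <= C) ->
    Ex Q (fun w => box j.+1 x w * g (X j w)) = p * Ex (normal_prob 0 (Num.sqrt (v j))) g.
  have b0 w : 0 <= box j.+1 x w by case/andP: (box01 j.+1 x w).
  have b1 w : box j.+1 x w <= 1 by case/andP: (box01 j.+1 x w).
  apply: (weighted_law (measurable_box j.+1 x) b0 b1) => // y.
  rewrite ray_integral//; last by move=> w; rewrite ger0_norm// (le_trans (b1 w))//; lra.
  by rewrite box1 mulrC EFinM; congr (_ * _)%E; exact: (gcdfE j (fun=> y)).
have E2 phi (g : R -> R) : measurable_fun setT g -> (exists C, forall y, `|g y| <= C) ->
    Ex Q (fun w => h1 phi w * g (X j w)) =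
    ((1 + cos phi * e) * p) * Ex (normal_prob 0 (Num.sqrt (v j))) g.
  have b0 w : 0 <= box j.+1 x w by case/andP: (box01 j.+1 x w).
  have b1 w : box j.+1 x w <= 1 by case/andP: (box01 j.+1 x w).
  have c0 w : 0 <= 1 + cos (S c j w + phi) by have := cos_geN1 (S c j w + phi); lra.
  have c2 w : 1 + cos (S c j w + phi) <= 2 by have := cos_le1 (S c j w + phi); lra.
  have mh : measurable_fun setT (h1 phi) by apply: measurable_funM => //; exact: measurable_funD.
  have h0 w : 0 <= h1 phi w by exact: mulr_ge0.
  have h2 w : h1 phi w <= 2 by rewrite -[leRHS]mulr1; exact: ler_pM.
  have ce0 : 0 <= (1 + cos phi * e) * p.
    rewrite mulr_ge0//; case/andP: e01 => e0 e1; have := cos_geN1 phi; nra.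
  apply: (weighted_law mh h0 h2) => // y.
  rewrite ray_integral//; last by move=> w; rewrite ger0_norm.
  rewrite -(gcdfE j (fun=> y)) -EFinM.
  congr EFin.
  rewrite (@eq_Ex _ _ _ _ _ (fun w => box j.+1 x w * (X j w <= y)%R%:R +
     cos (S c j w + phi) * box j (xj y) w)); last by move=> w; rewrite boxj /h1; ring.
  rewrite ExD; last 2 first.
  - apply: (@L1_bounded _ _ _ _ _ 1); first exact: measurable_funM.
    by move=> w; rewrite -boxj; have /andP[? ?] := box01 j (xj y) w; rewrite ger0_norm.
  - apply: (@L1_bounded _ _ _ _ _ 1); first exact: measurable_funM.
    move=> w; have /andP[? ?] := box01 j (xj y) w; rewrite normrM mulr_ile1 ?cos_max//.
    by rewrite ger0_norm.
  by rewrite box1 IH ?(ltnW jm)// gj -/e; ring.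
have E3 phi (g : R -> R) : measurable_fun setT g -> (forall y, `|g y| <= 1) ->
    L1 Q (fun w => cos (S c j w + phi) * box j.+1 x w * g (X j w)) /\
    Ex Q (fun w => cos (S c j w + phi) * box j.+1 x w * g (X j w)) =
    cos phi * e * p * Ex (normal_prob 0 (Num.sqrt (v j))) g.
  move=> mg g1.
  have L0 : L1 Q (fun w => box j.+1 x w * g (X j w)).
    apply: (@L1_bounded _ _ _ _ _ 1); first by apply: measurable_funM => //; exact: measurableT_comp.
    move=> w; have /andP[b0 b1] := box01 j.+1 x w.
    by rewrite normrM ger0_norm// mulr_ile1.
  have L2 : L1 Q (fun w => h1 phi w * g (X j w)).
    apply: (@L1_bounded _ _ _ _ _ 2).
      apply: measurable_funM; last exact: measurableT_comp.
      by apply: measurable_funM => //; exact: measurable_funD.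
    move=> w; have /andP[b0 b1] := box01 j.+1 x w; rewrite /h1 -mulrA normrM.
    rewrite -[leRHS]mulr1; apply: ler_pM => //.
      by apply: le_trans (ler_normD _ _) _; have := cos_max (S c j w + phi); rewrite normr1; lra.
    by rewrite normrM ger0_norm// mulr_ile1.
  have -> : (fun w => cos (S c j w + phi) * box j.+1 x w * g (X j w)) =
      (fun w => h1 phi w * g (X j w) - box j.+1 x w * g (X j w)).
    by apply/funext => w; rewrite /h1; ring.
  split; first exact: L1B.
  have gb : exists C, forall y, `|g y| <= C by exists 1.
  by rewrite ExB// E1// E2//; ring.
pose gc (th y : R) := cos (c j * y + th).
have mgc th : measurable_fun setT (gc th) by apply: measurable_phase; exact: continuous_cos.
have gc1 th y : `|gc th y| <= 1 by exact: cos_max.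
have [La Ea] := E3 theta (gc 0) (mgc 0) (gc1 0).
have [Lb Eb] := E3 (theta - pi / 2) (gc (- (pi / 2))) (mgc _) (gc1 _).
(* The formula cos (A + B) = cos A cos B - sin A sin B, both sines written as cosines shifted by pi
   / 2. The second expectation contains the factor cos (- pi / 2) = 0. *)
rewrite (@eq_Ex _ _ _ _ _ (fun w => cos (S c j w + theta) * box j.+1 x w * gc 0 (X j w) -
    cos (S c j w + (theta - pi / 2)) * box j.+1 x w * gc (- (pi / 2)) (X j w))); last first.
  move=> w; rewrite /gc /S big_ord_recr/= addr0 addrA !cosBpihalf.
  by rewrite (addrAC _ (c j * X j w)) (cosD _ (c j * X j w)); ring.
rewrite ExB// Ea Eb !(Ex_cos_normal s0) sqr_sqrtr ?ltW// cosN cos_pihalf cos0.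
rewrite big_ord_recr/= opprD expRD -/e mulrA; ring.
Qed.
End GaussianSequence.

(** * Riemann sums along continuous paths *)

Section RiemannSums.
Context {R : realType}.
Local Notation mu := (@lebesgue_measure R).

Lemma segment_unif_continuous (f : R -> R) (K e : R) : continuous f -> 0 < e ->
  exists2 r : R, 0 < r & forall x y, `|x| <= K -> `|y - x| < r -> `|f y - f x| <= e.
Proof.
move=> cf e0; pose g (z : 'rV[R]_1) := f (z ord0 ord0).
have cg : continuous g.
  move=> z; apply: (@continuous_comp _ _ _ (fun z : 'rV[R]_1 => z ord0 ord0) f); last exact: cf.
  exact: coord_continuous.
have [r r0 hr] := box_unif_continuous K cg e0.
exists r => // x y xK yx; have := hr (const_mx x) (const_mx y); rewrite /g !mxE.
by apply => i; rewrite !mxE.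
Qed.

(** Integration starts at -1 so that all of [0,1], including 0, is interior and the derivative is
    two-sided there. *)
Lemma continuous_primitive (f : R -> R) : continuous f ->
  exists F : R -> R, forall x : R, -1 < x -> is_derive x (1 : R) F (f x).
Proof.
move=> cf; exists (fun x => \int[mu]_(t in `[-1, x]) f t) => x x1.
have fi : mu.-integrable `[-1, x + 1] (EFin \o f).
  apply: continuous_compact_integrable; first exact: segment_compact.
  exact: continuous_subspaceT.
have xx : x < x + 1 by rewrite ltrDl.
have [d1 d2] := continuous_FTC1_closed xx fi x1 (cf x).
by apply: DeriveDef; [exact: d1|rewrite -derive1E; exact: d2].
Qed.

Lemma cvg_riemann_sum (f : R -> R) : continuous f ->
  exists l, (fun N : nat => N.+1%:R^-1 * \sum_(i < N.+1) f (i.+1%:R / N.+1%:R)) @ \oo --> (l : R).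
Proof.
move=> cf; have [F dF] := continuous_primitive cf.
exists (F 1 - F 0); apply/cvgrPdist_le => e e0.
have [r r0 hr] := segment_unif_continuous 1 cf e0.
have : \forall N \near \oo, N.+1%:R^-1 < r by apply: (cvgr_lt _ (@cvg_harmonic R)).
apply: filterS => N Nr.
have N0 : (0 : R) < N.+1%:R by [].
have -> : F 1 - F 0 = \sum_(i < N.+1) (F (i.+1%:R / N.+1%:R) - F (i%:R / N.+1%:R)).
  by rewrite -(big_mkord xpredT (fun i => F (i.+1%:R / N.+1%:R) - F (i%:R / N.+1%:R)))
     (telescope_sumr (fun i => F (i%:R / N.+1%:R)))// mul0r divff// gt_eqF.
rewrite mulr_sumr -sumrB; apply: le_trans (ler_norm_sum _ _ _) _.
have -> : e = \sum_(i < N.+1) (N.+1%:R^-1 * e).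
  by rewrite sumr_const card_ord -[RHS]mulr_natl mulVKf// gt_eqF.
apply: ler_sum => i _.
have ab : (i%:R / N.+1%:R : R) < i.+1%:R / N.+1%:R by rewrite ltr_pM2r ?invr_gt0// ltr_nat.
have a0 : (0 : R) <= i%:R / N.+1%:R by rewrite divr_ge0.
have b1 : (i.+1%:R / N.+1%:R : R) <= 1 by rewrite ler_pdivrMr// mul1r ler_nat.
have ba : i.+1%:R / N.+1%:R - i%:R / N.+1%:R = N.+1%:R^-1 :> R.
  by rewrite -mulrBl -natr1 addrAC subrr add0r mul1r.
have [c] : exists2 c, c \in `]i%:R / N.+1%:R, i.+1%:R / N.+1%:R[%R &
    F (i.+1%:R / N.+1%:R) - F (i%:R / N.+1%:R) = f c * (i.+1%:R / N.+1%:R - i%:R / N.+1%:R).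
  apply: MVT => //.
    by move=> x; rewrite in_itv/= => /andP[x0 _]; apply: dF; apply: lt_le_trans (ltW x0); apply: lt_le_trans a0; rewrite ltrN10.
  apply: derivable_within_continuous => x; rewrite in_itv/= => /andP[x0 _].
  have x1 : -1 < x by apply: lt_le_trans x0; apply: lt_le_trans a0; rewrite ltrN10.
  by have [] := dF x x1.
rewrite in_itv/= => /andP[c0 c1] ->.
rewrite ba mulrC -mulrBr normrM ger0_norm ?invr_ge0//; apply: ler_wpM2l; first by rewrite invr_ge0.
apply: hr; first by rewrite ger0_norm// divr_ge0.
move: Nr c0 c1; rewrite -ba distrC.
move: (i.+1%:R / _) (i%:R / _) => B A Nr c0 c1.
by rewrite ger0_norm; lra.
Qed.

Lemma cvg_dyadic (u : nat -> R) (l : R) : (fun N => u N.+1) @ \oo --> l ->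
  (fun n => u (2 ^ n)%N) @ \oo --> l.
Proof.
move=> ul; rewrite (_ : (fun n => u (2 ^ n)%N) = (fun N => u N.+1) \o (fun n => (2 ^ n).-1)); last first.
  by apply/funext => n /=; rewrite prednK// expn_gt0.
apply: cvg_comp ul; apply/cvgnyPge => A; near=> n.
have nA : (A <= n)%N by near: n; exact: nbhs_infty_ge.
by apply: leq_trans nA _; rewrite -ltnS prednK ?expn_gt0//; exact: ltn_expl.
Unshelve. all: by end_near. Qed.

(** Summation by parts turns the Stieltjes sums of t against W into W 1 minus a Riemann sum of the
    path W, which converges by continuity. So the limit in [wiener_int] exists on every path. *)
Lemma wiener_int_linear (m : R) (W : R -> R) : continuous W ->
  (fun n : nat => \sum_(i < 2 ^ n) m * (i%:R / (2 ^ n)%:R) *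
     (W (i.+1%:R / (2 ^ n)%:R) - W (i%:R / (2 ^ n)%:R))) @ \oo -->
  wiener_int (fun t => m * t) W.
Proof.
move=> cW; have [l hl] := cvg_riemann_sum cW.
suff : (fun n : nat => \sum_(i < 2 ^ n) m * (i%:R / (2 ^ n)%:R) *
     (W (i.+1%:R / (2 ^ n)%:R) - W (i%:R / (2 ^ n)%:R))) @ \oo --> m * (W 1 - l).
  by move=> h; rewrite /wiener_int (cvg_lim _ h).
apply: (@cvg_dyadic (fun N => \sum_(i < N) m * (i%:R / N%:R) *
     (W (i.+1%:R / N%:R) - W (i%:R / N%:R)))).
have E N : \sum_(i < N.+1) m * (i%:R / N.+1%:R) * (W (i.+1%:R / N.+1%:R) - W (i%:R / N.+1%:R)) =
    m * (W 1 - N.+1%:R^-1 * \sum_(i < N.+1) W (i.+1%:R / N.+1%:R)).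
  have N0 : (N.+1%:R : R) != 0 by rewrite pnatr_eq0.
  have -> : W 1 = N.+1%:R^-1 * \sum_(i < N.+1) (i.+1%:R * W (i.+1%:R / N.+1%:R) - i%:R * W (i%:R / N.+1%:R)).
    rewrite -(big_mkord xpredT (fun i => i.+1%:R * W (i.+1%:R / N.+1%:R) - i%:R * W (i%:R / N.+1%:R))).
    by rewrite (telescope_sumr (fun i => i%:R * W (i%:R / N.+1%:R)))// mul0r subr0 divff// mulKf.
  rewrite -mulrBr -sumrB !mulr_sumr; apply: eq_bigr => i _.
  have e : i.+1%:R = i%:R + 1 :> R by rewrite natr1.
  by move: (W (i.+1%:R / _)) (W (i%:R / _)) => A B; rewrite e; field.
under eq_fun do rewrite E.
by apply: cvgM (cvg_cst _) _; apply: cvgB (cvg_cst _) hl.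
Qed.
End RiemannSums.

Lemma big_ord_double (T : Type) (idx : T) (op : Monoid.law idx) n (F : nat -> T) :
  \big[op/idx]_(k < n.*2) F k = \big[op/idx]_(i < n) op (F i.*2) (F i.*2.+1).
Proof.
elim: n => [|n IH]; first by rewrite !big_ord0.
by rewrite doubleS !big_ord_recr/= IH Monoid.mulmA.
Qed.

(** * Characteristic function of the two Wiener integrals *)

Section WienerIntegral.
Context {R : realType} {d : measure_display} {T : measurableType d}.
Variables (Q : probability T R) (W1 W2 : R -> T -> R).
Hypothesis W12 : indep_std_wiener2 Q W1 W2.

Let inc (W : R -> T -> R) (N i : nat) w := W (i.+1%:R / N%:R) w - W (i%:R / N%:R) w.

(** The increments of both processes are interleaved into one sequence, those of [W1] at even and
    those of [W2] at odd indices, to which [Ex_cos_box] applies with all indices moved into the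
    cosine. *)
Lemma wiener_grid_cf N (a b : R) (f : nat -> R) theta :
  Ex Q (fun w => cos (\sum_(i < N.+1) f i * (a * inc W1 N.+1 i w + b * inc W2 N.+1 i w) + theta)) =
  cos theta * expR (- ((a ^+ 2 + b ^+ 2) / 2 * (N.+1%:R^-1 * \sum_(i < N.+1) f i ^+ 2))).
Proof.
have [_ [_ [mW cdf]]] := W12.
pose X k := inc (if odd k then W2 else W1) N.+1 k./2.
pose c k := f k./2 * (if odd k then b else a).
have mX k : measurable_fun setT (X k).
  by rewrite /X; case: odd; apply: measurable_funB; have [] := mW (k./2.+1%:R / N.+1%:R);
    have [] := mW (k./2%:R / N.+1%:R).
have v0 (k : nat) : 0 < N.+1%:R^-1 :> R by rewrite invr_gt0.
have incE i : i.+1%:R / N.+1%:R - i%:R / N.+1%:R = N.+1%:R^-1 :> R.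
  by rewrite -mulrBl -natr1 addrAC subrr add0r mul1r.
have joint (x : nat -> R) :
    Q (\bigcap_(k in [set k | (k < N.+1.*2)%N]) [set w | X k w <= x k]) =
    (\prod_(k < N.+1.*2) gauss_cdf N.+1%:R^-1 (x k))%E.
  rewrite (@big_ord_double _ _ _ _ (fun k => gauss_cdf N.+1%:R^-1 (x k))).
  have t0 : 0%:R / N.+1%:R = 0 :> R by rewrite mul0r.
  have ti i : (i < N.+1)%N -> i%:R / N.+1%:R < i.+1%:R / N.+1%:R :> R.
    by move=> _; rewrite ltr_pM2r ?invr_gt0// ltr_nat.
  have e := cdf N.+1 (fun i => i%:R / N.+1%:R) (fun i => x i.*2) (fun i => x i.*2.+1) t0 ti.
  rewrite (eq_bigr (fun i : 'I_N.+1 => gauss_cdf (i.+1%:R / N.+1%:R - i%:R / N.+1%:R) (x i.*2) *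
    gauss_cdf (i.+1%:R / N.+1%:R - i%:R / N.+1%:R) (x i.*2.+1))%E); last first.
    by move=> i _; rewrite (incE i).
  rewrite -e {e}; congr (Q _); apply/seteqP; split => w h.
    move=> i /= iN; split.
      have := h i.*2; rewrite /X/= odd_double doubleK ltn_double; exact.
    have := h i.*2.+1; rewrite /X/= odd_double/= uphalf_double.
    by apply; rewrite -doubleS leq_double.
  move=> k /= kN.
  have hk : (k./2 < N.+1)%N.
    by rewrite -ltn_double; apply: leq_ltn_trans kN; rewrite -{2}(odd_double_half k) leq_addl.
  have [h1 h2] := h _ hk; rewrite /X; have e := odd_double_half k.
  by case: (odd k) e => /= e; [rewrite add1n in e|rewrite add0n in e]; rewrite -{2}e.
have := @Ex_cos_box _ _ _ Q X (fun=> N.+1%:R^-1) N.+1.*2 mX v0 joint N.+1.*2 c (fun=> 0) theta (leqnn _).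
rewrite big_geq// mulr1 (@big_ord_double _ _ _ _ (fun k => c k ^+ 2 / N.+1%:R / 2)) => e.
rewrite [RHS](_ : _ = cos theta * expR (- (\sum_(i < N.+1) (c i.*2 ^+ 2 / N.+1%:R / 2 + c i.*2.+1 ^+ 2 / N.+1%:R / 2)))); last first.
  rewrite !mulr_sumr; do 3 congr (_ _); apply: eq_bigr => i _.
  by rewrite /c/= odd_double doubleK uphalf_double/=; ring.
rewrite -e; apply: eq_Ex => w; rewrite big_geq// mulr1 (@big_ord_double _ _ _ _ (fun k => c k * X k w)).
congr (cos (_ + _)); apply: eq_bigr => i _.
by rewrite /c /X/= odd_double doubleK uphalf_double/=; ring.
Qed.

Let continuous_path w : continuous (W1^~ w) /\ continuous (W2^~ w).
Proof. by have [_ [cW _]] := W12; exact: cW. Qed.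

Let measurable_inc N i : measurable_fun setT (inc W1 N i) /\ measurable_fun setT (inc W2 N i).
Proof.
have [_ [_ [mW _]]] := W12.
by split; apply: measurable_funB; have [] := mW (i.+1%:R / N%:R); have [] := mW (i%:R / N%:R).
Qed.

Lemma measurable_wiener_int m :
  measurable_fun setT (fun w => wiener_int (fun t => m * t) (W1^~ w)) /\
  measurable_fun setT (fun w => wiener_int (fun t => m * t) (W2^~ w)).
Proof.
split.
  apply: (@measurable_fun_cvg _ _ _ setT (fun n w => \sum_(i < 2 ^ n) m * (i%:R / (2 ^ n)%:R) * inc W1 (2 ^ n) i w)) => //.
    by move=> n; apply: measurable_sum => i; apply: measurable_funM => //; have [] := measurable_inc (2 ^ n) i.
  by move=> w _; apply: wiener_int_linear; have [] := continuous_path w.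
apply: (@measurable_fun_cvg _ _ _ setT (fun n w => \sum_(i < 2 ^ n) m * (i%:R / (2 ^ n)%:R) * inc W2 (2 ^ n) i w)) => //.
  by move=> n; apply: measurable_sum => i; apply: measurable_funM => //; have [] := measurable_inc (2 ^ n) i.
by move=> w _; apply: wiener_int_linear; have [] := continuous_path w.
Qed.

(** Bounded convergence along the dyadic sums. Their expectations are a subsequence of those on the
    grids of mesh 1/(N+1), where the sums of squares tend to m^2 / 3. *)
Lemma wiener_int_cf m a b theta :
  Ex Q (fun w => cos (a * wiener_int (fun t => m * t) (W1^~ w) +
    b * wiener_int (fun t => m * t) (W2^~ w) + theta)) =
  cos theta * expR (- ((a ^+ 2 + b ^+ 2) * m ^+ 2 / 6)).
Proof.
pose g N w := cos (\sum_(i < N) (m * (i%:R / N%:R)) * (a * inc W1 N i w + b * inc W2 N i w) + theta).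
have cosc : measurable_fun setT (cos : R -> R) by apply: continuous_measurable_fun; exact: continuous_cos.
have mg n : measurable_fun setT (g n).
  apply: (measurableT_comp (f := cos)) => //; apply: measurable_funD => //.
  apply: measurable_sum => i; apply: measurable_funM => //; have [? ?] := measurable_inc n i.
  by apply: measurable_funD; apply: measurable_funM.
have cg w : (fun n => g (2 ^ n)%N w) @ \oo --> cos (a * wiener_int (fun t => m * t) (W1^~ w) +
    b * wiener_int (fun t => m * t) (W2^~ w) + theta).
  apply: (continuous_cvg _ (@continuous_cos R _)); apply: cvgD (cvg_cst _).
  have [c1 c2] := continuous_path w.
  rewrite (_ : (fun n => _) = fun n : nat =>
    a * (\sum_(i < 2 ^ n) m * (i%:R / (2 ^ n)%:R) * inc W1 (2 ^ n) i w) +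
    b * (\sum_(i < 2 ^ n) m * (i%:R / (2 ^ n)%:R) * inc W2 (2 ^ n) i w)); last first.
    apply/funext => n; rewrite !mulr_sumr -big_split/=; apply: eq_bigr => i _; ring.
  by apply: cvgD; apply: cvgM (cvg_cst _) _; exact: wiener_int_linear.
have [_ cE] := Ex_bounded_cvg Q (fun n => mg (2 ^ n)%N) (fun n w => cos_max _) cg.
have : (fun N => Ex Q (g N.+1)) @ \oo --> cos theta * expR (- ((a ^+ 2 + b ^+ 2) * m ^+ 2 / 6)).
  under eq_fun => N do rewrite (wiener_grid_cf N a b (fun i => m * (i%:R / N.+1%:R))).
  apply: cvgM (cvg_cst _) _; apply: (continuous_cvg _ (@continuous_expR R _)); apply: cvgN.
  rewrite (_ : (_ + _) * _ / 6 = (a ^+ 2 + b ^+ 2) / 2 * (m ^+ 2 * 3^-1)); last by field.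
  apply: cvgM (cvg_cst _) _.
  rewrite (_ : (fun N : nat => _) = fun N : nat => m ^+ 2 * (hh N.+1 * \sum_(j < N.+1) tk N.+1 j ^+ 2)); last first.
    apply/funext => N; rewrite mulrCA /hh; congr (_ * _); rewrite mulr_sumr.
    by apply: eq_bigr => i _; rewrite exprMn.
  by apply: cvgM (cvg_cst _) _; exact: cvg_sum_tk2.
move/(@cvg_dyadic _ (fun N => Ex Q (g N))) => cE'.
exact: (cvg_unique _ cE cE').
Qed.

End WienerIntegral.

(** * The limit theorem *)

Section ProcessLimit.
Context {R : realType} {d d' : measure_display} {T : measurableType d} {T' : measurableType d'}.
Variables (P : probability T R) (Q : probability T' R).
Variables (xi : nat -> nat -> bool -> T -> nat * nat) (eps : nat -> T -> nat * nat).
Variables alpha beta : R.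
Hypothesis mxi : forall k j i, discrete_rv (xi k j i).
Hypothesis meps : forall k, discrete_rv (eps k).
Hypothesis indY : mutually_indep P (fun I : (nat * nat * bool + nat)%type =>
  match I with inl (k, j, i) => xi k j i | inr k => eps k end).
Hypothesis xi_law : forall k j i v,
  P [set w | xi k j i w = v] = P [set w | xi 0%N 0%N i w = v].
Hypothesis eps_law : forall k v,
  P [set w | eps k w = v] = P [set w | eps 0%N w = v].
Hypothesis xi_unit : forall k j i w, ((xi k j i w).1 + (xi k j i w).2)%N = 1%N.
Hypotheses (alpha_gt0 : 0 < alpha) (beta_gt0 : 0 < beta).
Hypothesis alphaDbeta : alpha + beta = 1.
Hypothesis xi_mean : forall i,
  Ex P (fun w => (xi 0%N 0%N i w).1%:R) = if i then beta else alpha.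
Hypothesis eps8 : L1 P (fun w => ((eps 0%N w).1%:R + (eps 0%N w).2%:R) ^+ 8).
Variables Wt Wtt : R -> T' -> R.
Hypothesis W12 : indep_std_wiener2 Q Wt Wtt.

Local Notation m := (mU P eps).

Lemma measurable_process_sums n :
  [/\ measurable_fun setT (SA xi eps n : T -> R), measurable_fun setT (SB xi eps n : T -> R),
      measurable_fun setT (SC P xi eps n) & measurable_fun setT (SD P xi eps alpha beta n)].
Proof.
have mu j : measurable_fun setT (uh xi eps n j : T -> R).
  by apply: measurable_funM => //; exact: (UU_measurable P alpha beta mxi meps xi_unit).
have mv j : measurable_fun setT (vh xi eps n j : T -> R).
  by apply: measurable_funM => //; exact: (VV_measurable P alpha beta mxi meps xi_unit).
have ma j : measurable_fun setT (incU P eps j).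
  by apply: (known_mfun mxi meps); exact: (@known_incU _ _ _ _ _ _ j).
have mb j : measurable_fun setT (dh P xi eps alpha beta n j).
  by apply: (known_mfun mxi meps); exact: known_dh.
split; apply: measurable_funM => //; apply: measurable_sum => j.
- exact: measurable_funX.
- exact: measurable_funX.
- exact: measurable_funM.
- exact: measurable_funM.
Qed.

Lemma process_cvg_dist :
  cvg_dist P (fun n w => row4 (SA xi eps n.+1 w) (SB xi eps n.+1 w) (SC P xi eps n.+1 w)
      (SD P xi eps alpha beta n.+1 w))
    Q (fun w => row4 (m ^+ 2 / 3) (m / 2)
      (Num.sqrt (s2U P eps) * wiener_int (fun t => m * t) (Wtt^~ w))
      (Num.sqrt (gam alpha beta) * wiener_int (fun t => m * t) (Wt^~ w))).
Proof.
move=> g cg gb.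
have row4E (q : 'I_4 -> R) (a b c e theta : R) :
    \sum_i q i * row4 a b c e ord0 i + theta =
    q 0 * a + q 1 * b + q 2 * c + q 3 * e + theta.
  by rewrite !big_ord_recr big_ord0/= !mxE/= add0r; congr (_ * _ + _ * _ + _ * _ + _ * _ + _); congr (q _); apply/val_inj.
have i4 (Pr : 'I_4 -> Prop) : Pr 0 -> Pr 1 -> Pr 2 -> Pr 3 -> forall i, Pr i.
  move=> h0 h1 h2 h3 [[|[|[|[|//]]]] hi].
  - by rewrite (_ : Ordinal hi = 0) //; apply/val_inj.
  - by rewrite (_ : Ordinal hi = 1) //; apply/val_inj.
  - by rewrite (_ : Ordinal hi = 2) //; apply/val_inj.
  - by rewrite (_ : Ordinal hi = 3) //; apply/val_inj.
have [K hK] := process_tight mxi meps indY xi_law eps_law xi_unit alpha_gt0 beta_gt0 alphaDbeta xi_mean eps8.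
(* The 1 allows the estimate |x| <= 1 + x^2 for the last two coordinates. The index is n + 1 because
   the scalings require a positive number of generations. *)
pose tight n w := 1 + (SA xi eps n.+1 w + SB xi eps n.+1 w + SC P xi eps n.+1 w ^+ 2 +
  SD P xi eps alpha beta n.+1 w ^+ 2).
have SA0 n w : 0 <= SA xi eps n w :> R.
  by rewrite mulr_ge0 ?hh_ge0// sumr_ge0// => j _; exact: sqr_ge0.
have SB0 n w : 0 <= SB xi eps n w :> R.
  by rewrite mulr_ge0 ?hh_ge0// sumr_ge0// => j _; exact: sqr_ge0.
apply: (@portmanteau _ _ _ _ _ _ P Q _ _ _ _ _ tight (1 + K)) => //.
- move=> n; have [mA mB mC mD] := measurable_process_sums n.+1.
  by apply: i4; under eq_fun do rewrite mxE/=.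
- have [mt mtt] := measurable_wiener_int W12 m.
  by apply: i4; under eq_fun do rewrite mxE/=; try exact: measurable_cst; exact: measurable_funM.
- move=> q theta; under eq_fun => n do under eq_Ex do rewrite row4E.
  under eq_Ex do rewrite row4E.
  rewrite (@eq_Ex _ _ _ _ _ (fun w => cos (q 3 * Num.sqrt (gam alpha beta) * wiener_int (fun t => m * t) (Wt^~ w) +
      q 2 * Num.sqrt (s2U P eps) * wiener_int (fun t => m * t) (Wtt^~ w) +
      (q 0 * (m ^+ 2 / 3) + q 1 * (m / 2) + theta)))); last by move=> w; congr cos; ring.
  rewrite (wiener_int_cf W12) !exprMn !sqr_sqrtr; last 2 first.
  - exact: s2U_ge0.
  - by apply: ltW; exact: gam_gt0.
  rewrite (_ : _ * m ^+ 2 = rho P eps alpha beta (q 2) (q 3)); last by rewrite rho_sqr; ring.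
  exact: process_cf.
- by move=> n; apply: L1D (L1_cst _ _) _; have [] := hK n.+1.
- by move=> n; have [h1 h2] := hK n.+1; rewrite ExD ?Ex_cst ?lerD2l//; exact: L1_cst.
- by move=> n w; rewrite !addr_ge0 ?sqr_ge0.
- move=> n w; have a0 := SA0 n.+1 w; have b0 := SB0 n.+1 w.
  have nle (x : R) : `|x| <= 1 + x ^+ 2 by exact: norm_le_sqr.
  have c0 := sqr_ge0 (SC P xi eps n.+1 w); have d0 := sqr_ge0 (SD P xi eps alpha beta n.+1 w).
  have c1 := nle (SC P xi eps n.+1 w); have d1 := nle (SD P xi eps alpha beta n.+1 w).
  by apply: i4; rewrite mxE/= /tight ?(ger0_norm a0) ?(ger0_norm b0); lra.
Qed.
End ProcessLimit.

(** * Covariance forms as variances of linear combinations *)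

Section SecondMoments.
Context {R : realType} {d : measure_display} {T : measurableType d}.
Variables (P : probability T R) (X : T -> nat * nat).
Hypothesis mX : discrete_rv X.

Definition sqnorm (v : nat * nat) : R := v.1%:R ^+ 2 + v.2%:R ^+ 2.

Hypothesis L8 : L1 P (fun w => sqnorm (X w) ^+ 4).

(** [sqnorm v] is a natural number, hence 0 or at least 1. *)
Lemma sqnorm_le4 v : sqnorm v <= sqnorm v ^+ 4.
Proof.
rewrite /sqnorm -!natrX -natrD; case: (_ + _)%N => [|k]; first by rewrite expr0n.
by apply: ler_eXnr => //; rewrite ler1n.
Qed.

Lemma L1_moment8 (f : nat * nat -> R) C : (forall v, `|f v| <= C * sqnorm v ^+ 4) ->
  L1 P (fun w => f (X w)).
Proof.
move=> fC; apply: (L1_le _ (L1Z C L8)) => [|w]; last exact: fC.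
exact: (measurable_atoms_comp (F := fun v _ => f v) mX (fun=> measurable_cst _)).
Qed.

Lemma natr_le_sqr (k : nat) : (k%:R : R) <= k%:R ^+ 2.
Proof. by case: k => [|k]; rewrite ?expr0n//; apply: ler_eXnr => //; rewrite ler1n. Qed.

Let comp (v : nat * nat) i : R := cmp i v.

Let comp_le i v : `|comp v i| <= 1 * sqnorm v ^+ 4.
Proof.
rewrite mul1r; apply: le_trans (sqnorm_le4 v); rewrite /comp /cmp /sqnorm.
by case: ifP => _; rewrite ger0_norm//; apply: le_trans (natr_le_sqr _) _;
  rewrite ?lerDl ?lerDr sqr_ge0.
Qed.

Let comp2_le i j v : `|comp v i * comp v j| <= 1 * sqnorm v ^+ 4.
Proof.
rewrite mul1r; apply: le_trans (sqnorm_le4 v); rewrite /comp /cmp /sqnorm.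
have := ler0n R v.1; have := ler0n R v.2; move: (v.1%:R : R) (v.2%:R : R) => a b b0 a0.
have a2 := sqr_ge0 a; have b2 := sqr_ge0 b; have ab := sqr_ge0 (a - b); rewrite sqrrB in ab.
by case: ifP => _; case: ifP => _; rewrite ger0_norm ?mulr_ge0//; lra.
Qed.

Lemma L1_cmp i : L1 P (fun w => cmp i (X w) : R).
Proof. exact: (L1_moment8 (f := fun v => comp v i) (comp_le i)). Qed.

(** Applied with c = 1 for [vec1] and c = -1 for [util]: the form is the variance of the sum or of
    the difference of the coordinates. *)
Lemma qf_covmx (c : R) (u : 'cV[R]_2) : u ord0 ord0 = 1 -> u ord_max ord0 = c ->
  qf (covmx P X) u = Ex P (fun w => ((X w).1%:R + c * (X w).2%:R) ^+ 2) -
    Ex P (fun w => (X w).1%:R + c * (X w).2%:R) ^+ 2.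
Proof.
move=> u0 u1.
have L := L1_cmp.
have LL i j : L1 P (fun w => cmp i (X w) * cmp j (X w) : R).
  exact: (L1_moment8 (f := fun v => comp v i * comp v j) (comp2_le i j)).
rewrite (@eq_Ex _ _ _ _ _ (fun w => cmp ord0 (X w) * cmp ord0 (X w) +
   (2 * c * (cmp ord0 (X w) * cmp ord_max (X w)) + c ^+ 2 * (cmp ord_max (X w) * cmp ord_max (X w))))); last first.
  by move=> w; rewrite /cmp/=; ring.
rewrite (@eq_Ex _ _ _ _ (fun w => (X w).1%:R + _) (fun w => cmp ord0 (X w) + c * cmp ord_max (X w))); last first.
  by move=> w.
do ?rewrite ExD; do ?[exact: L|exact: LL|apply: L1D|apply: L1Z].
rewrite !ExZ//.
rewrite /qf mxE !big_ord_recr big_ord0/= !mxE !big_ord_recr !big_ord0/= !mxE.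
rewrite (_ : widen_ord _ ord_max = ord0); last exact/val_inj.
rewrite u0 u1 /cov; set e01 := Ex P (fun w => cmp ord0 (X w) * cmp ord_max (X w)).
rewrite (@eq_Ex _ _ _ _ (fun w => cmp ord_max (X w) * cmp ord0 (X w)) (fun w => cmp ord0 (X w) * cmp ord_max (X w))).
  by rewrite -/e01; ring.
by move=> w; rewrite mulrC.
Qed.

End SecondMoments.

Lemma qf_avg {R : realType} (A B : 'M[R]_2) u : qf (2^-1 *: (A + B)) u = (qf A u + qf B u) / 2.
Proof.
by rewrite /qf -scalemxAr -scalemxAl mulmxDr mulmxDl !mxE mulrC.
Qed.

Lemma inner2 {R : realType} (u v : 'cV[R]_2) :
  (u^T *m v) ord0 ord0 = u ord0 ord0 * v ord0 ord0 + u ord_max ord0 * v ord_max ord0.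
Proof.
rewrite mxE !big_ord_recr big_ord0/= add0r !mxE.
by rewrite (_ : widen_ord _ ord_max = ord0)//; exact/val_inj.
Qed.

Lemma row4_sum {R : realType} n (a b c e : nat -> R) :
  \sum_(1 <= k < n.+1) row4 (a k) (b k) (c k) (e k) =
  row4 (\sum_(j < n) a j.+1) (\sum_(j < n) b j.+1) (\sum_(j < n) c j.+1) (\sum_(j < n) e j.+1).
Proof.
rewrite big_add1 big_mkord/=; apply/rowP => i; rewrite summxE mxE.
by case: i => [[|[|[|[|//]]]] hi]; apply: eq_bigr => j _; rewrite mxE.
Qed.

Lemma powR_scalings {R : realType} n : [/\ n.+1%:R `^ (- 3%:R) = hh n.+1 ^+ 3 :> R,
  n.+1%:R `^ (- 2%:R) = hh n.+1 ^+ 2 :> R &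
  n.+1%:R `^ (- (3%:R / 2%:R)) = hh n.+1 * gg n.+1 :> R].
Proof.
have n0 : (0 : R) < n.+1%:R by [].
rewrite !powRN !powR_mulrn// /hh !exprVn; split => //.
rewrite (_ : 3%:R / 2%:R = 1 + 2^-1 :> R); last by field.
rewrite powRD ?gt_eqF ?implybT//.
by rewrite powRr1// powR12_sqrt// /gg /hh sqrtrV// invfM.
Qed.

Lemma integral01_derive {R : realType} (F f : R -> R) : continuous f ->
  (forall x : R, is_derive x (1 : R) F (f x)) ->
  fine (\int[lebesgue_measure]_(t in `[0%R, 1%R]) (f t)%:E)%E = F 1 - F 0.
Proof.
move=> cf dF; rewrite (@continuous_FTC2 _ f F 0 1)//.
- exact: continuous_subspaceT.
- have cF x : {for x, continuous F}.
    by apply: differentiable_continuous; apply/derivable1_diffP; have [] := dF x.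
  split; first by move=> x _; have [] := dF x.
  + by apply: cvg_at_right_filter; exact: cF.
  + by apply: cvg_at_left_filter; exact: cF.
- by move=> x _; rewrite derive1E; have [] := dF x.
Qed.

Lemma integral_sqr_linear {R : realType} (m : R) :
  fine (\int[lebesgue_measure]_(t in `[0%R, 1%R]) ((m * t) ^+ 2)%:E)%E = m ^+ 2 / 3.
Proof.
have c : continuous (fun t : R => (m * t) ^+ 2).
  by move=> x; apply: (@continuous_comp _ _ _ ( *%R m) (fun y => y ^+ 2)); [exact: mulrl_continuous|exact: exprn_continuous].
have dF (x : R) : is_derive x (1 : R) (fun t => m ^+ 2 / 3 * t ^+ 3) ((m * x) ^+ 2).
  by apply: is_derive_eq; rewrite /GRing.scale/=; field.
by rewrite (integral01_derive c dF) expr1n expr0n/=; ring.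
Qed.

Lemma integral_linear {R : realType} (m : R) :
  fine (\int[lebesgue_measure]_(t in `[0%R, 1%R]) (m * t)%:E)%E = m / 2.
Proof.
have c : continuous (fun t : R => m * t).
  exact: mulrl_continuous.
have dF (x : R) : is_derive x (1 : R) (fun t => m / 2 * t ^+ 2) (m * x).
  by apply: is_derive_eq; rewrite /GRing.scale/=; field.
by rewrite (integral01_derive c dF) expr1n expr0n/=; ring.
Qed.

(** * Reduction to exactly one child per individual *)

Section Unitize.
Context {R : realType} {d : measure_display} {T : measurableType d}.
Variable P : probability T R.

Lemma measure_eq_off_null (A B N : set T) : measurable A -> measurable B -> measurable N ->
  P N = 0%E -> (forall w, ~ N w -> (A w <-> B w)) -> P A = P B.
Proof.
move=> mA mB mN N0 AB.
have off C : measurable C -> P C = P (C `\` N).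
  move=> mC; rewrite (measureDI P mC mN) [X in (_ + X)%E](_ : _ = 0%E) ?adde0//.
  apply/eqP; rewrite eq_le measure_ge0 andbT -N0.
  by apply: le_measure; rewrite ?inE//; exact: measurableI.
rewrite (off A)// (off B)//; congr (P _); apply/seteqP.
by split => w [Cw Nw]; split => //; apply/AB.
Qed.

(** The form is E (s - 1)^2 for the integer total s, whose mean is 1; where s differs from 1, the
    square is at least 1 and dominates the indicator. Nonnegativity is included because the theorem
    gives zero only for the average over the two types. *)
Lemma qf_vec1_unit (X : T -> nat * nat) : discrete_rv X ->
  L1 P (fun w => sqnorm (X w) ^+ 4 : R) ->
  Ex P (fun w => (X w).1%:R) + Ex P (fun w => (X w).2%:R) = 1 ->
  0 <= qf (covmx P X) vec1 /\
  (qf (covmx P X) vec1 = 0 -> P [set w | ((X w).1 + (X w).2)%N != 1%N] = 0%E).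
Proof.
move=> mX L8 E1.
have le4 (v : nat * nat) : sqnorm v <= sqnorm v ^+ 4 :> R := sqnorm_le4 v.
pose s (v : nat * nat) : R := v.1%:R + v.2%:R.
have Lc := L1_cmp mX L8.
have L1s : L1 P (fun w => s (X w)) by exact: (L1D (Lc ord0) (Lc ord_max)).
have L2s : L1 P (fun w => s (X w) ^+ 2).
  apply: (L1_moment8 mX L8 (f := fun v => s v ^+ 2) (C := 2)) => v.
  apply: le_trans (ler_wpM2l _ (le4 v)) => //.
  rewrite ger0_norm ?sqr_ge0// /s /sqnorm.
  by have := sqr_ge0 (v.1%:R - v.2%:R : R); rewrite sqrrB sqrrD; lra.
have Es : Ex P (fun w => s (X w)) = 1 by rewrite -E1; exact: (ExD (Lc ord0) (Lc ord_max)).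
have qE : qf (covmx P X) vec1 = Ex P (fun w => (s (X w) - 1) ^+ 2).
  rewrite (qf_covmx mX L8 (c := 1)) ?mxE//.
  rewrite (@eq_Ex _ _ _ _ _ (fun w => s (X w) ^+ 2)); last by move=> w; rewrite mul1r.
  rewrite (@eq_Ex _ _ _ _ (fun w => _ + 1 * _) (fun w => s (X w))); last by move=> w; rewrite mul1r.
  rewrite (@eq_Ex _ _ _ _ (fun w => (_ - 1) ^+ 2) (fun w => s (X w) ^+ 2 + ((-2) * s (X w) + 1))); last first.
    by move=> w; ring.
  have L3 := L1Z (-2) L1s; have L4 := L1D L3 (L1_cst P 1).
  by rewrite (ExD L2s L4) (ExD L3 (L1_cst P 1)) (ExZ _ L1s) Ex_cst Es; ring.
have LE : L1 P (fun w => (s (X w) - 1) ^+ 2).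
  rewrite (_ : (fun w => _) = fun w => s (X w) ^+ 2 + ((-2) * s (X w) + 1)); last first.
    by apply/funext => w; ring.
  by apply: L1D => //; apply: L1D; [exact: L1Z|exact: L1_cst].
rewrite qE; split; first by apply: Ex_ge0 => w; exact: sqr_ge0.
move=> E0; set A := [set w | _].
have mA : measurable A.
  have mf : measurable_fun setT (fun w => ((X w).1 + (X w).2)%N != 1%N).
    exact: (measurable_atoms_comp (F := fun v _ => (v.1 + v.2)%N != 1%N) mX (fun=> measurable_cst _)).
  have := mf measurableT [set true] I; rewrite setTI.
  by congr (measurable _); apply/seteqP; split => w /=; case: eqP.
apply/eqP; rewrite eq_le measure_ge0 andbT -[X in (_ <= X)%E]/(0%:E) -E0 -integral_Ex//.
rewrite -[X in (P X <= _)%E](setIT A) -integral_indic//.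
apply: ge0_le_integral => //.
- by apply/measurable_EFinP; exact: measurable_indic.
- by apply/measurable_EFinP; exact: (L1_measurable LE).
- move=> w _; rewrite lee_fin indicE; case: (boolP (w \in A)) => [|_]; last exact: sqr_ge0.
  rewrite inE /A/= /s -natrD; case: (_ + _)%N => [|[|k]] // _; first by rewrite sub0r sqrrN expr1n.
  by rewrite -[k.+2%:R]natr1 addrK -natrX ler1n expn_gt0.
Qed.

(* Applied to the offspring vectors, this changes them only on a null event. *)
Definition unitize (v : nat * nat) : nat * nat := if (v.1 + v.2)%N == 1%N then v else (1, 0)%N.

Lemma unitize_unit v : ((unitize v).1 + (unitize v).2)%N = 1%N.
Proof. by rewrite /unitize; case: eqP. Qed.

Lemma discrete_unitize (X : T -> nat * nat) : discrete_rv X -> discrete_rv (fun w => unitize (X w)).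
Proof.
move=> mX v.
have mf : measurable_fun setT (fun w => unitize (X w) == v).
  exact: (measurable_atoms_comp (F := fun u _ => unitize u == v) mX (fun=> measurable_cst _)).
have := mf measurableT [set true] I; rewrite setTI.
by congr (measurable _); apply/seteqP; split => w /=; [move/eqP|move=> ->; rewrite eqxx].
Qed.

Lemma Xproc_unitize (xi : nat -> nat -> bool -> T -> nat * nat) (eps : nat -> T -> nat * nat) k w :
  (forall k j i, unitize (xi k j i w) = xi k j i w) ->
  Xproc (fun k j i w => unitize (xi k j i w)) eps k w = Xproc xi eps k w.
Proof.
move=> h; elim: k => //= k ->.
by congr (_ + _ + _, _ + _ + _)%N; apply: eq_bigr => j _; rewrite h.
Qed.

End Unitize.

Lemma discrete_of_cmp {R : realType} {d : measure_display} {T : measurableType d} (X : T -> nat * nat) :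
  measurable_fun setT (fun w => (X w).1%:R : R) -> measurable_fun setT (fun w => (X w).2%:R : R) ->
  discrete_rv X.
Proof.
move=> m1 m2 v.
have h1 := m1 measurableT _ (measurable_set1 (v.1%:R : R)); rewrite setTI in h1.
have h2 := m2 measurableT _ (measurable_set1 (v.2%:R : R)); rewrite setTI in h2.
rewrite (_ : [set w | X w = v] = (fun w => (X w).1%:R : R) @^-1` [set v.1%:R] `&`
    (fun w => (X w).2%:R : R) @^-1` [set v.2%:R]); first exact: measurableI.
apply/seteqP; split => w /=; first by move=> ->.
move=> [/eqP + /eqP]; rewrite !eqr_nat => /eqP e1 /eqP e2.
by rewrite [LHS]surjective_pairing e1 e2 -surjective_pairing.
Qed.

Lemma discrete_Xproc {R : realType} {d : measure_display} {T : measurableType d}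
    (xi : nat -> nat -> bool -> T -> nat * nat) (eps : nat -> T -> nat * nat) k :
  (forall k j i, discrete_rv (xi k j i)) -> (forall k, discrete_rv (eps k)) ->
  discrete_rv (Xproc xi eps k).
Proof.
move=> mxi meps.
have mf (X : T -> nat * nat) (f : nat * nat -> R) : discrete_rv X -> measurable_fun setT (fun w => f (X w)).
  by move=> mX; exact: (measurable_atoms_comp (F := fun v _ => f v) mX (fun=> measurable_cst _)).
elim: k => [|k IH].
  move=> v; have [<-|ne] := pselect ((0, 0)%N = v).
    by rewrite (_ : [set _ | _] = setT)//; apply/seteqP; split.
  by rewrite (_ : [set _ | _] = set0)//; apply/seteqP; split.
apply: (@discrete_of_cmp R).
- pose F (x : nat * nat) w : R := \sum_(j < x.1) (xi k j false w).1%:R +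
    \sum_(j < x.2) (xi k j true w).1%:R + (eps k w).1%:R.
  rewrite (_ : (fun w => _) = fun w => F (Xproc xi eps k w) w); last first.
    by apply/funext => w; rewrite /= !natrD !natr_sum.
  apply: measurable_atoms_comp IH _ => x; apply: measurable_funD; last exact: (mf _ (fun v => v.1%:R)).
  by apply: measurable_funD; apply: measurable_sum => j; exact: (mf _ (fun v => v.1%:R)).
- pose F (x : nat * nat) w : R := \sum_(j < x.1) (xi k j false w).2%:R +
    \sum_(j < x.2) (xi k j true w).2%:R + (eps k w).2%:R.
  rewrite (_ : (fun w => _) = fun w => F (Xproc xi eps k w) w); last first.
    by apply/funext => w; rewrite /= !natrD !natr_sum.
  apply: measurable_atoms_comp IH _ => x; apply: measurable_funD; last exact: (mf _ (fun v => v.2%:R)).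
  by apply: measurable_funD; apply: measurable_sum => j; exact: (mf _ (fun v => v.2%:R)).
Qed.

Lemma measurable_row4 {R : realType} {d : measure_display} {T : measurableType d} (a b c e : T -> R) :
  measurable_fun setT a -> measurable_fun setT b -> measurable_fun setT c -> measurable_fun setT e ->
  forall i, measurable_fun setT (fun w => row4 (a w) (b w) (c w) (e w) ord0 i).
Proof. by move=> ma mb mc me [[|[|[|[|//]]]] hi]; under eq_fun do rewrite mxE/=. Qed.

Theorem theorem4p2 (R : realType) (d : measure_display) (Om : measurableType d)
  (P : probability Om R)
  (xi : nat -> nat -> bool -> Om -> nat * nat) (eps : nat -> Om -> nat * nat)
  (alpha beta : R) :
  (forall k j i, discrete_rv (xi k j i)) ->
  (forall k, discrete_rv (eps k)) ->
  mutually_indep P (fun I : (nat * nat * bool + nat)%type =>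
    match I with inl (k, j, i) => xi k j i | inr k => eps k end) ->
  (forall k j i v, P [set w | xi k j i w = v] = P [set w | xi 0%N 0%N i w = v]) ->
  (forall k v, P [set w | eps k w = v] = P [set w | eps 0%N w = v]) ->
  0 < alpha -> alpha < 1 -> 0 < beta -> beta < 1 -> alpha + beta = 1 ->
  (\int[P]_w (cmp ord0 (xi 0%N 0%N false w))%:E = alpha%:E)%E ->
  (\int[P]_w (cmp ord_max (xi 0%N 0%N false w))%:E = beta%:E)%E ->
  (\int[P]_w (cmp ord0 (xi 0%N 0%N true w))%:E = beta%:E)%E ->
  (\int[P]_w (cmp ord_max (xi 0%N 0%N true w))%:E = alpha%:E)%E ->
  (forall i, (\int[P]_w (((cmp ord0 (xi 0%N 0%N i w)) ^+ 2
                         + (cmp ord_max (xi 0%N 0%N i w)) ^+ 2) ^+ 4)%:E < +oo)%E) ->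
  (\int[P]_w (((cmp ord0 (eps 0%N w)) ^+ 2
               + (cmp ord_max (eps 0%N w)) ^+ 2) ^+ 4)%:E < +oo)%E ->
  let meps : 'cV[R]_2 := \col_(i < 2) Ex P (fun w => cmp i (eps 0%N w)) in
  meps != 0 ->
  let mxi : 'M[R]_2 := \matrix_(i < 2, j < 2) (if i == j then alpha else beta) in
  let Vxibar : 'M[R]_2 :=
    2^-1 *: (covmx P (xi 0%N 0%N false) + covmx P (xi 0%N 0%N true)) in
  let Veps : 'M[R]_2 := covmx P (eps 0%N) in
  qf Vxibar vec1 = 0 ->
  let inner (u v : 'cV[R]_2) : R := (u^T *m v) ord0 ord0 in
  let Xv (k : nat) (w : Om) : 'cV[R]_2 := \col_(i < 2) cmp i (Xproc xi eps k w) in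
  let M (k : nat) (w : Om) : 'cV[R]_2 := Xv k w - mxi *m Xv k.-1 w - meps in
  let U (k : nat) (w : Om) : R := inner vec1 (Xv k w) in
  let V (k : nat) (w : Om) : R := inner util (Xv k w) in
  let Zn (n : nat) (w : Om) : 'rV[R]_4 :=
    \sum_(1 <= k < n.+1)
      row4 (n%:R `^ (- 3%:R) * U k.-1 w ^+ 2)
           (n%:R `^ (- 2%:R) * V k.-1 w ^+ 2)
           (n%:R `^ (- (3%:R / 2%:R)) * inner vec1 (M k w) * U k.-1 w)
           (n%:R `^ (- (3%:R / 2%:R)) * inner util (M k w) * V k.-1 w) in
  let Y (t : R) : R := inner vec1 meps * t in
  forall (d' : measure_display) (Om' : measurableType d') (Q : probability Om' R)
         (Wt Wtt : R -> Om' -> R),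
  indep_std_wiener2 Q Wt Wtt ->
  let Z (w : Om') : 'rV[R]_4 :=
    row4 (fine (\int[lebesgue_measure]_(t in `[0%R, 1%R]) (Y t ^+ 2)%:E)%E)
         (qf Vxibar util / (4%:R * alpha * beta)
            * fine (\int[lebesgue_measure]_(t in `[0%R, 1%R]) (Y t)%:E)%E)
         (Num.sqrt (qf Veps vec1) * wiener_int Y (fun t => Wtt t w))
         (qf Vxibar util / (2%:R * Num.sqrt (alpha * beta))
            * wiener_int Y (fun t => Wt t w)) in
  cvg_dist P Zn Q Z.
Proof.
move=> mxi meps indY xi_law eps_law al0 al1 be0 be1 alb E00 E01 E10 E11 X8 e8 mu_eps mu_eps0
  mx Vxibar Veps V0 inner Xv M U V Zn Y d' Om' Q Wt Wtt W12 Z.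
have L8 (X : Om -> nat * nat) : discrete_rv X ->
    (\int[P]_w (((cmp ord0 (X w)) ^+ 2 + (cmp ord_max (X w)) ^+ 2) ^+ 4)%:E < +oo)%E ->
    L1 P (fun w => sqnorm (X w) ^+ 4 : R).
  move=> mX Xf; apply: L1_ge0P => // [|w]; last by rewrite exprn_ge0// addr_ge0 ?sqr_ge0.
  exact: (measurable_atoms_comp (F := fun v _ => sqnorm v ^+ 4) mX (fun=> measurable_cst _)).
have X8' i := L8 _ (mxi 0%N 0%N i) (X8 i).
have e8' := L8 _ (meps 0%N) e8.
have mean i : Ex P (fun w => (xi 0%N 0%N i w).1%:R) = (if i then beta else alpha) /\
    Ex P (fun w => (xi 0%N 0%N i w).2%:R) = (if i then alpha else beta).
  by case: i; split; rewrite /Ex; [rewrite E10|rewrite E11|rewrite E00|rewrite E01].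
have [qf0 qf1] := qf_vec1_unit (mxi 0%N 0%N false) (X8' false)
  (ltac:(by have [-> ->] := mean false)).
have [qt0 qt1] := qf_vec1_unit (mxi 0%N 0%N true) (X8' true)
  (ltac:(by have [-> ->] := mean true; rewrite addrC)).
have null0 i : P [set w | ((xi 0%N 0%N i w).1 + (xi 0%N 0%N i w).2)%N != 1%N] = 0%E.
  have h : qf (covmx P (xi 0%N 0%N false)) vec1 + qf (covmx P (xi 0%N 0%N true)) vec1 = 0.
    by apply/eqP; move: V0; rewrite /Vxibar qf_avg => /eqP; rewrite mulf_eq0 invr_eq0 pnatr_eq0 orbF.
  by case: i; [apply: qt1|apply: qf1]; lra.
have mB k j i : measurable [set w | ((xi k j i w).1 + (xi k j i w).2)%N != 1%N].
  have mf : measurable_fun setT (fun w => ((xi k j i w).1 + (xi k j i w).2)%N != 1%N).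
    exact: (measurable_atoms_comp (F := fun v _ => (v.1 + v.2)%N != 1%N) (mxi k j i) (fun=> measurable_cst _)).
  have := mf measurableT [set true] I; rewrite setTI.
  by congr (measurable _); apply/seteqP; split => w /=; case: eqP.
(* The null event is transferred from one individual to all of its type, its probability being the
   integral of a function of the offspring vector. *)
have null k j i : P [set w | ((xi k j i w).1 + (xi k j i w).2)%N != 1%N] = 0%E.
  have iE k' j' : P [set w | ((xi k' j' i w).1 + (xi k' j' i w).2)%N != 1%N] =
      (\int[P]_w (if ((xi k' j' i w).1 + (xi k' j' i w).2)%N != 1%N then 1 else 0))%E.
    rewrite -[X in P X](setIT [set w | _]) -integral_indic//; apply: eq_integral => w _.
    by rewrite indicE; case: ifP => h; [rewrite mem_set|rewrite memNset//= h].
  rewrite -(null0 i) (iE k j) (iE 0%N 0%N).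
  apply: (ge0_integral_same_law (mxi k j i) (mxi 0%N 0%N i) (xi_law k j i)
    (f := fun v => if (v.1 + v.2)%N != 1%N then 1%E else 0%E)) => v.
  by case: ifP.
(* A single null event for all individuals of both types: outside it [unitize] changes no offspring
   vector, so the two processes have the same paths. *)
pose N := \bigcup_k \bigcup_j ([set w | ((xi k j false w).1 + (xi k j false w).2)%N != 1%N] `|`
  [set w | ((xi k j true w).1 + (xi k j true w).2)%N != 1%N]).
have mN : measurable N.
  by apply: bigcupT_measurable => k; apply: bigcupT_measurable => j; exact: measurableU.
have N0 : P N = 0%E.
  suff : P.-negligible N by move/negligibleP => ->.
  apply: negligible_bigcup => k; apply: negligible_bigcup => j.
  by apply: negligibleU; [exists [set w | ((xi k j false w).1 + (xi k j false w).2)%N != 1%N]|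
    exists [set w | ((xi k j true w).1 + (xi k j true w).2)%N != 1%N]]; split => //; exact: null.
pose xi' k j i w := unitize (xi k j i w).
have offN w : ~ N w -> forall k j i, xi' k j i w = xi k j i w.
  move=> Nw k j i; rewrite /xi' /unitize; case: eqP => // /eqP h; case: Nw.
  by exists k => //; exists j => //; case: i h => h; [right|left].
have mxi' k j i : discrete_rv (xi' k j i) by exact: discrete_unitize.
have lawE k j i v : P [set w | xi' k j i w = v] = P [set w | xi k j i w = v].
  apply: (measure_eq_off_null (mxi' k j i v) (mxi k j i v) mN N0) => w /offN Nw.
  by rewrite /= Nw.
have indY' : mutually_indep P (fun I : (nat * nat * bool + nat)%type =>
    match I with inl (k, j, i) => xi' k j i | inr k => eps k end).
  move=> s v us.
  transitivity (P (\bigcap_(i in [set` s]) [set w | (match i with inl (k, j, i) => xi k j i | inr k => eps k end) w = v i])).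
    apply: (measure_eq_off_null _ _ mN N0).
    - by apply: fin_bigcap_measurable => // -[[[k j] i]|k] _; [exact: mxi'|exact: meps].
    - by apply: fin_bigcap_measurable => // -[[[k j] i]|k] _; [exact: mxi|exact: meps].
    move=> w /offN Nw; split => h i si; have := h i si; case: i si => [[[k j] i]|k] si //=.
      by rewrite Nw.
    by rewrite Nw.
  by rewrite indY//; apply: eq_bigr => -[[[k j] i]|k] _.
have xi_law' k j i v : P [set w | xi' k j i w = v] = P [set w | xi' 0%N 0%N i w = v].
  by rewrite !lawE xi_law.
have unit' k j i w : ((xi' k j i w).1 + (xi' k j i w).2)%N = 1%N by exact: unitize_unit.
have mean' i : Ex P (fun w => (xi' 0%N 0%N i w).1%:R) = if i then beta else alpha.
  rewrite -(mean i).1.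
  exact: (Ex_same_law (mxi' 0%N 0%N i) (mxi 0%N 0%N i) (lawE 0%N 0%N i) (fun v => v.1%:R)).
have eps8 : L1 P (fun w => ((eps 0%N w).1%:R + (eps 0%N w).2%:R : R) ^+ 8).
  (* (a + b)^2 <= 2 (a^2 + b^2), raised to the fourth power. *)
  apply: (L1_moment8 (meps 0%N) e8' (f := fun v => (v.1%:R + v.2%:R) ^+ 8) (C := 2 ^+ 4)) => v.
  rewrite ger0_norm ?exprn_even_ge0// -exprMn (exprM _ 2 4).
  rewrite lerXn2r ?nnegrE ?sqr_ge0 ?mulr_ge0 ?addr_ge0 ?sqr_ge0// /sqnorm.
  by have := sqr_ge0 (v.1%:R - v.2%:R : R); rewrite sqrrB sqrrD; lra.
have core := process_cvg_dist mxi' meps indY' xi_law' eps_law unit' al0 be0 alb mean' eps8 W12.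
have Le := L1_cmp (meps 0%N) e8'.
have mUE : mu_eps ord0 ord0 + mu_eps ord_max ord0 = mU P eps.
  by rewrite !mxE /mU -ExD//; exact: Le.
have mVE : mu_eps ord0 ord0 - mu_eps ord_max ord0 = mV P eps.
  by rewrite !mxE /mV -ExB//; exact: Le.
have al1b : beta = 1 - alpha by lra.
have gamE : gam alpha beta = 4 * (alpha * beta) by rewrite /gam /delta al1b; ring.
(* The difference of the offspring counts squares to 1 and has mean [delta] or [- delta], so both
   types contribute 1 - delta^2 = 4 alpha beta. Hence in the limit the second coefficient is 1 and
   the fourth is the square root of gam. *)
have qfU : qf Vxibar util = gam alpha beta.
  have one i : qf (covmx P (xi 0%N 0%N i)) util = gam alpha beta.
    rewrite (qf_covmx (mxi 0%N 0%N i) (X8' i) (c := -1)) ?mxE//.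
    rewrite -(Ex_same_law (mxi' 0%N 0%N i) (mxi 0%N 0%N i) (lawE 0%N 0%N i) (fun v => (v.1%:R + -1 * v.2%:R) ^+ 2)).
    rewrite (@eq_Ex _ _ _ _ _ (fun=> 1)); last first.
      move=> w; have := unit' 0%N 0%N i w; move: (xi' _ _ _ w) => [a b] /=.
      by case: a b => [|[|a]] [|[|b]] //= _; ring.
    have Lx := L1_cmp (mxi 0%N 0%N i) (X8' i).
    rewrite Ex_cst (ExD (Lx ord0) (L1Z (-1) (Lx ord_max))) (ExZ _ (Lx ord_max)).
    have [-> ->] := mean i.
    by case: i {Lx}; rewrite /gam /delta; ring.
  by rewrite /Vxibar qf_avg !one; field.
have qfe : qf Veps vec1 = s2U P eps.
  rewrite (qf_covmx (meps 0%N) e8' (c := 1)) ?mxE//.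
  have uE w : (eps 0%N w).1%:R + 1 * (eps 0%N w).2%:R = immig eps 0 w by rewrite mul1r.
  under eq_Ex do rewrite uE.
  under [X in _ - X ^+ 2]eq_Ex do rewrite uE.
  rewrite -/(mU P eps) /s2U.
  have Li : L1 P (immig eps 0) by exact: (L1D (Le ord0) (Le ord_max)).
  have Li2 : L1 P (fun w => immig eps 0 w ^+ 2).
    apply: (L1_moment8 (meps 0%N) e8' (f := fun v => (v.1%:R + v.2%:R) ^+ 2) (C := 2)) => v.
    apply: le_trans (ler_wpM2l _ (sqnorm_le4 v)) => //.
    rewrite ger0_norm ?sqr_ge0// /sqnorm.
    by have := sqr_ge0 (v.1%:R - v.2%:R : R); rewrite sqrrB sqrrD; lra.
  rewrite (@eq_Ex _ _ _ _ (fun w => incU P eps 0 w ^+ 2) (fun w => immig eps 0 w ^+ 2 +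
      ((- 2 * mU P eps) * immig eps 0 w + mU P eps ^+ 2))); last by move=> w; rewrite /incU; ring.
  have Lc := L1_cst P (mU P eps ^+ 2); have Lz := L1Z (- 2 * mU P eps) Li.
  by rewrite (ExD Li2 (L1D Lz Lc)) (ExD Lz Lc) (ExZ _ Li) Ex_cst -/(mU P eps); ring.
have [vec1E vec1E'] : (vec1 : 'cV[R]_2) ord0 ord0 = 1 /\ (vec1 : 'cV[R]_2) ord_max ord0 = 1 by rewrite !mxE.
have [utilE utilE'] : (util : 'cV[R]_2) ord0 ord0 = 1 /\ (util : 'cV[R]_2) ord_max ord0 = -1 by rewrite !mxE.
have mXv k i : measurable_fun setT (fun w => Xv k w i ord0).
  under eq_fun do rewrite mxE.
  exact: (measurable_atoms_comp (F := fun v _ => cmp i v) (discrete_Xproc (R := R) k mxi meps) (fun=> measurable_cst _)).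
have minner u (F : Om -> 'cV[R]_2) : (forall i, measurable_fun setT (fun w => F w i ord0)) ->
    measurable_fun setT (fun w => inner u (F w)).
  by move=> mF; under eq_fun do rewrite /inner inner2; apply: measurable_funD; apply: measurable_funM.
have mM k i : measurable_fun setT (fun w => M k w i ord0).
  rewrite (_ : (fun w => _) = fun w => Xv k w i ord0 - \sum_j mx i j * Xv k.-1 w j ord0 - mu_eps i ord0); last first.
    by apply/funext => w; rewrite /M !mxE.
  apply: measurable_funB => //; apply: measurable_funB => //; apply: measurable_sum => j.
  exact: measurable_funM.
have mZn n i : measurable_fun setT (fun w => Zn n w ord0 i).
  under eq_fun do rewrite /Zn summxE.
  apply: measurable_sum => k; move: i; apply: measurable_row4; apply: measurable_funM => //;
    try (apply: measurable_funX); try (apply: measurable_funM => //); by apply: minner.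
have ZnE n w : ~ N w -> Zn n.+1 w = row4 (SA xi' eps n.+1 w) (SB xi' eps n.+1 w)
    (SC P xi' eps n.+1 w) (SD P xi' eps alpha beta n.+1 w).
  move=> /offN Nw.
  have XE k : Xproc xi eps k w = Xproc xi' eps k w by rewrite Xproc_unitize.
  have UE k : U k w = UU xi' eps k w by rewrite /U /inner inner2 !mxE !mul1r /cmp/= XE.
  have VE k : V k w = VV xi' eps k w by rewrite /V /inner inner2 !mxE mul1r mulN1r /cmp/= XE.
  have ME0 k : M k.+1 w ord0 ord0 = Xv k.+1 w ord0 ord0 -
      (alpha * Xv k w ord0 ord0 + beta * Xv k w ord_max ord0) - mu_eps ord0 ord0.
    by rewrite /M !mxE !big_ord_recr big_ord0/= !mxE/= add0r.
  have ME1 k : M k.+1 w ord_max ord0 = Xv k.+1 w ord_max ord0 -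
      (beta * Xv k w ord0 ord0 + alpha * Xv k w ord_max ord0) - mu_eps ord_max ord0.
    by rewrite /M !mxE !big_ord_recr big_ord0/= !mxE/= add0r.
  (* [vec1] and [util] are eigenvectors of the symmetric matrix [mx] with eigenvalues 1 and delta,
     so projecting [M] on them leaves the increment of U and the innovation of V. *)
  have aE k : inner vec1 (M k.+1 w) = incU P eps k w.
    have := @UU_step R _ _ _ eps unit' k w; rewrite -!UE /incU -mUE /U /inner !inner2 (ME0 k) (ME1 k) al1b.
    by rewrite vec1E vec1E' => e; lra.
  have bE k : inner util (M k.+1 w) = dX P xi' eps alpha beta k w.
    have := VV_step P xi' eps alpha beta k w; rewrite -!VE -mVE /V /inner !inner2 (ME0 k) (ME1 k) /delta al1b.
    by rewrite utilE utilE' => e; lra.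
  have [p3 p2 p32] := @powR_scalings R n.
  rewrite /Zn row4_sum p3 p2 p32; congr row4; rewrite /SA /SB /SC /SD mulr_sumr; apply: eq_bigr => j _ /=.
  - by rewrite UE /uh; ring.
  - by rewrite VE /vh exprMn [gg _ ^+ 2]ggE; ring.
  - by rewrite UE aE /uh; ring.
  - by rewrite VE bE /vh /dh -ggE; ring.
(* The shift drops n = 0, so that the powers of n are those of a positive number and agree with [hh]
   and [gg]. *)
move=> g cg gb; rewrite -(cvg_shiftS (fun n => Ex P (fun w => g (Zn n w)))).
have := core g cg gb.
have -> : Ex Q (fun w => g (row4 (mU P eps ^+ 2 / 3) (mU P eps / 2)
      (Num.sqrt (s2U P eps) * wiener_int (fun t => mU P eps * t) (Wtt^~ w))
      (Num.sqrt (gam alpha beta) * wiener_int (fun t => mU P eps * t) (Wt^~ w)))) = Ex Q (fun w => g (Z w)).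
  have YE t : Y t = mU P eps * t by rewrite /Y /inner inner2 !mxE !mul1r -mUE !mxE.
  apply: eq_Ex => w; congr g; rewrite /Z; congr row4.
  - by under eq_integral do rewrite YE; rewrite integral_sqr_linear.
  - under eq_integral do rewrite YE; rewrite integral_linear qfU gamE.
    by field; rewrite !gt_eqF.
  - by rewrite qfe (funext YE).
  - rewrite (funext YE) qfU gamE; congr (_ * _).
    have ab0 : 0 < alpha * beta by exact: mulr_gt0.
    have s0 : 0 < Num.sqrt (alpha * beta) by rewrite sqrtr_gt0.
    rewrite sqrtrM// (_ : 4 = 2 ^+ 2) ?sqrtr_sqr ?ger0_norm//; last by rewrite -natrX.
    have := sqr_sqrtr (ltW ab0); move: s0; move: (Num.sqrt _) => x x0 <-.
    by field; rewrite gt_eqF.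
have -> // : (fun n => Ex P (fun w => g (row4 (SA xi' eps n.+1 w) (SB xi' eps n.+1 w)
    (SC P xi' eps n.+1 w) (SD P xi' eps alpha beta n.+1 w)))) = (fun n => Ex P (fun w => g (Zn n.+1 w))).
apply/funext => n; apply: (Ex_ae _ _ mN _ N0).
- have [mA mB' mC mD] := measurable_process_sums P alpha beta mxi' meps unit' n.+1.
  by apply: measurable_continuous_rV => //; exact: measurable_row4.
- exact: measurable_continuous_rV.
- by move=> w; apply: contraNP => /ZnE ->; rewrite eqxx.
Qed.
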